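(* Let $n<p<\infty$ and let $S\subset\mathbb{R}^n$ be a closed set. A function $f:S\to\mathbb{R}$ can be extended to a (continuous) function $F\in L^1_p(\mathbb{R}^n)$ if and only if there exists a constant $\lambda>0$ such that for every finite family $\{Q_i: i=1,\dots,m\}$ of pairwise disjoint cubes in $\mathbb{R}^n$ and every choice of points $x_i,y_i\in(11Q_i)\cap S$ the inequality $$\sum_{i=1}^m\frac{|f(x_i)-f(y_i)|^p}{(\operatorname{diam}Q_i)^{p-n}}\le\lambda$$ holds. Moreover, $\|f\|_{L^1_p(\mathbb{R}^n)|_S}\sim\inf\lambda^{1/p}$ (the infimum over all such $\lambda$), with constants of equivalence depending only on $n$ and $p$.
   Context: Distances and diameters in $\mathbb{R}^n$ are measured in the norm $\|x\|=\max_i|x_i|$. A cube is a closed cube with sides parallel to the coordinate axes; for $\lambda>0$, $\lambda Q$ denotes the dilation of $Q$ about its center by the factor $\lambda$. $L^1_p(\mathbb{R}^n)$ is the homogeneous Sobolev space of functions whose first-order distributional partial derivatives are in $L_p(\mathbb{R}^n)$, with seminorm $\|F\|_{L^1_p(\mathbb{R}^n)}=\|\nabla F\|_{L_p(\mathbb{R}^n)}$. Since $p>n$, each element of $L^1_p(\mathbb{R}^n)$ is identified with its unique continuous representative. The trace space $L^1_p(\mathbb{R}^n)|_S$ consists of all $f:S\to\mathbb{R}$ for which there is a continuous $F\in L^1_p(\mathbb{R}^n)$ with $F|_S=f$, and $\|f\|_{L^1_p(\mathbb{R}^n)|_S}=\inf\{\|F\|_{L^1_p(\mathbb{R}^n)}: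 F\in L^1_p(\mathbb{R}^n)\text{ continuous},\ F|_S=f\}$. $A\sim B$ means $A/C\le B\le CA$ for a constant $C\ge1$. *)

(* Defs.v *)
From HB Require Import structures.
From mathcomp Require Import all_boot all_order all_algebra.
From mathcomp Require Import all_classical all_reals all_analysis.
Import Order.TTheory GRing.Theory Num.Theory.
Import numFieldNormedType.Exports.

Set Implicit Arguments.
Unset Strict Implicit.
Unset Printing Implicit Defensive.

Local Open Scope classical_set_scope.
Local Open Scope ring_scope.

(* 'rV[R]_n carries the sigma-algebra generated by the coordinates, i.e. the
   product (Borel) sigma-algebra.  Its norm in the library is the max-norm. *)
Definition rV_display : measure_display. Proof. exact: default_measure_display. Qed.

Section measurable_rV.
Context {R : realType} (n : nat).

Let coord : 'I_n -> 'rV[R]_n -> R := fun i x => x ord0 i.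

Let rV_set0 : g_sigma_preimage coord set0.
Proof. exact: sigma_algebra0. Qed.

Let rV_setC A : g_sigma_preimage coord A -> g_sigma_preimage coord (~` A).
Proof. exact: sigma_algebraC. Qed.

Let rV_bigcup (F : (set 'rV[R]_n)^nat) : (forall i, g_sigma_preimage coord (F i)) ->
  g_sigma_preimage coord (\bigcup_i (F i)).
Proof. exact: sigma_algebra_bigcup. Qed.

HB.instance Definition _ := @isMeasurable.Build rV_display
  'rV[R]_n (g_sigma_preimage coord) rV_set0 rV_setC rV_bigcup.

End measurable_rV.


Section rV_measurability.
Context {R : realType}.

Lemma measurable_coord n (i : 'I_n) :
  measurable_fun [set: 'rV[R]_n] (fun x : 'rV[R]_n => x ord0 i).
Proof.
move=> _ Y mY; rewrite setTI; apply: sub_sigma_algebra => /=.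
rewrite -bigcup_seq/=; exists i => /=; first by rewrite mem_index_enum.
by exists Y => //; rewrite setTI.
Qed.

Lemma measurable_fun_rVP d (T : measurableType d) n (f : T -> 'rV[R]_n) :
  measurable_fun setT f <->
  forall i, measurable_fun setT (fun t => f t ord0 i).
Proof.
split=> [mf i|mf].
  exact: (measurableT_comp (measurable_coord i) mf).
move=> _ Y mY; rewrite setTI.
suff : measurable `<=` [set A | measurable (f @^-1` A)] by exact.
apply: smallest_sub; first split.
- by rewrite /mkset preimage_set0; exact: measurable0.
- by move=> A; rewrite /mkset setTD preimage_setC; exact: measurableC.
- by move=> F mF; rewrite /mkset preimage_bigcup; exact: bigcupT_measurable.
move=> A; rewrite -bigcup_seq/= => -[i _] [B mB <-].
by rewrite setTI -comp_preimage -[X in measurable X]setTI; exact: mf.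
Qed.

End rV_measurability.

Section lebesgue_measure_rV.
Context {R : realType}.

Definition rV_cons n (z : measurableTypeR R * 'rV[R]_n) : 'rV[R]_n.+1 :=
  \row_j if unlift ord0 j is Some k then z.2 ord0 k else z.1.

Definition rV_uncons n (x : 'rV[R]_n.+1) : measurableTypeR R * 'rV[R]_n :=
  (x ord0 ord0, \row_k x ord0 (lift ord0 k)).

Lemma rV_consK n : cancel (@rV_cons n) (@rV_uncons n).
Proof.
case=> a v; rewrite /rV_uncons /rV_cons mxE unlift_none/=; congr (_, _).
by apply/rowP => k; rewrite !mxE liftK.
Qed.

Lemma rV_unconsK n : cancel (@rV_uncons n) (@rV_cons n).
Proof.
move=> x; apply/rowP => j; rewrite mxE.
by case: unliftP => [k|] -> //=; rewrite mxE.
Qed.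

Lemma measurable_rV_cons n : measurable_fun setT (@rV_cons n).
Proof.
apply/measurable_fun_rVP => j; case: (unliftP ord0 j) => [k|] ->.
  rewrite (_ : (fun _ => _) = (fun x : 'rV[R]_n => x ord0 k) \o snd).
    exact: measurableT_comp (measurable_coord k) measurable_snd.
  by apply/funext => z /=; rewrite mxE liftK.
rewrite (_ : (fun _ => _) = fst); first exact: measurable_fst.
by apply/funext => z /=; rewrite mxE unlift_none.
Qed.

Lemma measurable_rV_uncons n : measurable_fun setT (@rV_uncons n).
Proof.
apply/measurable_fun_pairP; split; first exact: measurable_coord.
apply/measurable_fun_rVP => k.
under eq_fun do rewrite /= mxE.
exact: measurable_coord.
Qed.

Section step.
Variables (n : nat) (m : {sigma_finite_measure set 'rV[R]_n -> \bar R}).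

Definition lebesgue_rV_step : set 'rV[R]_n.+1 -> \bar R :=
  pushforward (@lebesgue_measure R \x m)%E (@rV_cons n).

Let step0 : lebesgue_rV_step set0 = 0%E.
Proof. by rewrite /lebesgue_rV_step /pushforward preimage_set0 measure0. Qed.

Let step_ge0 A : (0 <= lebesgue_rV_step A)%E.
Proof. exact: (measure_ge0 (@lebesgue_measure R \x m)%E). Qed.

Let step_sigma_additive : semi_sigma_additive lebesgue_rV_step.
Proof.
have mc A : measurable A -> measurable (@rV_cons n @^-1` A).
  by move=> mA; rewrite -[X in measurable X]setTI; exact: measurable_rV_cons.
move=> F mF tF mUF; rewrite /lebesgue_rV_step /pushforward preimage_bigcup.
apply: measure_semi_sigma_additive; first by move=> k; exact: mc.
- apply/trivIsetP => /= i j _ _ ij; rewrite -preimage_setI.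
  by move/trivIsetP : tF => /(_ _ _ _ _ ij) ->//; rewrite preimage_set0.
- by rewrite -preimage_bigcup; exact: mc.
Qed.

HB.instance Definition _ := isMeasure.Build _ _ _ lebesgue_rV_step
  step0 step_ge0 step_sigma_additive.

Let sigma_finite_step : sigma_finite setT lebesgue_rV_step.
Proof.
have /sigma_finiteP[F [FT ndF mF]] := sigma_finiteT (@lebesgue_measure R).
have /sigma_finiteP[G [GT ndG mG]] := sigma_finiteT m.
exists (fun k => @rV_uncons n @^-1` (F k `*` G k)).
  apply/esym; rewrite -subTset => x _.
  have [i _ Fi] : (\bigcup_i F i) (rV_uncons x).1 by rewrite -FT.
  have [j _ Gj] : (\bigcup_j G j) (rV_uncons x).2 by rewrite -GT.
  exists (maxn i j) => //; split.
    by have /subsetPset := ndF _ _ (leq_maxl i j); exact.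
  by have /subsetPset := ndG _ _ (leq_maxr i j); exact.
move=> k; have [mFk Fk] := mF k; have [mGk Gk] := mG k; split.
  rewrite -[X in measurable X]setTI; apply: measurable_rV_uncons => //.
  exact: measurableX.
rewrite /lebesgue_rV_step /pushforward -comp_preimage.
rewrite (_ : _ \o _ = id); last by apply/funext => z; exact: rV_consK.
by rewrite preimage_id product_measure1E// lte_mul_pinfty// ge0_fin_numE.
Qed.

HB.instance Definition _ := Measure_isSigmaFinite.Build _ _ _
  lebesgue_rV_step sigma_finite_step.

End step.

Fixpoint lebesgue_rV n : {sigma_finite_measure set 'rV[R]_n -> \bar R} :=
  match n with
  | 0 => dirac (0 : 'rV[R]_0)
  | n'.+1 => lebesgue_rV_step (lebesgue_rV n')
  end.

Lemma lebesgue_rV_box n (A : 'I_n -> set R) :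
  (forall i, measurable (A i)) ->
  lebesgue_rV n [set x : 'rV[R]_n | forall i, A i (x ord0 i)] =
  (\prod_(i < n) lebesgue_measure (A i))%E.
Proof.
have box_measurable k (B : 'I_k -> set R) : (forall i, measurable (B i)) ->
    measurable [set x : 'rV[R]_k | forall i, B i (x ord0 i)].
  move=> mB; rewrite (_ : mkset _ =
      \bigcap_(i in [set: 'I_k]) ((fun x : 'rV[R]_k => x ord0 i) @^-1` B i)).
    apply: fin_bigcap_measurable => // i _.
    by rewrite -[X in measurable X]setTI; exact: measurable_coord.
  by apply/seteqP; split => x /= Bx i; [move=> _|]; exact: Bx.
elim: n A => [|n IHn] A mA.
  by rewrite big_ord0 /= diracE mem_set//= => -[].
rewrite big_ord_recl -IHn; last by move=> i; exact: mA.
rewrite -product_measure1E; [|exact: mA|]; last first.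
  exact: (box_measurable _ (fun i => A (lift ord0 i))).
rewrite /= /lebesgue_rV_step /pushforward; congr (product_measure1 _ _ _).
apply/seteqP; split=> [[a v] /= Av|[a v] /= [Aa Av] i].
  split=> [|i]; first by have := Av ord0; rewrite mxE unlift_none.
  by have := Av (lift ord0 i); rewrite mxE liftK.
by rewrite mxE; case: unliftP => [k|] ->.
Qed.

End lebesgue_measure_rV.

Section sobolev.
Context {R : realType} {n : nat}.
Local Notation mu := (@lebesgue_rV R n).
Implicit Types (F f phi : 'rV[R]_n -> R) (G : 'rV[R]_n -> 'rV[R]_n).

Definition partial (i : 'I_n) f : 'rV[R]_n -> R :=
  fun x => 'D_(delta_mx ord0 i) f x.

Definition smooth f := forall s : seq 'I_n,
  let g := foldr partial f s in
  continuous g /\ forall i x, derivable g x (delta_mx ord0 i).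

Definition test_function phi :=
  smooth phi /\
  exists2 K : set 'rV[R]_n, compact K & forall x, ~ K x -> phi x = 0.

Definition locally_integrable_rV F := forall K : set 'rV[R]_n,
  compact K -> mu.-integrable K (EFin \o F).

Definition weak_partial (i : 'I_n) F (g : 'rV[R]_n -> R) :=
  forall phi, test_function phi ->
  (\int[mu]_x (F x * partial i phi x)%:E = - \int[mu]_x (g x * phi x)%:E)%E.

(* G represents the distributional gradient of F, and G is in L_p. *)
Definition Lp_gradient (p : R) F G :=
  locally_integrable_rV F /\
  forall i, (fun x => G x ord0 i) \in Lfun mu p%:E /\
            weak_partial i F (fun x => G x ord0 i).

Definition L1p (p : R) F := exists G, Lp_gradient p F G.

(* The seminorm ||grad F||_{L_p} as a relation: grad F is only determined up
   to a null set, and any representative gives the same value v. *)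
Definition L1p_seminorm (p : R) F (v : \bar R) :=
  exists2 G, Lp_gradient p F G & v = Lnorm mu p%:E (fun x => `|G x|%:E).

(* A function on S is a total function of which only the values on S matter. *)
Definition extends (S : set 'rV[R]_n) f F := forall x, S x -> F x = f x.

Definition in_trace (p : R) (S : set 'rV[R]_n) f :=
  exists F, [/\ continuous F, L1p p F & extends S f F].

Definition trace_norm (p : R) (S : set 'rV[R]_n) f : \bar R :=
  ereal_inf [set v | exists F,
    [/\ continuous F, L1p_seminorm p F v & extends S f F]].

End sobolev.

Record cube (R : realType) (n : nat) := Cube {
  center : 'rV[R]_n;
  radius : R;
  radius_gt0 : 0 < radius }.

Section cubes.
Context {R : realType} {n : nat}.
Implicit Types (Q : cube R n) (S : set 'rV[R]_n).

(* Closed balls of the max-norm are exactly the closed axis-parallel cubes. *)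
Definition cube_set Q : set 'rV[R]_n :=
  [set x | `|x - center Q| <= radius Q].

Definition dilate (a : R) Q : set 'rV[R]_n :=
  [set x | `|x - center Q| <= a * radius Q].

Definition diam (A : set 'rV[R]_n) : R :=
  sup [set `|z.1 - z.2| | z in A `*` A].

Definition packing_bound (p : R) S (f : 'rV[R]_n -> R) (lam : R) :=
  forall (m : nat) (Q : 'I_m -> cube R n) (x y : 'I_m -> 'rV[R]_n),
    trivIset setT (fun i => cube_set (Q i)) ->
    (forall i, (dilate 11 (Q i) `&` S) (x i)) ->
    (forall i, (dilate 11 (Q i) `&` S) (y i)) ->
    \sum_(i < m) (`|f (x i) - f (y i)| `^ p
                  / diam (cube_set (Q i)) `^ (p - n%:R)) <= lam.

Definition packing_norm (p : R) S (f : 'rV[R]_n -> R) : \bar R :=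
  ereal_inf [set (lam `^ p^-1)%:E |
    lam in [set lam | 0 < lam /\ packing_bound p S f lam]].

End cubes.

(* Main.v *)
(* Sufficiency.  Off [S], the extension at [x] averages, over radii [r] between
   [(1 + 1/50) d] and [(1 + 2/50) d] with [d := dist(x, S)], the infimum of [f] on
   [S] within distance [r] of [x].  That infimum is merely monotone in [r]; averaging
   turns monotonicity into the increment bound [|F y - F x| <= C (|x - y| / d) osc],
   where [osc] is the oscillation of [f] near [x] at scale [d].  Covering by a Vitali
   family of cubes, the packing condition bounds
   [\int |F (x + t e_i) - F x|^p] by [C lam t^p].  The difference quotients are
   then bounded in [L_p], and uniform convexity makes suitable midpoint combinations
   of them converge strongly in [L_p]; the limit is the weak derivative.

   Necessity.  Two product kernels at scales [r] and [r/2] differ by the divergence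
   of a compactly supported smooth field, so telescoping over dyadic scales gives
   Morrey's inequality on a cube of radius [r] with any exponent [q > n].  Choosing
   [n < q < p], a strong-type maximal inequality with exponent [p/q] sums these
   bounds over disjoint cubes. *)

Require Import Defs.
From mathcomp Require Import all_boot all_order all_algebra.
From mathcomp Require Import all_classical all_reals all_analysis.
From mathcomp Require Import measurable_realfun ring lra.
Import Order.TTheory GRing.Theory Num.Theory.
Import numFieldNormedType.Exports.

Set Implicit Arguments.
Unset Strict Implicit.
Unset Printing Implicit Defensive.

Local Open Scope classical_set_scope.
Local Open Scope ring_scope.

(** Taking infima of [f] over balls replaces a Whitney partition of unity: values at two points are
    compared through inclusion of balls alone, so everything reduces to oscillations of [f], which
    is what the packing condition controls. Points closer to [S] than the translation length [t]
    have no usable scale of their own; [D := max(200 t, dist)] is 1-Lipschitz and positive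
    everywhere, including on [S]. With Vitali balls of radius [r = D / 4] at their centres, the
    balls of radius [3 r] cover, [D <= 7 r] on them, and the data used there lie within
    [3 r + (11 / 10) 7 r = 10.7 r] of the centre: this is the origin of the dilation factor 11.
    Uniform convexity does the work of weak compactness: the identity defining a weak derivative is
    affine in the derivative, hence stable under midpoints. In the necessity part, Morrey's
    inequality with exponent [p] would leave integrals over the dilated cubes, which may overlap
    without bound although the cubes are disjoint. The maximal inequality pays for this overlap, and
    it needs an exponent [p / q > 1]. *)

(** * Cubes as max-norm balls, their volume, and Borel sets *)

Section rV_norm.
Context {R : realType} {n : nat}.
Implicit Types (x c : 'rV[R]_n) (r : R).

Lemma coord_le_norm x i : `|x ord0 i| <= `|x|.
Proof.
rewrite [leRHS]/Num.norm /= mx_normrE.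
by apply/bigmax_geP; right => /=; exists (ord0, i).
Qed.

Lemma rV_norm_leP x r : 0 <= r -> reflect (forall i, `|x ord0 i| <= r) (`|x| <= r).
Proof.
move=> r0; apply: (iffP idP) => [xr i|xr].
  exact: le_trans (coord_le_norm x i) xr.
rewrite [leLHS]/Num.norm /= mx_normrE; apply/bigmax_leP; split => // -[i j] _ /=.
by rewrite (ord1 i).
Qed.

Lemma norm_delta_mx (i : 'I_n) : `|delta_mx ord0 i : 'rV[R]_n| = 1.
Proof.
apply/eqP; rewrite eq_le; apply/andP; split.
  apply/rV_norm_leP => // j; rewrite mxE.
  by case: (_ && _); rewrite ?normr1 ?normr0.
by rewrite -[leLHS](@normr1 R) (le_trans _ (coord_le_norm _ i))// mxE !eqxx.
Qed.

Definition cball c r : set 'rV[R]_n := [set x | `|x - c| <= r].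

Lemma cballE c r : 0 <= r ->
  cball c r = [set x | forall i, `[c ord0 i - r, c ord0 i + r]%classic (x ord0 i)].
Proof.
move=> r0; apply/seteqP; split => x /=.
  move/(rV_norm_leP _ r0) => xr i; have := xr i.
  by rewrite !mxE ler_distl in_itv/=.
move=> xr; apply/(rV_norm_leP _ r0) => i; have := xr i.
by rewrite !mxE ler_distl in_itv/=.
Qed.

Lemma measurable_box (A : 'I_n -> set R) : (forall i, measurable (A i)) ->
  measurable [set x : 'rV[R]_n | forall i, A i (x ord0 i)].
Proof.
move=> mA; rewrite (_ : mkset _ =
    \bigcap_(i in [set: 'I_n]) ((fun x : 'rV[R]_n => x ord0 i) @^-1` A i)).
  apply: fin_bigcap_measurable => // i _.
  by rewrite -[X in measurable X]setTI; exact: measurable_coord.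
by apply/seteqP; split => x /= Bx i; [move=> _|]; exact: Bx.
Qed.

Lemma measurable_cball c r : measurable (cball c r).
Proof.
have [r0|r0] := leP 0 r; last first.
  rewrite (_ : cball c r = set0) //; apply/seteqP; split => x //=.
  by move=> /le_lt_trans - /(_ _ r0); rewrite normr_lt0.
rewrite cballE//; apply: (measurable_box (A := fun i => `[c ord0 i - r, c ord0 i + r]%classic)) => i.
exact: measurable_itv.
Qed.

Lemma lebesgue_rV_cball c r : 0 <= r ->
  lebesgue_rV n (cball c r) = ((2 * r) ^+ n)%:E.
Proof.
move=> r0; rewrite cballE//.
rewrite (lebesgue_rV_box (A := fun i => `[c ord0 i - r, c ord0 i + r]%classic)); last first.
  by move=> i; exact: measurable_itv.
under eq_bigr do rewrite lebesgue_measure_itv/= lte_fin.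
rewrite (eq_bigr (fun=> (2 * r)%:E)).
  by rewrite prodEFin big_const_ord iter_mulr_1.
move=> i _; case: ifPn => [_|]; first by rewrite -EFinB; congr EFin; ring.
by rewrite -leNgt => h; congr EFin; lra.
Qed.

Lemma continuous_dist_to c : continuous (fun x : 'rV[R]_n => `|x - c|).
Proof.
move=> x; apply: (@cvg_norm _ _ _ (nbhs x)).
by apply: cvgB; [exact: cvg_id|exact: cvg_cst].
Qed.

Lemma compact_cball c r : compact (cball c r).
Proof.
apply: bounded_closed_compact.
  exists (`|c| + r); split; first exact: num_real.
  move=> M cM x /= xcr; apply: le_trans (ltW cM).
  by rewrite -[x](subrK c) (le_trans (ler_normD _ _))// addrC lerD2l.
apply: (@closed_comp _ _ (fun x : 'rV[R]_n => `|x - c|) [set y | y <= r]).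
  move=> x _; exact: continuous_dist_to.
exact: closed_le.
Qed.

(** The sigma-algebra is generated by the coordinates, so open sets have to be recovered from boxes:
    [U] is the countable union of the cubes with rational centre and radius [1 / (k + 1)] that it
    contains. *)
Lemma measurable_rV_open (U : set 'rV[R]_n) : open U -> measurable U.
Proof.
move=> oU.
pose q (v : 'rV[rat]_n) : 'rV[R]_n := map_mx ratr v.
pose I := [set vk : 'rV[rat]_n * nat | cball (q vk.1) vk.2.+1%:R^-1 `<=` U].
rewrite (_ : U = \bigcup_(vk in I) cball (q vk.1) vk.2.+1%:R^-1).
  rewrite bigcup_mkcond; apply: countable_bigcupT_measurable.
    exact: countableP.
  by move=> vk; case: ifPn => // _; exact: measurable_cball.
apply/seteqP; split => [x Ux|x [vk /= h xk]]; last exact: h.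
have /nbhs_ballP[e /= e0 eU] : nbhs x U by exact: open_nbhs_nbhs.
(* The factor 2 is one radius to move from [x] to the rational centre and one to reach any other
   point of the cube. *)
have [k ke] : exists k, 2 * k.+1%:R^-1 < e.
  have e20 : 0 < e / 2 by rewrite divr_gt0.
  have [k _ /(_ k (leqnn k))/= ke] := near_infty_natSinv_lt (PosNum e20).
  by exists k; rewrite mulrC -ltr_pdivlMr.
have [v xv] : exists v : 'rV[rat]_n, forall i, `|x ord0 i - q v ord0 i| <= k.+1%:R^-1.
  have /choice[v xv] : forall i, exists r : rat, `|x ord0 i - ratr r| <= k.+1%:R^-1.
    move=> i; have [|r] := @rat_in_itvoo R (x ord0 i - k.+1%:R^-1) (x ord0 i + k.+1%:R^-1).
      by rewrite ltrBlDr -addrA ltrDl addr_gt0.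
    rewrite in_itv/= => /andP[r1 r2]; exists r.
    by rewrite distrC ler_distl (ltW r1) (ltW r2).
  by exists (\row_i v i) => i; rewrite !mxE.
exists (v, k) => /=.
  move=> y /= yv; apply: eU; rewrite -ball_normE /=.
  rewrite -(subrK (q v) x) -addrA (le_lt_trans (ler_normD _ _))//.
  apply: le_lt_trans ke; rewrite mulr_natl mulr2n lerD//.
    by apply/rV_norm_leP => // i; have := xv i; rewrite !mxE.
  by rewrite distrC.
by apply/rV_norm_leP => // i; have := xv i; rewrite !mxE.
Qed.

Lemma continuous_measurable_rV (F : 'rV[R]_n -> R) :
  continuous F -> measurable_fun [set: 'rV[R]_n] F.
Proof.
move=> cF; apply: (measurability _ (RGenOpens.measurableE R)).
move=> _ [_ [a [b ->] <-]]; rewrite setTI; apply: measurable_rV_open.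
by apply: open_comp => [x _|]; [exact: cF|exact: interval_open].
Qed.

End rV_norm.

(** * Translation invariance of Lebesgue measure and of integrals *)

Section translation.
Context {R : realType}.
Local Open Scope ereal_scope.

Lemma lebesgue_measure_shift (c : R) (A : set R) : measurable A ->
  lebesgue_measure ((fun x => x + c)%R @^-1` A) = lebesgue_measure A.
Proof.
move=> mA.
have mc : measurable_fun setT (fun x : measurableTypeR R => x + c : measurableTypeR R)%R.
  exact: measurable_funD.
pose m := pushforward (@lebesgue_measure R) (fun x : measurableTypeR R => x + c : measurableTypeR R)%R.
apply/esym. rewrite -[RHS]/(m A).
apply: (@lebesgue_measure_unique R m) => //= _ [[a b]] _ <-.
rewrite /m /pushforward.
rewrite (_ : _ @^-1` _ = `](a - c)%R, (b - c)%R]%classic); last first.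
  by apply/seteqP; split => x /=; rewrite !in_itv/= ltrBlDr lerBrDr.
rewrite !lebesgue_measure_itv/= !lte_fin ltrD2r; case: ifPn => // _.
by congr EFin; ring.
Qed.

Lemma measurable_rV_shift n (c : 'rV[R]_n) :
  measurable_fun setT (fun x : 'rV[R]_n => x + c)%R.
Proof.
apply/measurable_fun_rVP => i; under eq_fun do rewrite mxE.
by apply: measurable_funD => //; exact: measurable_coord.
Qed.

(** Uniqueness of measures: both sides agree on measurable boxes, which are stable under
    intersection and generate the sigma-algebra, and the cubes of integer radius exhaust the space
    with finite measure. *)
Lemma lebesgue_rV_shift n (c : 'rV[R]_n) (A : set 'rV[R]_n) : measurable A ->
  lebesgue_rV n ((fun x => x + c)%R @^-1` A) = lebesgue_rV n A.
Proof.
move=> mA; apply/esym.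
pose m := pushforward (lebesgue_rV n) (fun x : 'rV[R]_n => x + c)%R.
rewrite -[RHS]/(m A).
pose box (B : 'I_n -> set R) := [set x : 'rV[R]_n | forall i, B i (x ord0 i)].
pose G := [set box B | B in [set B : 'I_n -> set R | forall i, measurable (B i)]].
have mbox B : (forall i, measurable (B i)) -> measurable (box B) by exact: measurable_box.
apply: (measure_unique G (fun k => cball 0 k%:R)) => //.
- apply/seteqP; split; last first.
    by apply: smallest_sub; [exact: sigma_algebra_measurable|move=> _ [B mB <-]; exact: mbox].
  apply: smallest_sub; first exact: smallest_sigma_algebra.
  move=> A0; rewrite -bigcup_seq/= => -[i _] [B mB <-].
  apply: sub_sigma_algebra; exists (fun j => if j == i then B else setT).
    by move=> j; case: ifP.
  rewrite setTI; apply/seteqP; split => x /=; first by move=> /(_ i); rewrite eqxx.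
  by move=> Bx j; case: eqP => // ->.
- move=> _ _ [B mB <-] [C mC <-]; exists (fun i => B i `&` C i).
    by move=> i; exact: measurableI.
  apply/seteqP; split => x /=.
    by move=> BC; split=> i; have [] := BC i.
  by move=> [Bx Cx] i.
- move=> k; rewrite cballE//.
  by exists (fun i : 'I_n => `[(0 : 'rV[R]_n) ord0 i - k%:R, (0 : 'rV[R]_n) ord0 i + k%:R]%classic)%R.
- rewrite -subTset => x _; exists (Num.truncn `|x|).+1 => //.
  by rewrite /cball/= subr0 ltW// truncnS_gt.
- exact: measurable_rV_shift.
- move=> mc _ [B mB <-]; rewrite /m /pushforward/=.
  transitivity (lebesgue_rV n (box (fun i => (fun t => t + c ord0 i)%R @^-1` B i))).
    2: by congr (lebesgue_rV n _); apply/seteqP; split => x /= Bx i; have := Bx i; rewrite mxE.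
  rewrite !lebesgue_rV_box//.
    by apply: eq_bigr => i _; rewrite lebesgue_measure_shift.
  move=> i; rewrite -[X in measurable X]setTI.
  have mi : measurable_fun setT (fun t : measurableTypeR R => t + c ord0 i)%R.
    exact: measurable_funD.
  exact: mi.
- move=> k; have := @lebesgue_rV_cball R n 0 k%:R (ler0n _ _).
  by move=> h; rewrite [X in X < _]h ltry.
Qed.

Lemma integral_rV_shift n (c : 'rV[R]_n) (f : 'rV[R]_n -> \bar R) :
  measurable_fun setT f ->
  \int[lebesgue_rV n]_x f (x + c)%R = \int[lebesgue_rV n]_x f x.
Proof.
move=> mf; have mc := @measurable_rV_shift n c.
have H g : measurable_fun setT g -> (forall x, 0 <= g x) ->
    \int[lebesgue_rV n]_x g (x + c)%R = \int[lebesgue_rV n]_x g x.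
  move=> mg g0; have := @ge0_integral_pushforward _ _ _ _ _ _ mc (lebesgue_rV n) setT g.
  rewrite preimage_setT => /(_ measurableT mg (fun x _ => g0 x)) => <-.
  by apply: eq_measure_integral => A mA _; exact: lebesgue_rV_shift.
rewrite [LHS]integralE [RHS]integralE; congr (_ - _).
  rewrite -[in RHS]H//; first by rewrite -/(f \o (fun x => x + c)%R) funepos_comp.
  exact: measurable_funepos.
rewrite -[in RHS]H//; first by rewrite -/(f \o (fun x => x + c)%R) funeneg_comp.
exact: measurable_funeneg.
Qed.

End translation.

(** * Integrals of nonnegative real-valued functions *)

Section nonneg_integrals.
Context d (T : measurableType d) (R : realType) (mu : {measure set T -> \bar R}).
Implicit Types f g : T -> R.
Local Notation "'\I' f" := (\int[mu]_x (f x)%:E)%E (at level 10, f at level 8).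

Lemma ge0_le_int f g : measurable_fun setT f -> measurable_fun setT g ->
  (forall x, 0 <= f x) -> (forall x, f x <= g x) -> (\I f <= \I g)%E.
Proof.
move=> mf mg f0 fg; apply: ge0_le_integral => //.
- by move=> x _; rewrite lee_fin.
- exact/measurable_EFinP.
- exact/measurable_EFinP.
- by move=> x _; rewrite lee_fin.
Qed.

Lemma ge0_intZ (k : R) f : measurable_fun setT f -> (forall x, 0 <= f x) -> 0 <= k ->
  (\I (fun x => k * f x)%R = k%:E * \I f)%E.
Proof.
move=> mf f0 k0; under eq_integral do rewrite EFinM.
apply: ge0_integralZl_EFin => //; last exact/measurable_EFinP.
by move=> x _; rewrite lee_fin.
Qed.

Lemma ge0_intD f g : measurable_fun setT f -> measurable_fun setT g ->
  (forall x, 0 <= f x) -> (forall x, 0 <= g x) ->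
  (\I (fun x => f x + g x)%R = \I f + \I g)%E.
Proof.
move=> mf mg f0 g0; under eq_integral do rewrite EFinD.
apply: ge0_integralD => //.
- by move=> x _; rewrite lee_fin.
- exact/measurable_EFinP.
- by move=> x _; rewrite lee_fin.
- exact/measurable_EFinP.
Qed.

Lemma ge0_int_sum I (s : seq I) (P : pred I) (f : I -> T -> R) :
  (forall i, measurable_fun setT (f i)) -> (forall i x, 0 <= f i x) ->
  (\I (fun x => \sum_(i <- s | P i) f i x)%R = \sum_(i <- s | P i) \I (f i))%E.
Proof.
move=> mf f0; rewrite -big_filter.
under eq_integral do rewrite -big_filter -sumEFin.
apply: ge0_integral_sum => //; first by move=> i; exact/measurable_EFinP.
by move=> i x _; rewrite lee_fin.
Qed.

Lemma measurable_sum_cond I (s : seq I) (P : pred I) (f : I -> T -> R) :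
  (forall i, measurable_fun setT (f i)) ->
  measurable_fun setT (fun x => \sum_(i <- s | P i) f i x).
Proof.
move=> mf; under eq_fun do rewrite -big_filter.
exact: measurable_sum.
Qed.

Lemma int_indic (A : set T) : measurable A -> (\I (fun x => \1_A x)%R = mu A)%E.
Proof. by move=> mA; rewrite integral_indic// setIT. Qed.

End nonneg_integrals.

(** * Covering and maximal inequalities *)

Section vitali.
Context {R : realType} {n : nat}.

Lemma indic_trivIset_sum_le1 (T : Type) (I : finType) (J : {set I}) (B : I -> set T) x :
  (forall i j, i \in J -> j \in J -> i != j -> B i `&` B j = set0) ->
  \sum_(i in J) \1_(B i) x <= 1 :> R.
Proof.
move=> dJ.
have [[i iJ Bix]|noB] := pselect (exists2 i, i \in J & B i x).
  rewrite (bigD1 i)//= big1 ?addr0.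
    by rewrite indicE; case: (_ \in _).
  move=> j /andP[jJ ji]; rewrite indicE memNset// => Bjx.
  by have := dJ _ _ jJ iJ ji; apply/eqP/set0P; exists x.
rewrite big1// => i iJ; rewrite indicE memNset// => Bix.
by apply: noB; exists i.
Qed.

(** Greedy selection: keep a ball of largest radius, discard those that come near it, and recurse on
    the rest, which has smaller cardinality. *)
Lemma vitali_finite (I : finType) (c : I -> 'rV[R]_n) (r : I -> R) (A : {set I}) :
  (forall i, 0 <= r i) ->
  exists2 J : {set I}, J \subset A &
    (forall i j, i \in J -> j \in J -> i != j -> cball (c i) (r i) `&` cball (c j) (r j) = set0) /\
    (forall i, i \in A -> exists2 j, j \in J & cball (c i) (r i) `<=` cball (c j) (3 * r j)).
Proof.
move=> r0.
(* Disjointness and covering are traded for inequalities between centres and radii, which are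
   boolean and can define the remaining set [A']. *)
suff [J JA [dJ cJ]] : exists2 J : {set I}, J \subset A &
    (forall i j, i \in J -> j \in J -> i != j -> r i + r j < `|c i - c j|) /\
    (forall i, i \in A -> exists2 j, j \in J & r i <= r j /\ `|c i - c j| <= r i + r j).
  exists J => //; split=> [i j iJ jJ ij|i /cJ[j jJ [rij cij]]].
    rewrite -subset0 => x [/= xi xj]; have := dJ _ _ iJ jJ ij.
    rewrite ltNge => /negP; apply; rewrite -(subrK x (c i)) -addrA.
    by rewrite (le_trans (ler_normD _ _))// distrC lerD.
  exists j => // x; rewrite /cball/= => xi; rewrite -(subrK (c i) x) -addrA.
  by rewrite (le_trans (ler_normD _ _))//; lra.
have [k] := ubnP #|A|; elim: k A => // k IH A Ak.
have [->|[i0 i0A]] := set_0Vmem A.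
  exists finset.set0; first exact: finset.sub0set.
  by split=> [i j|i]; rewrite finset.in_set0.
pose i1 := [arg max_(i > i0 in A) r i]%O.
have [i1A ri1] : i1 \in A /\ forall j, j \in A -> r j <= r i1.
  by rewrite /i1; case: arg_maxP.
pose A' := [set i in A | r i + r i1 < `|c i - c i1|].
have A'A : A' \subset A by apply/fintype.subsetP => i; rewrite inE => /andP[].
have i1A' : i1 \notin A'.
  by rewrite inE subrr normr0 negb_and -leNgt addr_ge0// orbT.
have [|J JA' [dJ cJ]] := IH A'.
  rewrite -ltnS (leq_trans _ Ak)// ltnS; apply: proper_card.
  by apply/properP; split => //; exists i1.
exists (i1 |: J)%SET.
  by rewrite finset.subUset finset.sub1set i1A (fintype.subset_trans JA').
split=> [i j|i iA].
  rewrite !finset.in_setU1 => /orP[/eqP ->|iJ] /orP[/eqP ->|jJ].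
  - by rewrite eqxx.
  - by move/fintype.subsetP: JA' => /(_ _ jJ); rewrite inE => /andP[_]; rewrite distrC addrC.
  - by move/fintype.subsetP: JA' => /(_ _ iJ); rewrite inE => /andP[_].
  - exact: dJ.
have [iA'|] := boolP (i \in A').
  by have [j jJ h] := cJ _ iA'; exists j => //; rewrite finset.in_setU1 jJ orbT.
rewrite inE iA/= -leNgt => h; exists i1; first by rewrite finset.in_setU1 eqxx.
by split=> //; exact: ri1.
Qed.

End vitali.

(** * A maximal inequality for finite families of disjoint cubes *)

Section hardy_littlewood.
Context {R : realType} {n : nat}.
Local Notation mu := (@lebesgue_rV R n).
Local Notation "'\I' f" := (\int[mu]_x (f x)%:E)%E (at level 10, f at level 8).

Lemma measurable_indic_cball (c : 'rV[R]_n) (r : R) :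
  measurable_fun setT (\1_(cball c r) : 'rV[R]_n -> R).
Proof. by apply: measurable_indic; exact: measurable_cball. Qed.

Lemma int_indic_cball (c : 'rV[R]_n) (r : R) : 0 <= r ->
  (\I (fun x => \1_(cball c r) x)%R = ((2 * r) ^+ n)%:E)%E.
Proof.
by move=> r0; rewrite int_indic; [exact: lebesgue_rV_cball|exact: measurable_cball].
Qed.

(** Volumes are compared by integrating sums of indicators: the sum over the disjoint small balls is
    at most 1, and wherever it is nonzero some selected ball, enlarged threefold, contains the
    point. *)
Lemma measure_packing_le (I : finType) (c : I -> 'rV[R]_n) (r : I -> R) (L : R) (A : {set I}) :
  (forall i, 0 < r i) -> 1 <= L ->
  (forall i j, i != j -> cball (c i) (r i) `&` cball (c j) (r j) = set0) ->
  exists2 J : {set I}, J \subset A &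
    (forall i j, i \in J -> j \in J -> i != j ->
       cball (c i) (L * r i) `&` cball (c j) (L * r j) = set0) /\
    \sum_(i in A) (2 * r i) ^+ n <= 3 ^+ n * \sum_(j in J) (2 * (L * r j)) ^+ n.
Proof.
move=> r0 L1 dr; have L0 : 0 < L by rewrite (lt_le_trans _ L1).
have [|J JA [dJ cJ]] := @vitali_finite R n I c (fun i => L * r i) A.
  by move=> i; rewrite mulr_ge0 ?ltW.
exists J => //; split => //.
rewrite -lee_fin mulr_sumr -!sumEFin.
rewrite (eq_bigr (fun i => \I (fun x => \1_(cball (c i) (r i)) x : R)))%E; last first.
  by move=> i _; rewrite int_indic_cball// ltW.
rewrite [leRHS](eq_bigr (fun i => \I (fun x => \1_(cball (c i) (3 * (L * r i))) x : R)))%E; last first.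
  move=> i _; rewrite int_indic_cball; first by rewrite -exprMn; congr (_ ^+ _)%:E; ring.
  by rewrite !mulr_ge0// ltW.
rewrite -!ge0_int_sum//; [|by move=> i; exact: measurable_indic_cball..].
apply: ge0_le_int.
- by apply: measurable_sum_cond => i; exact: measurable_indic_cball.
- by apply: measurable_sum_cond => i; exact: measurable_indic_cball.
- by move=> x; rewrite sumr_ge0.
move=> x; have [[i iA xi]|noB] := pselect (exists2 i, i \in A & cball (c i) (r i) x).
  apply: (@le_trans _ _ 1).
    by apply: indic_trivIset_sum_le1 => j k _ _; exact: dr.
  have [j jJ /(_ x)] := cJ _ iA; rewrite (bigD1 j)//= => h.
  rewrite indicE mem_set ?lerDl ?sumr_ge0//; apply: h.
  apply: le_trans xi _; rewrite -[leLHS]mul1r ler_wpM2r// ltW//.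
rewrite big1 ?sumr_ge0// => i iA; rewrite indicE memNset// => xi.
by apply: noB; exists i.
Qed.

(** Truncation at half the level: the part of [h] below [t / 2] accounts for at most half of a mean
    that reaches [t], so the excess over [t / 2] carries the other half. Having only the excess on
    the right is what lets the levels be summed in [maximal_strong]. *)
Lemma maximal_weak (I : finType) (c : I -> 'rV[R]_n) (r : I -> R) (L t : R)
    (h : 'rV[R]_n -> R) (A : {set I}) :
  (forall i, 0 < r i) -> 1 <= L ->
  (forall i j, i != j -> cball (c i) (r i) `&` cball (c j) (r j) = set0) ->
  measurable_fun setT h -> (forall x, 0 <= h x) -> 0 < t ->
  (forall i, i \in A -> ((t * (2 * (L * r i)) ^+ n)%:E <=
     \I (fun x => \1_(cball (c i) (L * r i)) x * h x)%R)%E) ->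
  ((t * \sum_(i in A) (2 * r i) ^+ n)%:E <=
   (3 ^+ n * 2)%:E * \I (fun x => Num.max (h x - t / 2) 0)%R)%E.
Proof.
move=> r0 L1 dr mh h0 t0 tA; have L0 : 0 < L by rewrite (lt_le_trans _ L1).
have [J /fintype.subsetP JA [dJ leJ]] := measure_packing_le A r0 L1 dr.
set g := fun x => Num.max (h x - t / 2) 0.
have g0 x : 0 <= g x by rewrite le_max lexx orbT.
have mg : measurable_fun setT g.
  by apply: measurable_maxr => //; exact: measurable_funB.
have mB i : measurable_fun setT (\1_(cball (c i) (L * r i)) : _ -> R).
  exact: measurable_indic_cball.
have Vg j : j \in J -> ((t / 2 * (2 * (L * r j)) ^+ n)%:E <=
    \I (fun x => \1_(cball (c j) (L * r j)) x * g x)%R)%E.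
  move=> jJ; have := tA _ (JA _ jJ); set V := (2 * _) ^+ n => tV.
  (* A finite summand is added on both sides and cancelled, so that no subtraction of integrals
     occurs. *)
  have : ((t / 2 * V)%:E + (t / 2 * V)%:E <=
     \I (fun x => \1_(cball (c j) (L * r j)) x * g x)%R + (t / 2 * V)%:E)%E.
    rewrite -EFinD (_ : t / 2 * V + _ = t * V); last by field.
    apply: (le_trans tV); rewrite EFinM /V -(int_indic_cball (c j)); last first.
      by rewrite mulr_ge0// ltW.
    rewrite -ge0_intZ//; last by rewrite divr_ge0// ltW.
    rewrite -ge0_intD//; last 3 first.
    - by apply: measurable_funM.
    - by move=> x; rewrite mulr_ge0.
    - by move=> x; rewrite mulr_ge0// divr_ge0// ltW.
    - apply: ge0_le_int.
      + exact: measurable_funM.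
      + by apply: measurable_funD; apply: measurable_funM.
      + by move=> x; rewrite mulr_ge0.
      + move=> x; rewrite indicE; case: (_ \in _); last by rewrite !mul0r mulr0 addr0.
        by rewrite !mul1r mulr1 -lerBlDr le_max lexx.
    - exact: measurable_funM.
  by rewrite leeD2rE.
apply: (@le_trans _ _ (3 ^+ n * 2 * (\sum_(j in J) (t / 2 * (2 * (L * r j)) ^+ n)))%:E).
  rewrite lee_fin (le_trans (ler_wpM2l (ltW t0) leJ))// -mulr_sumr.
  by rewrite le_eqVlt; apply/orP; left; apply/eqP; field.
rewrite [leLHS]EFinM lee_wpmul2l ?lee_fin//.
rewrite -sumEFin; apply: (le_trans (lee_sum _ Vg)).
rewrite -ge0_int_sum//; last 2 first.
- by move=> i; exact: measurable_funM.
- by move=> i x; rewrite mulr_ge0.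
apply: ge0_le_int => //.
- by apply: measurable_sum_cond => i; exact: measurable_funM.
- by move=> x; rewrite sumr_ge0// => i _; rewrite mulr_ge0.
- move=> x; rewrite -mulr_suml -[leRHS]mul1r ler_wpM2r//.
  exact: indic_trivIset_sum_le1.
Qed.

Lemma lt1_powR2 (s : R) : 0 < s -> 1 < 2 `^ s.
Proof.
move=> s0; have := @gt0_ltr_powR R s s0 1 2; rewrite powR1; apply; rewrite ?nnegrE//.
by rewrite ltr1n.
Qed.

(** A geometric sum is controlled by its last term: when the top level [T] is present, the lower
    levels are all at most [T / 2], and the induction hypothesis is used with that bound in place of
    [H]. *)
Lemma dyadic_sum_le (s t0 H : R) (N : nat) : 0 < s -> 0 < t0 -> 0 <= H ->
  \sum_(k < N) (2 ^+ k * t0) `^ s * (2 ^+ k * t0 <= H)%R%:R <=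
  (2 `^ s / (2 `^ s - 1)) * H `^ s.
Proof.
move=> s0 t00; set b := 2 `^ s.
have b1 : 1 < b by exact: lt1_powR2.
have K0 : 0 <= b / (b - 1) by rewrite divr_ge0// ?subr_ge0 ltW// (lt_trans _ b1).
elim: N H => [|N IH] H H0; first by rewrite big_ord0 mulr_ge0// powR_ge0.
rewrite big_ord_recr/=.
have [le|gt] := leP (2 ^+ N * t0) H; last first.
  by rewrite mulr0 addr0; exact: IH.
rewrite mulr1; set T := 2 ^+ N * t0.
have T0 : 0 < T by rewrite mulr_gt0// exprn_gt0.
have T20 : 0 <= T / 2 by rewrite divr_ge0// ltW.
apply: (@le_trans _ _ (b / (b - 1) * (T / 2) `^ s + T `^ s)).
  rewrite lerD2r; apply: le_trans (IH _ T20); apply: ler_sum => k _.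
  rewrite ler_wpM2l ?powR_ge0//.
  have -> : 2 ^+ k * t0 <= T / 2.
    rewrite ler_pdivlMr// /T mulrAC ler_wpM2r ?(ltW t00)// -exprSr ler_weXn2l//.
    by rewrite ler1n.
  by rewrite ler_nat leq_b1.
have -> : (T / 2) `^ s = T `^ s * b^-1.
  by rewrite powRM ?invr_ge0 ?(ltW T0)// -powR_inv1// -powRrM mulN1r powRN.
have -> : b / (b - 1) * (T `^ s * b^-1) + T `^ s = b / (b - 1) * T `^ s.
  by field; rewrite subr_eq0 !gt_eqF// (lt_trans _ b1).
by rewrite ler_wpM2l// ge0_ler_powR// ?ltW// nnegrE ltW.
Qed.

Lemma dyadic_level (t0 a : R) (N : nat) : t0 <= a -> a <= 2 ^+ N * t0 -> (0 < N)%N ->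
  exists2 k : 'I_N, 2 ^+ k * t0 <= a & a <= 2 * (2 ^+ k * t0).
Proof.
elim: N => // N IH ta aN _.
have [le|/ltW ge] := leP (2 ^+ N * t0) a.
  by exists ord_max => //=; rewrite mulrA -exprS.
case: N IH aN ge => [|N] IH aN ge.
  by exists ord0; rewrite /= ?expr0 ?mul1r//; move: aN; rewrite expr1.
have [//|//|k k1 k2] := IH _ _ (ltn0Sn _).
by exists (widen_ord (leqnSn _) k).
Qed.

(** Marcinkiewicz-style summation over levels. Since [I] is finite, the layer-cake integral becomes
    a finite sum over dyadic levels between the least positive [a i] and an upper bound of all
    [a i]. The excess of [h] over [t k / 2] vanishes unless [t k <= 2 * h], so at each point
    [dyadic_sum_le] with exponent [s - 1 > 0] leaves a multiple of [h^s]. *)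
Lemma maximal_strong (I : finType) (c : I -> 'rV[R]_n) (r : I -> R) (L s : R)
    (h : 'rV[R]_n -> R) (a : I -> R) :
  (forall i, 0 < r i) -> 1 <= L -> 1 < s ->
  (forall i j, i != j -> cball (c i) (r i) `&` cball (c j) (r j) = set0) ->
  measurable_fun setT h -> (forall x, 0 <= h x) -> (forall i, 0 <= a i) ->
  (forall i, ((a i * (2 * (L * r i)) ^+ n)%:E <=
     \I (fun x => \1_(cball (c i) (L * r i)) x * h x)%R)%E) ->
  ((\sum_i (2 * r i) ^+ n * a i `^ s)%:E <=
   (3 ^+ n * 2 * 2 `^ s * (2 `^ (s - 1) * (2 `^ (s - 1) / (2 `^ (s - 1) - 1))))%:E *
   \I (fun x => h x `^ s)%R)%E.
Proof.
move=> r0 L1 s1 dr mh h0 a0 ha.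
have s0 : 0 < s by rewrite (lt_trans _ s1).
(* The neutral value 1 of the minimum keeps [t0] positive even if no [a i] is. *)
have [t0 t00 t0a] : exists2 t0, 0 < t0 & forall i, 0 < a i -> t0 <= a i.
  exists (\big[Num.min/1]_(i | 0 < a i) a i).
    by elim/big_ind : _ => // x y x0 y0; rewrite lt_min x0.
  move=> i ai; rewrite (bigD1 i)//= ge_min lexx//.
have [N N0 aN] : exists2 N, (0 < N)%N & forall i, a i <= 2 ^+ N * t0.
  pose M := \sum_i a i.
  have [N NM] : exists N : nat, M <= 2 ^+ N * t0.
    exists (Num.truncn (M / t0)).+1.
    rewrite -ler_pdivrMr// (le_trans (ltW (truncnS_gt _)))//.
    by rewrite -natrX ler_nat ltnW// ltn_expl.
  exists N.+1 => // i; apply: (@le_trans _ _ (2 ^+ N * t0)).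
    by apply: le_trans NM; rewrite /M (bigD1 i)//= lerDl sumr_ge0.
  by rewrite ler_wpM2r ?(ltW t00)// ler_weXn2l// ler1n.
set t := fun k : nat => 2 ^+ k * t0.
have tpos k : 0 < t k by rewrite mulr_gt0// exprn_gt0.
pose A k : {set I} := finset.finset (fun i => t k <= a i).
(* Each positive [a i] lies between [t k] and [2 * t k] for some level [k]; this single level
   already pays for the term of index [i]. *)
apply: (@le_trans _ _ (\sum_(k < N) (2 * t k) `^ s * \sum_(i in A k) (2 * r i) ^+ n)%:E).
  rewrite lee_fin; under [leRHS]eq_bigr do rewrite mulr_sumr big_mkcond/=.
  rewrite exchange_big/=; apply: ler_sum => i _.
  have [ai0|] := ltP 0 (a i); last first.
    move=> ai0; have -> : a i = 0 by apply/eqP; rewrite eq_le ai0 a0.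
    rewrite powR0 ?gt_eqF// mulr0 sumr_ge0// => k _; case: ifP => // _.
    by rewrite mulr_ge0 ?powR_ge0// exprn_ge0// mulr_ge0// ltW.
  have [k k1 k2] := dyadic_level (t0a _ ai0) (aN i) N0.
  have Ak : i \in A k by rewrite finset.in_set.
  rewrite (bigD1 k)//= Ak mulrC.
  rewrite -[leLHS]addr0 lerD ?sumr_ge0//.
    rewrite ler_wpM2r ?exprn_ge0 ?mulr_ge0 ?(ltW (r0 i))//.
    apply: (ge0_ler_powR (ltW s0)) => //; rewrite nnegrE//.
    by rewrite mulr_ge0// ltW.
  move=> j _; case: ifP => // _.
  by rewrite mulr_ge0 ?powR_ge0// exprn_ge0// mulr_ge0// ltW.
have s10 : 0 < s - 1 by rewrite subr_gt0.
have b1 : 1 < 2 `^ (s - 1) by exact: lt1_powR2.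
have K0 : 0 <= 3 ^+ n * 2 * 2 `^ s * (2 `^ (s - 1) * (2 `^ (s - 1) / (2 `^ (s - 1) - 1))).
  by rewrite !mulr_ge0 ?invr_ge0 ?exprn_ge0 ?powR_ge0// subr_ge0 ltW.
have g0 k x : 0 <= Num.max (h x - t k / 2) 0 by rewrite le_max lexx orbT.
have mg k : measurable_fun setT (fun x => Num.max (h x - t k / 2) 0).
  by apply: measurable_maxr => //; exact: measurable_funB.
apply: (@le_trans _ _ (\sum_(k < N) (3 ^+ n * 2 * ((2 * t k) `^ s / t k))%:E *
    \I (fun x => Num.max (h x - t k / 2) 0)%R)%E).
  rewrite -sumEFin; apply: lee_sum => k _.
  have := @maximal_weak I c r L (t k) h (A k) r0 L1 dr mh h0 (tpos k).
  have tA i : i \in A k -> ((t k * (2 * (L * r i)) ^+ n)%:E <=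
     \I (fun x => \1_(cball (c i) (L * r i)) x * h x)%R)%E.
    rewrite finset.in_set => tk; apply: le_trans (ha i); rewrite lee_fin ler_wpM2r//.
    by rewrite exprn_ge0// !mulr_ge0// ltW// (lt_le_trans _ L1).
  move=> /(_ tA) H.
  rewrite (_ : (2 * t k) `^ s * _ = (2 * t k) `^ s / t k * (t k * \sum_(i in A k) (2 * r i) ^+ n)); last first.
    by field; rewrite gt_eqF.
  rewrite [leLHS]EFinM [3 ^+ n * 2 * _]mulrC [in leRHS]EFinM -muleA.
  by rewrite lee_wpmul2l// lee_fin divr_ge0 ?powR_ge0// ltW.
have c0 k : 0 <= 3 ^+ n * 2 * ((2 * t k) `^ s / t k).
  by rewrite mulr_ge0// divr_ge0 ?powR_ge0// ltW.
under eq_bigr => k _ do rewrite -ge0_intZ//.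
rewrite -ge0_int_sum//; last 2 first.
- by move=> i; exact: measurable_funM.
- by move=> i x; rewrite mulr_ge0.
have mhs : measurable_fun setT (fun x => h x `^ s).
  exact: (measurableT_comp (measurable_powR s) mh).
have hs0 x : 0 <= h x `^ s by exact: powR_ge0.
rewrite -(ge0_intZ _ mhs hs0 K0).
apply: ge0_le_int.
- by apply: measurable_sum_cond => k; exact: measurable_funM.
- exact: measurable_funM.
- by move=> x; rewrite sumr_ge0// => k _; rewrite mulr_ge0.
move=> x.
have := @dyadic_sum_le (s - 1) t0 (2 * h x) N s10 t00.
rewrite mulr_ge0// => /(_ isT) D.
apply: (@le_trans _ _ (3 ^+ n * 2 * 2 `^ s * (h x * \sum_(k < N) (2 ^+ k * t0) `^ (s - 1) * (2 ^+ k * t0 <= 2 * h x)%R%:R))).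
  rewrite !mulr_sumr; apply: ler_sum => k _.
  have -> : (2 * t k) `^ s / t k = 2 `^ s * t k `^ (s - 1).
    rewrite powRM ?(ltW (tpos k))// -(mulr_powRB1 (ltW (tpos k)) s0).
    by field; rewrite gt_eqF.
  rewrite -/(t k) -!mulrA ler_wpM2l// ler_wpM2l// ler_wpM2l ?powR_ge0//.
  rewrite [leRHS]mulrCA ler_wpM2l ?powR_ge0//.
  rewrite (_ : 2 ^+ k * (t0 / 2) = t k / 2); last by rewrite mulrA.
  have tk := tpos k; have [le|gt] := leP (t k) (2 * h x).
    by rewrite mulr1 ge_max h0 andbT lerBlDr lerDl mulr_ge0// ltW.
  by rewrite mulr0 ge_max lexx andbT subr_le0 ler_pdivlMr// mulrC ltW.
rewrite -!mulrA ler_wpM2l// ler_wpM2l// ler_wpM2l ?powR_ge0//.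
apply: le_trans (ler_wpM2l (h0 x) D) _.
rewrite powRM// -(mulr_powRB1 (h0 x) s0).
by rewrite le_eqVlt; apply/orP; left; apply/eqP; ring.
Qed.

End hardy_littlewood.

(** * Uniform convexity and weak limits in L_p *)

Section power_function.
Context {R : realType} (p : R).
Hypothesis p1 : 1 < p.

Let p0 : 0 < p. Proof. by rewrite (lt_trans _ p1). Qed.

Lemma continuous_norm_powR : continuous (fun x : R => `|x| `^ p).
Proof.
move=> x; have [->|x0] := eqVneq x 0.
  apply/cvgrPdist_lt => e e0.
  have ep : 0 < e `^ p^-1 by exact: powR_gt0.
  have := @nbhs0_lt R R _ ep; apply: filterS => t et.
  rewrite normr0 powR0 ?gt_eqF// sub0r normrN ger0_norm ?powR_ge0//.
  have := @gt0_ltr_powR R p p0 `|t| (e `^ p^-1).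
  rewrite -powRrM mulVf ?gt_eqF// powRr1 ?ltW//; apply=> //; rewrite nnegrE//.
  exact: powR_ge0.
apply: (@continuous_comp _ _ _ (fun x : R => `|x|) (fun x => x `^ p)).
  exact: norm_continuous.
apply/differentiable_continuous/derivable1_diffP.
by apply: derivable_powR; rewrite in_itv/= normr_gt0 x0.
Qed.

(** The gap, as a function of [b > 0], vanishes at 1 and has negative derivative before it, because
    [c < (1 + c) / 2] for [c < 1]; the mean value theorem on [[b, 1]] gives positivity. *)
Lemma midpoint_gap_pos (b : R) : 0 <= b -> b < 1 ->
  ((1 + b) / 2) `^ p < (1 + b `^ p) / 2.
Proof.
move=> b0 b1; have [->|bn0] := eqVneq b 0.
  rewrite powR0 ?gt_eqF// !addr0 !div1r -mulr_powRB1// ?invr_ge0//.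
  rewrite gtr_pMr ?invr_gt0//; have := @gt0_ltr_powR R (p - 1).
  rewrite subr_gt0 => /(_ p1 2^-1 1); rewrite powR1; apply; rewrite ?nnegrE ?invr_ge0//.
  by rewrite invf_lt1// ltr1n.
have {}b0 : 0 < b by rewrite lt_neqAle eq_sym bn0.
pose g (t : R) := 2^-1 * (1 + t `^ p) - (2^-1 * (1 + t)) `^ p.
pose dg (t : R) := 2^-1 * (p * t `^ (p - 1)) - p * (2^-1 * (1 + t)) `^ (p - 1) * 2^-1.
have gd (t : R) : 0 < t -> is_derive t 1 g (dg t).
  move=> t0; have t1 : 0 < 2^-1 * (1 + t) by rewrite mulr_gt0// addr_gt0.
  have d1 := is_derive1_powR p t0.
  have d2 := is_derive1_powR p t1.
  have d3 := is_deriveZ (2^-1 : R) (is_deriveD (is_derive_cst (1 : R) t 1) (is_derive_id t 1)).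
  have d4 := is_deriveZ (2^-1 : R) (is_deriveD (is_derive_cst (1 : R) t 1) d1).
  have d5 := @is_derive1_comp R (fun x => x `^ p) _ t _ _ d2 d3.
  apply: (is_derive_eq (is_deriveB d4 d5)).
  by rewrite /dg !add0r; congr (_ - _ * _); rewrite /GRing.scale/= mulr1.
have cg : {within `[b, 1], continuous g}.
  apply: derivable_within_continuous => t; rewrite in_itv/= => /andP[bt _].
  by have [] := gd t (lt_le_trans b0 bt).
have gd' t : t \in `]b, 1[ -> is_derive t 1 g (dg t).
  by rewrite in_itv/= => /andP[bt _]; apply: gd; exact: lt_trans bt.
have [c] := @MVT R g dg b 1 b1 gd' cg.
rewrite in_itv/= => /andP[bc c1].
have g1 : g 1 = 0.
  by rewrite /g powR1 (_ : 2^-1 * (1 + 1) = 1) ?powR1 ?subrr//; field.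
rewrite g1 sub0r => E.
suff : 0 < g b by rewrite /g subr_gt0 ![2^-1 * _]mulrC.
have c0 := lt_trans b0 bc.
have dc : dg c < 0.
  rewrite /dg [_ * 2^-1]mulrC -mulrBr -mulrBr pmulr_rlt0// pmulr_rlt0// subr_lt0.
  have := @gt0_ltr_powR R (p - 1); rewrite subr_gt0 => /(_ p1 c (2^-1 * (1 + c))).
  by rewrite !nnegrE; apply; lra.
by rewrite -oppr_lt0 E nmulr_rlt0// subr_gt0.
Qed.

(** By symmetry and homogeneity only the ratio [t = |b| / |a|] in [[0, 1]] matters. *)
Lemma midpoint_powR_le (a b : R) : `|(a + b) / 2| `^ p <= (`|a| `^ p + `|b| `^ p) / 2.
Proof.
wlog ba : a b / `|b| <= `|a|.
  move=> W; have [ba|/ltW ab] := leP `|b| `|a|; first exact: W.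
  by rewrite addrC [X in _ <= X / 2]addrC; exact: W.
have [a0|a0] := eqVneq a 0.
  have -> : b = 0 by apply/eqP; move: ba; rewrite a0 normr0 normr_le0.
  by rewrite a0 addr0 mul0r normr0 powR0 ?gt_eqF// addr0 mul0r.
have na : 0 < `|a| by rewrite normr_gt0.
pose t := `|b| / `|a|.
have t0 : 0 <= t by rewrite divr_ge0.
have t1 : t <= 1 by rewrite ler_pdivrMr// mul1r.
have E : `|b| = `|a| * t by rewrite /t mulrC divfK// gt_eqF.
have G : ((1 + t) / 2) `^ p <= (1 + t `^ p) / 2.
  have [->|tn1] := eqVneq t 1.
    by rewrite powR1 (_ : (1 + 1) / 2 = 1 :> R) ?powR1//; field.
  by apply/ltW/midpoint_gap_pos => //; rewrite lt_neqAle tn1.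
apply: (@le_trans _ _ ((`|a| * ((1 + t) / 2)) `^ p)).
  apply: (ge0_ler_powR (ltW p0)); rewrite ?nnegrE// ?mulr_ge0 ?addr_ge0 ?invr_ge0//.
  rewrite normrM [`|2^-1|]ger0_norm ?invr_ge0// mulrA ler_wpM2r ?invr_ge0//.
  by rewrite mulrDr mulr1 -E ler_normD.
have h0 : 0 <= (1 + t) / 2 by rewrite divr_ge0// addr_ge0.
rewrite E (powRM _ _ h0)// (powRM _ _ t0)//.
by apply: le_trans (ler_wpM2l (powR_ge0 _ _) G) _; rewrite mulrA mulrDr mulr1.
Qed.

(* The midpoint defect is bounded below, after normalization, by compactness. *)
Lemma uniform_convexity_powR (e : R) : 0 < e -> exists2 dl : R, 0 < dl &
  forall a b : R, dl * `|a - b| `^ p <= dl * (e * (`|a| `^ p + `|b| `^ p)) +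
    ((`|a| `^ p + `|b| `^ p) / 2 - `|(a + b) / 2| `^ p).
Proof.
move=> e0.
pose u (b : R) := (1 + `|b| `^ p) / 2 - `|(1 + b) / 2| `^ p.
have cu : continuous u.
  move=> x; apply: cvgB.
    apply: cvgM; last exact: cvg_cst.
    by apply: cvgD; [exact: cvg_cst|exact: continuous_norm_powR].
  apply: (@continuous_comp _ _ _ (fun b : R => (1 + b) / 2) (fun x => `|x| `^ p)).
    apply: cvgM; last exact: cvg_cst.
    by apply: cvgD; [exact: cvg_cst|exact: cvg_id].
  exact: continuous_norm_powR.
have u0 b : `|b| <= 1 -> b < 1 -> 0 < u b.
  rewrite ler_norml => /andP[b1 b2] b3; rewrite /u subr_gt0.
  rewrite [`|(1 + b) / 2|]ger0_norm; last by rewrite divr_ge0// -lerBlDl sub0r.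
  have [b0|b0] := leP 0 b; first by rewrite ger0_norm//; exact: midpoint_gap_pos.
  rewrite ltr0_norm//; have [->|bn1] := eqVneq b (-1).
    by rewrite subrr mul0r powR0 ?gt_eqF// opprK powR1 divr_gt0.
  have bm : - b < 1 by rewrite ltrNl lt_neqAle eq_sym bn1.
  apply: lt_trans (midpoint_gap_pos _ bm); last by rewrite oppr_ge0 ltW.
  by apply: (gt0_ltr_powR p0); rewrite ?nnegrE; lra.
have u1 b : `|b| <= 1 -> 0 <= u b.
  move=> b1; have := b1; rewrite ler_norml => /andP[_].
  rewrite le_eqVlt => /predU1P[->|b2]; last exact/ltW/u0.
  have h2 : (1 + 1) / 2 = 1 :> R by field.
  by rewrite /u normr1 powR1 h2 normr1 powR1 subrr.
(* For [b] within [eta] of 1 the quantity [|1 - b|^p] is at most [e] by itself; compactness serves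
   only on [[-1, 1 - eta]], where [u] has a positive minimum. *)
pose eta := Num.min 1 (e `^ p^-1).
have eta0 : 0 < eta by rewrite lt_min ltr01 powR_gt0.
have eta1 : eta <= 1 by rewrite ge_min lexx.
have etae : eta `^ p <= e.
  rewrite -[leRHS](powRr1 (ltW e0)) -(mulVf (lt0r_neq0 p0)) powRrM.
  apply: (ge0_ler_powR (ltW p0)); rewrite ?nnegrE ?powR_ge0// ?(ltW eta0)//.
  by rewrite ge_min lexx orbT.
have [c] := @EVT_min R u (-1) (1 - eta) ltac:(lra) (continuous_subspaceT cu).
rewrite in_itv/= => /andP[c1 c2] cmin.
have uc : 0 < u c by apply: u0; [rewrite ler_norml|]; lra.
(* Since [|1 - b| <= 2], the product [dl * |1 - b|^p] stays below the minimum [u c]. *)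
pose dl := u c / 2 `^ p.
have dl0 : 0 < dl by rewrite divr_gt0// powR_gt0.
have key b : `|b| <= 1 -> dl * `|1 - b| `^ p <= dl * (e * (1 + `|b| `^ p)) + u b.
  move=> b1; have := b1; rewrite ler_norml => /andP[b2 b3].
  have [be|be] := leP b (1 - eta).
    apply: (@le_trans _ _ (u c)).
      rewrite /dl -mulrA ger_pMr// mulrC ler_pdivrMr ?powR_gt0// mul1r.
      apply: (ge0_ler_powR (ltW p0)); rewrite ?nnegrE// ger0_norm; lra.
    apply: (@le_trans _ _ (u b)); first by apply: cmin; rewrite in_itv/= b2.
    rewrite lerDr; apply: mulr_ge0; first exact: ltW.
    by apply: mulr_ge0; [exact: ltW|rewrite addr_ge0// powR_ge0].
  apply: (@le_trans _ _ (dl * (e * (1 + `|b| `^ p)))); last by rewrite lerDl u1.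
  rewrite ler_wpM2l ?(ltW dl0)//.
  apply: (@le_trans _ _ e); last by rewrite ler_peMr ?(ltW e0)// lerDl powR_ge0.
  apply: le_trans etae; apply: (ge0_ler_powR (ltW p0)); rewrite ?nnegrE// ?(ltW eta0)//.
  by rewrite ger0_norm; lra.
exists dl => //.
have main a b : `|b| <= `|a| -> dl * `|a - b| `^ p <= dl * (e * (`|a| `^ p + `|b| `^ p)) +
    ((`|a| `^ p + `|b| `^ p) / 2 - `|(a + b) / 2| `^ p).
  move=> ba; have [a0|a0] := eqVneq a 0.
    have b0 : b = 0 by apply/eqP; move: ba; rewrite a0 normr0 normr_le0.
    by rewrite a0 b0 !addr0 subrr mul0r normr0 powR0 ?gt_eqF// !(addr0, mulr0, mul0r, subrr).
  have na : 0 < `|a| by rewrite normr_gt0.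
  have := key (b / a); rewrite normf_div ler_pdivrMr// mul1r => /(_ ba).
  have ap : 0 <= `|a| `^ p by exact: powR_ge0.
  move=> /(ler_wpM2l ap).
  have E1 : `|a| `^ p * `|1 - b / a| `^ p = `|a - b| `^ p.
    by rewrite -powRM// -normrM; congr (`|_| `^ p); field.
  have E2 : `|a| `^ p * (`|b| / `|a|) `^ p = `|b| `^ p.
    by rewrite -powRM ?divr_ge0//; congr (_ `^ p); field; rewrite gt_eqF.
  have E3 : `|a| `^ p * `|(1 + b / a) / 2| `^ p = `|(a + b) / 2| `^ p.
    by rewrite -powRM// -normrM; congr (`|_| `^ p); field.
  rewrite mulrCA E1 => /le_trans; apply.
  rewrite /u normf_div -E3 -E2 le_eqVlt; apply/orP; left; apply/eqP; ring.
move=> a b; have [ab|/ltW ab] := leP `|b| `|a|; first exact: main.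
have := main b a ab; rewrite distrC [`|b| `^ p + _]addrC [b + a]addrC. exact.
Qed.

End power_function.

(** * Completeness of L_p, stated for integrals of p-th powers *)

Section Lp_completeness.
Context d (T : measurableType d) (R : realType) (mu : {measure set T -> \bar R}).
Variable p : R.
Hypothesis p1 : 1 < p.
Let p0 : 0 < p. Proof. by rewrite (lt_trans _ p1). Qed.

Definition powint (f : T -> R) : \bar R := (\int[mu]_x (`|f x| `^ p)%:E)%E.

Lemma measurable_norm_powR (f : T -> R) : measurable_fun setT f ->
  measurable_fun setT (fun x => `|f x| `^ p).
Proof.
move=> mf; apply: (measurableT_comp (measurable_powR p)).
exact: measurableT_comp.
Qed.

Lemma limn_einf_le (u : (\bar R)^nat) (a : \bar R) :
  (exists N, forall k, (N <= k)%N -> (u k <= a)%E) -> (limn_einf u <= a)%E.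
Proof.
move=> [N uN]; rewrite limn_einf_lim; apply: lime_le; first exact: is_cvg_einfs.
exists N => // k /= Nk; apply: le_trans (uN k Nk).
by apply: ereal_inf_lbound; exists k => /=.
Qed.

Lemma fatou_powint (g : nat -> T -> R) (f : T -> R) (M : R) :
  (forall k, measurable_fun setT (g k)) -> measurable_fun setT f ->
  {ae mu, forall x, (fun k => g k x) @ \oo --> f x} ->
  (exists N, forall k, (N <= k)%N -> (powint (g k) <= M%:E)%E) ->
  (powint f <= M%:E)%E.
Proof.
move=> mg mf gf gM.
have mF k : measurable_fun setT (fun x => (`|g k x| `^ p)%:E).
  by apply/measurable_EFinP; exact: measurable_norm_powR.
have F0 k x : setT x -> (0 <= (`|g k x| `^ p)%:E)%E by move=> _; rewrite lee_fin powR_ge0.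
apply: (@le_trans _ _ (\int[mu]_x limn_einf (fun k => (`|g k x| `^ p)%:E))%E); last first.
  by apply: le_trans (fatou mu measurableT mF F0) _; exact: limn_einf_le.
apply: ae_ge0_le_integral => //.
- by apply/measurable_EFinP; exact: measurable_norm_powR.
- move=> x _; rewrite limn_einf_lim; apply: lime_ge; first exact: is_cvg_einfs.
  by apply: nearW => k; apply: le_ereal_inf_tmp => _ [j _ <-]; rewrite lee_fin powR_ge0.
- rewrite /limn_einf; apply: measurableT_comp => //.
  apply: measurable_fun_limn_esup => k.
  by apply: measurableT_comp => //; exact: mF.
apply: filterS gf => x gfx _.
have h : (fun k => (`|g k x| `^ p)%:E) @ \oo --> (`|f x| `^ p)%:E.
  apply: cvg_EFin; first exact: nearW.
  apply: (@cvg_comp _ _ _ (fun k => g k x) (fun y => `|y| `^ p) _ (nbhs (f x))) => //.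
  exact: continuous_norm_powR.
by have [-> _] := cvg_limn_einf_sup h.
Qed.

Lemma fast_cauchy_cvg (u : R^nat) (s : R) :
  (forall j, `|u j.+1 - u j| <= s * (2^-1) ^+ j) -> cvgn u.
Proof.
move=> us.
have s0 : 0 <= s by have := le_trans (normr_ge0 _) (us 0%N); rewrite expr0 mulr1.
have -> : u = (fun n => u 0%N + series (telescope u) n).
  by apply/funext => n; exact: eq_sum_telescope.
apply: is_cvgD; first exact: is_cvg_cst.
apply: normed_cvg; apply: (@series_le_cvg _ _ (geometric s 2^-1)).
- by move=> k; exact: normr_ge0.
- by move=> k; rewrite geometric_ge0// invr_ge0.
- exact: us.
- apply: is_cvg_geometric_series; rewrite ger0_norm ?invr_ge0//.
  by rewrite invf_lt1// ltr1n.
Qed.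

(** The series of [2^(j p) |g (j+1) - g j|^p] has integral at most 1, so it is finite almost
    everywhere. Bounding each term by the whole sum makes the increments at most a constant times
    [2^-j]. *)
Lemma ae_cvg_fast (g : nat -> T -> R) :
  (forall k, measurable_fun setT (g k)) ->
  (forall j, (powint (fun x => g j.+1 x - g j x)%R <= (((2 ^+ j) `^ p)^-1 / (2 ^ j.+1)%:R)%R%:E)%E) ->
  {ae mu, forall x, cvgn (fun k => g k x)}.
Proof.
move=> mg gb.
pose w j x := (2 ^+ j) `^ p * `|g j.+1 x - g j x| `^ p.
have w0 j x : 0 <= w j x by rewrite mulr_ge0 ?powR_ge0.
have mw j : measurable_fun setT (fun x => (w j x)%:E).
  apply/measurable_EFinP/measurable_funM => //; apply: measurable_norm_powR.
  exact: measurable_funB.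
pose S x := (\sum_(j <oo) (w j x)%:E)%E.
have S0 x : (0 <= S x)%E by apply: nneseries_ge0 => j _ _; rewrite lee_fin.
have mS : measurable_fun setT S by apply: ge0_emeasurable_sum => // j x _ _; rewrite lee_fin.
have intS : mu.-integrable setT S.
  apply/integrableP; split => //.
  apply: (@le_lt_trans _ _ 1%:E); last exact: ltry.
  under eq_integral do rewrite gee0_abs//.
  rewrite integral_nneseries//; last by move=> j x _; rewrite lee_fin.
  apply: le_trans (@epsilon_trick0 R 1 xpredT ler01).
  apply: lee_nneseries => [j _ _|j _]; first by apply: integral_ge0 => x _; rewrite lee_fin.
  rewrite /w ge0_intZ ?powR_ge0//.
    apply: le_trans (lee_wpmul2l _ (gb j)) _; first by rewrite lee_fin powR_ge0.
    rewrite -EFinM lee_fin mulrA divff ?gt_eqF// ?powR_gt0// exprn_gt0//.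
  by apply: measurable_norm_powR; exact: measurable_funB.
apply: filterS (integrable_ae measurableT intS) => x /(_ Logic.I) Sx.
pose s := (fine (S x)) `^ p^-1.
apply: (@fast_cauchy_cvg _ s) => j.
have wS : w j x <= fine (S x).
  rewrite -lee_fin fineK//.
  have wi k : (0 <= k)%N -> xpredT k -> (0 <= (w k x)%:E)%E by move=> _ _; rewrite lee_fin.
  apply: le_trans (nneseries_lim_ge j.+1 wi).
  by rewrite big_nat_recr//= leeDr// sume_ge0// => i _; rewrite lee_fin.
have : w j x `^ p^-1 <= s.
  by apply: ge0_ler_powR; rewrite ?nnegrE ?fine_ge0 ?invr_ge0 ?(ltW p0).
rewrite /w -powRM ?exprn_ge0// -powRrM divff ?gt_eqF// powRr1 ?mulr_ge0 ?exprn_ge0//.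
by rewrite mulrC -ler_pdivlMr ?exprn_gt0// exprVn.
Qed.

Lemma riesz_fischer (h : nat -> T -> R) :
  (forall k, measurable_fun setT (h k)) ->
  (forall eta : R, 0 < eta -> exists N, forall j k, (N <= j)%N -> (N <= k)%N ->
     (powint (fun x => h j x - h k x)%R <= eta%:E)%E) ->
  exists G : T -> R, [/\ measurable_fun setT G,
    (forall eta : R, 0 < eta -> exists N, forall k, (N <= k)%N ->
       (powint (fun x => h k x - G x)%R <= eta%:E)%E) &
    (forall M : R, (forall k, powint (h k) <= M%:E)%E -> (powint G <= M%:E)%E)].
Proof.
move=> mh hC.
have /choice[N NP] : forall j, exists N, forall i k, (N <= i)%N -> (N <= k)%N ->
   (powint (fun x => h i x - h k x)%R <= (((2 ^+ j) `^ p)^-1 / (2 ^ j.+1)%:R)%R%:E)%E.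
  by move=> j; apply: hC; rewrite divr_gt0 ?invr_gt0 ?powR_gt0 ?exprn_gt0// ltr0n expn_gt0.
(* The partial sum makes [phi] nondecreasing and at least [N j]; the summand [j] makes it tend to
   infinity. *)
pose phi j := (\sum_(i < j.+1) N i + j)%N.
have phiN j : (N j <= phi j)%N by rewrite /phi big_ord_recr/= -addnA addnCA leq_addr.
have phij j : (j <= phi j)%N by rewrite /phi leq_addl.
have phiS j : (phi j <= phi j.+1)%N.
  by rewrite /phi [X in (_ <= X + _)%N]big_ord_recr/= leq_add// leq_addr.
pose g j := h (phi j).
have gcvg : {ae mu, forall x, cvgn (fun k => g k x)}.
  apply: ae_cvg_fast => [k|j]; first exact: mh.
  by apply: NP => //; exact: leq_trans (phiN j) (phiS j).
(* The upper limit is measurable on the whole space; its values matter only where the subsequence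
   converges. *)
pose G x := fine (limn_esup (fun k => (g k x)%:E)).
have mG : measurable_fun setT G.
  apply: (measurableT_comp (f := fine)) => //.
  by apply: measurable_fun_limn_esup => k; apply/measurable_EFinP; exact: mh.
have gG : {ae mu, forall x, (fun k => g k x) @ \oo --> G x}.
  apply: filterS gcvg => x /cvg_ex[l gl].
  suff -> : G x = l by [].
  have h' : (fun k => (g k x)%:E) @ \oo --> l%:E by apply: cvg_EFin => //; exact: nearW.
  by rewrite /G; have [_ ->] := cvg_limn_einf_sup h'.
exists G; split=> //.
- move=> eta /hC[N0 hN0]; exists N0 => k Nk.
  apply: (@fatou_powint (fun j x => h k x - g j x)).
  + by move=> j; apply: measurable_funB; exact: mh.
  + by apply: measurable_funB => //; exact: mh.
  + apply: filterS gG => x gGx; apply: cvgB; [exact: cvg_cst|exact: gGx].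
  + exists N0 => j Nj; apply: hN0 => //; exact: leq_trans Nj (phij j).
- move=> M hM; apply: (@fatou_powint g) => //; first by move=> k; exact: mh.
  by exists 0%N => k _; exact: hM.
Qed.

End Lp_completeness.

(** The arithmetic that ends the Cauchy argument of [mazur]: the first term is below [eta / 2] by
    the choice of [eps], and the midpoint defect is at most [dl * eta / 2]. *)
Lemma cauchy_bound (R : realType) (eps dl eta M a b m ds : R) :
  eps * (2 * (2 * M + 1)) = eta -> 0 < eps -> 0 < dl ->
  a <= ds + dl * eta / 4 -> b <= ds + dl * eta / 4 -> ds - dl * eta / 4 <= m ->
  eps * (2 * M) + ((a + b) / 2 - m) / dl <= eta.
Proof.
move=> e1 eps0 dl0 ha hb hm.
have : ((a + b) / 2 - m) / dl <= eta / 2 by rewrite ler_pdivrMr//; lra.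
lra.
Qed.

Section mazur.
Context d (T : measurableType d) (R : realType) (mu : {measure set T -> \bar R}).
Variable p : R.
Hypothesis p1 : 1 < p.
Let p0 : 0 < p. Proof. by rewrite (lt_trans _ p1). Qed.
Local Notation E := (powint mu p).

(* Iterated midpoints, rather than all convex combinations, so that the two-point
   inequality [uniform_convexity_powR] is enough. *)
Inductive mid_hull (V : nat -> T -> R) (k : nat) : (T -> R) -> Prop :=
| mid_hull_base j : (k <= j)%N -> mid_hull V k (V j)
| mid_hull_mid f g : mid_hull V k f -> mid_hull V k g ->
    mid_hull V k (fun x => (f x + g x) / 2).

Lemma mid_hull_mono V k l f : (k <= l)%N -> mid_hull V l f -> mid_hull V k f.
Proof.
move=> kl; elim=> [j lj|g h _ IHg _ IHh]; last exact: mid_hull_mid.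
by apply: mid_hull_base; exact: leq_trans lj.
Qed.

Lemma powint_ge0 f : (0 <= E f)%E.
Proof. by apply: integral_ge0 => x _; rewrite lee_fin powR_ge0. Qed.

Variables (V : nat -> T -> R) (M : R).
Hypothesis mV : forall k, measurable_fun setT (V k).
Hypothesis VM : forall k, (E (V k) <= M%:E)%E.

Let M0 : 0 <= M.
Proof. by rewrite -lee_fin; exact: le_trans (powint_ge0 _) (VM 0%N). Qed.

Lemma measurable_mid_hull k f : mid_hull V k f -> measurable_fun setT f.
Proof.
elim=> [j _|g h _ mg _ mh]; first exact: mV.
by apply: measurable_funM => //; exact: measurable_funD.
Qed.

Lemma powint_mid_hull k f : mid_hull V k f -> (E f <= M%:E)%E.
Proof.
elim=> [j _|g h hg Eg hh Eh]; first exact: VM.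
have mg := measurable_mid_hull hg; have mh := measurable_mid_hull hh.
apply: (@le_trans _ _ (\int[mu]_x (2^-1 * (`|g x| `^ p + `|h x| `^ p))%:E)%E).
  apply: ge0_le_int.
  - apply: measurable_norm_powR; apply: measurable_funM => //; exact: measurable_funD.
  - apply: measurable_funM => //.
    by apply: measurable_funD; exact: measurable_norm_powR.
  - by move=> x; exact: powR_ge0.
  - by move=> x; rewrite [leRHS]mulrC; exact: (midpoint_powR_le p1 (g x) (h x)).
have mgp := measurable_norm_powR p mg.
have mhp := measurable_norm_powR p mh.
have gp0 x : 0 <= `|g x| `^ p by exact: powR_ge0.
have hp0 x : 0 <= `|h x| `^ p by exact: powR_ge0.
have h0 : 0 <= 2^-1 :> R by rewrite invr_ge0.
rewrite (ge0_intZ _ (measurable_funD mgp mhp) (fun x => addr_ge0 (gp0 x) (hp0 x)) h0).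
rewrite (ge0_intD _ mgp mhp gp0 hp0).
rewrite -/(E g) -/(E h) (_ : M = 2^-1 * (M + M)); last by field.
by rewrite EFinM lee_wpmul2l ?lee_fin// EFinD leeD.
Qed.

Let e (f : T -> R) := fine (E f).

Let eE k f : mid_hull V k f -> E f = (e f)%:E.
Proof.
move=> hf; rewrite /e fineK// ge0_fin_numE ?powint_ge0//.
exact: le_lt_trans (powint_mid_hull hf) (ltry _).
Qed.

Let e_ge0 f : 0 <= e f. Proof. exact/fine_ge0/powint_ge0. Qed.

Let e_leM k f : mid_hull V k f -> e f <= M.
Proof. by move=> hf; rewrite -lee_fin -(eE hf); exact: powint_mid_hull hf. Qed.

(** Integrating the two-point inequality: the distance between two functions of the hull is
    controlled by the energy lost at their midpoint. *)
Lemma powint_sub_le (eps dl : R) k f g : 0 < eps -> 0 < dl ->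
  (forall a b : R, dl * `|a - b| `^ p <= dl * (eps * (`|a| `^ p + `|b| `^ p)) +
    ((`|a| `^ p + `|b| `^ p) / 2 - `|(a + b) / 2| `^ p)) ->
  mid_hull V k f -> mid_hull V k g ->
  (E (fun x => f x - g x)%R <= (eps * (2 * M) +
     ((e f + e g) / 2 - e (fun x => (f x + g x) / 2)%R) / dl)%R%:E)%E.
Proof.
move=> eps0 dl0 uc hf hg.
have mf := measurable_mid_hull hf; have mg := measurable_mid_hull hg.
have hm := mid_hull_mid hf hg.
have mm := measurable_mid_hull hm.
have mfp := measurable_norm_powR p mf.
have mgp := measurable_norm_powR p mg.
have mmp := measurable_norm_powR p mm.
have msp : measurable_fun setT (fun x => `|f x - g x| `^ p).
  by apply: measurable_norm_powR; exact: measurable_funB.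
pose c := eps + 2^-1 / dl.
have c0 : 0 <= c by rewrite addr_ge0 ?divr_ge0 ?ltW// invr_ge0.
(* The inequality rearranged so that no subtraction occurs under the integral. *)
have H : (\int[mu]_x (`|f x - g x| `^ p + dl^-1 * `|(f x + g x) / 2| `^ p)%:E <=
          \int[mu]_x (c * (`|f x| `^ p + `|g x| `^ p))%:E)%E.
  apply: ge0_le_int.
  - by apply: measurable_funD => //; exact: measurable_funM.
  - by apply: measurable_funM => //; exact: measurable_funD.
  - by move=> x; rewrite addr_ge0 ?mulr_ge0 ?powR_ge0// invr_ge0 ltW.
  - move=> x; have := uc (f x) (g x).
    set A := `|f x - g x| `^ p; set B := _ `^ p + _; set C := `|_ / 2| `^ p => h.
    have dln0 : dl != 0 by rewrite gt_eqF.
    have e1 : dl * (A + dl^-1 * C) = dl * A + C by field.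
    have e2 : dl * (c * B) = dl * (eps * B) + B / 2 by rewrite /c; field.
    by rewrite -(ler_pM2l dl0) e1 e2; lra.
have E2 : (E f + E g)%E = (e f + e g)%:E by rewrite (eE hf) (eE hg) EFinD.
have fp0 x : 0 <= `|f x| `^ p by exact: powR_ge0.
have gp0 x : 0 <= `|g x| `^ p by exact: powR_ge0.
have sp0 x : 0 <= `|f x - g x| `^ p by exact: powR_ge0.
have mp0 x : 0 <= `|(f x + g x) / 2| `^ p by exact: powR_ge0.
have dli0 : 0 <= dl^-1 by rewrite invr_ge0 ltW.
move: H; rewrite (ge0_intZ _ (measurable_funD mfp mgp) (fun x => addr_ge0 (fp0 x) (gp0 x)) c0).
rewrite (ge0_intD _ mfp mgp fp0 gp0).
rewrite (ge0_intD _ msp (measurable_funM (measurable_cst _) mmp) sp0 (fun x => mulr_ge0 dli0 (mp0 x))).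
rewrite (ge0_intZ _ mmp mp0 dli0).
rewrite -/(E f) -/(E g) -/(E (fun x => f x - g x)) -/(E (fun x => (f x + g x) / 2)).
rewrite E2 (eE hm) -!EFinM -leeBrDr// -EFinB => /le_trans; apply; rewrite lee_fin.
have := e_leM hf; have := e_leM hg; set a := e f; set b := e g => bM aM.
have : eps * (a + b) <= eps * (2 * M) by rewrite ler_wpM2l ?(ltW eps0)//; lra.
have dln0 : dl != 0 by rewrite gt_eqF.
set m := e _; have -> : c * (a + b) - dl^-1 * m = eps * (a + b) + ((a + b) / 2 - m) / dl.
  by rewrite /c; field.
by rewrite lerD2r.
Qed.

(** The infima [dd k] of the energy over the tails of the hull increase to a finite limit [ds]. Take
    near-minimizers [h k]. The midpoint of two late ones is again in a late tail, so its energy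
    cannot fall much below [ds]; by [powint_sub_le] the two are then close, and [h] is Cauchy. *)
Theorem mazur : exists (h : nat -> T -> R) (G : T -> R),
  [/\ forall k, mid_hull V k (h k), measurable_fun setT G, (E G <= M%:E)%E &
    forall eta : R, 0 < eta -> exists N, forall k, (N <= k)%N ->
      (E (fun x => h k x - G x)%R <= eta%:E)%E].
Proof.
pose D k := [set e f | f in mid_hull V k].
pose dd k := inf (D k).
have D0 k : D k !=set0 by exists (e (V k)); exists (V k) => //; exact: mid_hull_base.
have Dlb k : has_lbound (D k) by exists 0 => _ [f _ <-].
have dd_le k f : mid_hull V k f -> dd k <= e f.
  by move=> hf; apply: ge_inf => //; exists f.
have ddM k : dd k <= M.
  by apply: le_trans (dd_le k (V k) _) (e_leM (k := k) _); exact: mid_hull_base.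
have dd_nd k l : (k <= l)%N -> dd k <= dd l.
  move=> kl; apply: lb_le_inf => // _ [f hf <-]; apply: dd_le.
  exact: mid_hull_mono hf.
have [ds dsub dsP] : exists2 ds, (forall k, dd k <= ds) &
    forall eta, 0 < eta -> exists k, ds - eta < dd k.
  have hs : has_sup (range dd).
    by split; [exists (dd 0%N), 0%N|exists M => _ [k _ <-]].
  exists (sup (range dd)) => [k|eta eta0].
    by apply: ub_le_sup; [exact: hs.2|exists k].
  by have [_ [k _ <-] h] := sup_adherent eta0 hs; exists k.
have /choice[h hP] : forall k, exists f, mid_hull V k f /\ e f < dd k + k.+1%:R^-1.
  move=> k; have [|_ [f hf <-] fk] := @inf_adherent _ (D k) k.+1%:R^-1 _ (conj (D0 k) (Dlb k)).
    by rewrite invr_gt0.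
  by exists f.
have mh k : measurable_fun setT (h k) by have [/measurable_mid_hull] := hP k.
have hC : forall eta : R, 0 < eta -> exists N, forall j k, (N <= j)%N -> (N <= k)%N ->
     (E (fun x => h j x - h k x)%R <= eta%:E)%E.
  move=> eta eta0.
  (* The [+ 1] keeps the denominator positive when [M = 0]. *)
  pose eps := eta / (2 * (2 * M + 1)).
  have eps0 : 0 < eps by rewrite divr_gt0// mulr_gt0// ltr_wpDl// mulr_ge0.
  have [dl dl0 uc] := uniform_convexity_powR p1 eps0.
  have z0 : 0 < dl * eta / 4 by rewrite divr_gt0// mulr_gt0.
  have [N1 N1P] := dsP _ z0.
  have [N2 _ /(_ _ (leqnn _))/= N2P] := near_infty_natSinv_lt (PosNum z0).
  exists (maxn N1 N2) => j k; rewrite !geq_max => /andP[jN1 jN2] /andP[kN1 kN2].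
  have [hj ej] := hP j; have [hk ek] := hP k.
  have hj' := mid_hull_mono jN1 hj; have hk' := mid_hull_mono kN1 hk.
  apply: le_trans (powint_sub_le eps0 dl0 uc hj' hk') _; rewrite lee_fin.
  have em := dd_le _ _ (mid_hull_mid hj' hk').
  have inv_le (i : nat) : (N2 <= i)%N -> i.+1%:R^-1 <= N2.+1%:R^-1 :> R.
    by move=> iN; rewrite lef_pV2 ?posrE ?ltr0n// ler_nat.
  have := inv_le _ jN2; have := inv_le _ kN2 => ik ij.
  have e1 : eps * (2 * (2 * M + 1)) = eta.
    by rewrite /eps divfK// gt_eqF// mulr_gt0// ltr_wpDl// mulr_ge0.
  have ea : e (h j) <= ds + dl * eta / 4.
    by apply: le_trans (ltW ej) (lerD (dsub j) (le_trans ij (ltW N2P))).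
  have eb : e (h k) <= ds + dl * eta / 4.
    by apply: le_trans (ltW ek) (lerD (dsub k) (le_trans ik (ltW N2P))).
  have em' : ds - dl * eta / 4 <= e (fun x => (h j x + h k x) / 2).
    exact: le_trans (ltW N1P) em.
  exact: cauchy_bound e1 eps0 dl0 ea eb em'.
have [G [mG hG GM]] := riesz_fischer p1 mh hC.
exists h, G; split => //; first by move=> k; have [] := hP k.
by apply: GM => k; have [/powint_mid_hull] := hP k.
Qed.

End mazur.

(** * Weak derivatives from difference quotients *)

Section compact_support.
Context {R : realType} {n : nat}.
Local Notation mu := (@lebesgue_rV R n).
Implicit Types (f g phi F : 'rV[R]_n -> R) (c x : 'rV[R]_n).

Definition csupp phi c (r : R) := forall x, ~ cball c r x -> phi x = 0.

Lemma continuous_bounded_cball f c r : continuous f ->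
  exists2 B : R, 0 < B & forall x, cball c r x -> `|f x| <= B.
Proof.
move=> cf; have [->|/set0P ne] := eqVneq (cball c r) set0; first by exists 1.
have cn : {within cball c r, continuous (fun x => `|f x|)}.
  apply: continuous_subspaceT => x.
  apply: (@continuous_comp _ _ _ f (fun y => `|y|)); first exact: cf.
  exact: norm_continuous.
have [y _ yP] := EVT_max_rV ne (@compact_cball R n c r) cn.
exists (`|f y| + 1); first by rewrite ltr_wpDl.
by move=> x xr; rewrite (le_trans (yP x _))// ?inE// lerDl.
Qed.

Lemma integrable_indic_cball c r (B : R) :
  mu.-integrable setT (fun x => (B * \1_(cball c r) x)%:E).
Proof.
have [r0|r0] := leP 0 r; last first.
  rewrite (_ : (fun _ => _) = cst 0%E); first exact: integrable0.
  apply/funext => x; rewrite indicE memNset ?mulr0//.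
  by rewrite /cball/= => /le_lt_trans - /(_ _ r0); rewrite normr_lt0.
under eq_fun do rewrite EFinM; apply: integrableZl => //.
apply/integrableP; split.
  by apply/measurable_EFinP/measurable_indic; exact: measurable_cball.
under eq_integral do rewrite gee0_abs ?lee_fin//.
by rewrite int_indic_cball// ltry.
Qed.

Lemma integrable_csupp f c r (B : R) : measurable_fun setT f ->
  (forall x, `|f x| <= B) -> csupp f c r -> mu.-integrable setT (EFin \o f).
Proof.
move=> mf fB fr; apply: (le_integrable _ _ _ (integrable_indic_cball c r B)) => //.
  exact/measurable_EFinP.
move=> x _ /=; rewrite lee_fin.
have [xr|/fr ->] := pselect (cball c r x); last by rewrite normr0.
by rewrite indicE mem_set// mulr1 (le_trans (fB x))// ler_norm.
Qed.

Lemma csupp_bounded f c r : continuous f -> csupp f c r ->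
  exists2 B : R, 0 < B & forall x, `|f x| <= B.
Proof.
move=> cf fr; have [B B0 BP] := continuous_bounded_cball c r cf.
exists B => // x; have [/BP//|/fr ->] := pselect (cball c r x).
by rewrite normr0 ltW.
Qed.

Lemma integrable_continuous_csupp f c r : continuous f -> csupp f c r ->
  mu.-integrable setT (EFin \o f).
Proof.
move=> cf fr; have [B _ BP] := csupp_bounded cf fr.
by apply: integrable_csupp BP fr; exact: continuous_measurable_rV.
Qed.

Lemma csuppM f phi c r : csupp phi c r -> csupp (fun x => f x * phi x) c r.
Proof. by move=> pr x /pr ->; rewrite mulr0. Qed.

Lemma continuousM_rV f g : continuous f -> continuous g -> continuous (fun x => f x * g x).
Proof. by move=> cf cg x; exact: (@cvgM _ _ (nbhs x) _ f g _ _ (cf x) (cg x)). Qed.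

Lemma continuous_rV_shift (v : 'rV[R]_n) : continuous (fun x : 'rV[R]_n => x + v).
Proof. by move=> x; exact: (@cvgD R _ _ (nbhs x) _ idfun (cst v) x v cvg_id (cvg_cst v)). Qed.

Lemma continuous_comp_shift f (v : 'rV[R]_n) : continuous f -> continuous (fun x => f (x + v)).
Proof.
move=> cf x; apply: (@continuous_comp _ _ _ (fun x => x + v) f); last exact: cf.
exact: continuous_rV_shift.
Qed.

Lemma continuousB_rV f g : continuous f -> continuous g -> continuous (fun x => f x - g x).
Proof. by move=> cf cg x; exact: (@cvgB _ _ _ (nbhs x) _ f g _ _ (cf x) (cg x)). Qed.

Lemma continuousN_rV f : continuous f -> continuous (fun x => - f x).
Proof. by move=> cf x; exact: (@cvgN _ _ _ (nbhs x) _ f _ (cf x)). Qed.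

Lemma continuous_diffquot f (c0 : R) (v : 'rV[R]_n) : continuous f ->
  continuous (fun x => c0 * (f (x + v) - f x)).
Proof.
move=> cf; have cB := continuousB_rV (continuous_comp_shift (v := v) cf) cf.
by move=> x; exact: (@cvgM _ _ (nbhs x) _ (cst c0) _ _ _ (cvg_cst c0) (cB x)).
Qed.

(** Either [|u| <= a], or [|u| / a >= 1] and then [|u| <= a (|u| / a)^p]. *)
Lemma norm_le_powR (p a u : R) : 1 <= p -> 0 < a ->
  `|u| <= a + a `^ (1 - p) * `|u| `^ p.
Proof.
move=> p1 a0; have [ua|au] := leP `|u| a.
  by rewrite (le_trans ua)// lerDl mulr_ge0// powR_ge0.
have u0 := lt_trans a0 au.
rewrite -[leLHS]add0r lerD ?(ltW a0)// -(mulr_powRB1 (ltW u0)); last by rewrite (lt_le_trans _ p1).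
rewrite mulrCA; apply: ler_peMr; rewrite ?(ltW u0)//.
rewrite -[1 - p]opprB powRN mulrC ler_pdivlMr ?powR_gt0// mul1r.
by apply: ge0_ler_powR; rewrite ?nnegrE ?subr_ge0 ?(ltW u0) ?(ltW a0) ?(ltW au).
Qed.

(* Hölder's inequality on a ball, in Young's form with a free parameter [a]. *)
Lemma Lp_csupp_integral_le (p a B M : R) f phi c r : 1 < p -> 0 < a -> 0 <= r ->
  measurable_fun setT f -> measurable_fun setT phi ->
  (forall x, `|phi x| <= B) -> csupp phi c r -> (powint mu p f <= M%:E)%E ->
  (\int[mu]_x (`|f x * phi x|)%:E <= (B * (a * (2 * r) ^+ n + a `^ (1 - p) * M))%:E)%E.
Proof.
move=> p1 a0 r0 mf mphi phiB phir fM.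
have B0 : 0 <= B by exact: le_trans (phiB 0).
have mB : measurable_fun setT (\1_(cball c r) : 'rV[R]_n -> R) by exact: measurable_indic_cball.
have mfp := measurable_norm_powR p mf.
have i0 x : 0 <= a * \1_(cball c r) x by rewrite mulr_ge0// ltW.
have p0 x : 0 <= `|f x| `^ p by exact: powR_ge0.
have a1 : 0 <= a `^ (1 - p) by exact: powR_ge0.
have q0 x : 0 <= a `^ (1 - p) * `|f x| `^ p by exact: mulr_ge0.
have mai : measurable_fun setT (fun x => a * \1_(cball c r) x) by exact: measurable_funM.
have maf : measurable_fun setT (fun x => a `^ (1 - p) * `|f x| `^ p) by exact: measurable_funM.
apply: (@le_trans _ _ (\int[mu]_x (B * (a * \1_(cball c r) x + a `^ (1 - p) * `|f x| `^ p))%:E)%E).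
  apply: ge0_le_int => //.
  - by apply: measurableT_comp => //; exact: measurable_funM.
  - by apply: measurable_funM => //; exact: measurable_funD.
  - move=> x; have [xr|/phir ->] := pselect (cball c r x); last first.
      by rewrite mulr0 normr0 mulr_ge0// addr_ge0.
    rewrite normrM mulrC ler_pM//.
    by rewrite indicE mem_set// mulr1 norm_le_powR// ltW.
rewrite ge0_intZ//; [|exact: measurable_funD|by move=> x; rewrite addr_ge0].
rewrite ge0_intD// (ge0_intZ _ mB _ (ltW a0))// int_indic_cball// (ge0_intZ _ mfp)//.
rewrite EFinM lee_wpmul2l ?lee_fin// EFinD leeD// EFinM ?lee_wpmul2l ?lee_fin//.
Qed.

End compact_support.

Section difference_quotients.
Context {R : realType} {n : nat}.
Local Notation mu := (@lebesgue_rV R n).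
Implicit Types (f g phi F : 'rV[R]_n -> R) (c x : 'rV[R]_n).
Local Notation e_ i := (delta_mx ord0 i : 'rV[R]_n).

Lemma is_derive_line phi i x (s : R) : derivable phi (x + s *: e_ i) (e_ i) ->
  is_derive s 1 (fun s => phi (x + s *: e_ i)) (partial i phi (x + s *: e_ i)).
Proof.
move=> d.
have E : (fun h : R => h^-1 *: (((fun s => phi (x + s *: e_ i)) \o shift s) (h *: 1) - phi (x + s *: e_ i)))
   = (fun h : R => h^-1 *: ((phi \o shift (x + s *: e_ i)) (h *: e_ i) - phi (x + s *: e_ i))).
  apply/funext => h /=; congr (_ *: (phi _ - _)).
  by rewrite [h *: 1]mulr1 scalerDl addrCA.
apply: DeriveDef; first by rewrite /derivable E.
by rewrite /derive E.
Qed.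

Lemma diffquot_le phi i (B t : R) x : (forall y, derivable phi y (e_ i)) ->
  (forall y, `|partial i phi y| <= B) -> `|phi (x + t *: e_ i) - phi x| <= B * `|t|.
Proof.
move=> dphi phiB; pose f s := phi (x + s *: e_ i).
have df (s : R) : is_derive s 1 f (partial i phi (x + s *: e_ i)) by exact: is_derive_line.
have cf : continuous f.
  by move=> s; apply/differentiable_continuous/derivable1_diffP; have [] := df s.
have -> : phi x = f 0 by rewrite /f scale0r addr0.
have B0 : 0 <= B by exact: le_trans (phiB 0).
rewrite -/(f t); have [t0|t0|->] := ltgtP t 0; last by rewrite subrr !normr0 mulr0.
- have [c _] := @MVT R f _ t 0 t0 (fun s _ => df s) (continuous_subspaceT cf).
  by rewrite distrC => ->; rewrite sub0r normrM normrN ler_wpM2r.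
- have [c _ ->] := @MVT R f _ 0 t t0 (fun s _ => df s) (continuous_subspaceT cf).
  by rewrite subr0 normrM ler_wpM2r.
Qed.

Lemma test_function_csupp phi : test_function phi ->
  exists2 r : R, 0 <= r & csupp phi 0 r.
Proof.
move=> [_ [K cK K0]]; have [M [Mr MP]] := compact_bounded cK.
exists (`|M| + 1); first by rewrite addr_ge0.
move=> x nx; apply: K0 => Kx; apply: nx; rewrite /cball/= subr0.
by apply: (MP (`|M| + 1)) => //; rewrite (le_lt_trans (ler_norm M))// ltrDl.
Qed.

Lemma csupp_partial phi i c r : csupp phi c r -> csupp (partial i phi) c r.
Proof.
move=> pr x nx.
have o : open (~` cball c r) by apply: closed_openC; apply: compact_closed; [exact: norm_hausdorff|exact: compact_cball].
rewrite /partial (@near_eq_derive _ _ _ phi (cst 0)) ?derive_cst//.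
have : nbhs x (~` cball c r) by exact: open_nbhs_nbhs.
by apply: filterS => y ny; rewrite (pr y ny).
Qed.

End difference_quotients.

Section weak_derivative.
Context {R : realType} {n : nat}.
Local Notation mu := (@lebesgue_rV R n).
Implicit Types (f g phi F : 'rV[R]_n -> R) (c x : 'rV[R]_n).
Local Notation e_ i := (delta_mx ord0 i : 'rV[R]_n).
Local Notation I f := (Rintegral mu setT f).

Lemma integral_Rintegral f : mu.-integrable setT (EFin \o f) ->
  (\int[mu]_x (f x)%:E)%E = (I f)%:E.
Proof. by move=> fi; rewrite /Rintegral fineK//; exact: integrable_fin_num. Qed.

Lemma Lp_csupp_integrable (p M B : R) f phi c r : 1 < p -> 0 <= r ->
  measurable_fun setT f -> measurable_fun setT phi ->
  (forall x, `|phi x| <= B) -> csupp phi c r -> (powint mu p f <= M%:E)%E ->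
  mu.-integrable setT (EFin \o (fun x => f x * phi x)).
Proof.
move=> p1 r0 mf mphi phiB phir fM; apply/integrableP; split.
  by apply/measurable_EFinP; exact: measurable_funM.
apply: le_lt_trans (ltry _).
exact: (Lp_csupp_integral_le p1 ltr01 r0 mf mphi phiB phir fM).
Qed.

Lemma Rint_shift f (v : 'rV[R]_n) : measurable_fun setT f ->
  I (fun x => f (x + v)) = I f.
Proof.
move=> mf; rewrite /Rintegral; congr fine.
have := @integral_rV_shift R n v (EFin \o f); apply.
exact/measurable_EFinP.
Qed.

(** Discrete integration by parts, by translation invariance; the step of the quotient changes sign
    when it moves to [phi]. *)
Lemma Rint_diffquot F phi (c0 : R) (v : 'rV[R]_n) r : continuous F -> continuous phi ->
  csupp phi 0 r ->
  I (fun x => c0 * (F (x + v) - F x) * phi x) =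
  I (fun x => F x * (c0 * (phi (x - v) - phi x))).
Proof.
move=> cF cphi phir.
have cFs := continuous_comp_shift (v := v) cF.
have cphis := continuous_comp_shift (v := - v) cphi.
have phisr : csupp (fun x => phi (x - v)) v r.
  by move=> x nx; apply: phir => h; apply: nx; move: h; rewrite /cball/= subr0.
have i1 : mu.-integrable setT (EFin \o (fun x => F (x + v) * phi x)).
  exact: integrable_continuous_csupp (continuousM_rV cFs cphi) (csuppM _ phir).
have i2 : mu.-integrable setT (EFin \o (fun x => F x * phi x)).
  exact: integrable_continuous_csupp (continuousM_rV cF cphi) (csuppM _ phir).
have i3 : mu.-integrable setT (EFin \o (fun x => F x * phi (x - v))).
  exact: integrable_continuous_csupp (continuousM_rV cF cphis) (csuppM _ phisr).
have iB (f g : 'rV[R]_n -> R) : mu.-integrable setT (EFin \o f) -> mu.-integrable setT (EFin \o g) ->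
    mu.-integrable setT (EFin \o (fun x => f x - g x)).
  move=> fi gi; rewrite (_ : _ \o _ = (fun x => (f x)%:E - (g x)%:E)%E) //.
  exact: integrableB.
transitivity (c0 * (I (fun x => F (x + v) * phi x) - I (fun x => F x * phi x))).
  rewrite -RintegralB// -RintegralZl//; last exact: iB.
  by apply: eq_Rintegral => x _; ring.
transitivity (c0 * (I (fun x => F x * phi (x - v)) - I (fun x => F x * phi x))).
  congr (_ * (_ - _)).
  rewrite -(@Rint_shift (fun x => F x * phi (x - v)) v); last first.
    apply: continuous_measurable_rV; exact: continuousM_rV cF cphis.
  by apply: eq_Rintegral => x _; rewrite addrK.
rewrite -RintegralB// -RintegralZl//; last exact: iB.
by apply: eq_Rintegral => x _; ring.
Qed.

Lemma diffquot_cvg phi i x : derivable phi x (e_ i) ->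
  (fun k : nat => k.+1%:R * (phi (x - k.+1%:R^-1 *: e_ i) - phi x)) @ \oo --> - partial i phi x.
Proof.
move=> d.
pose q (h : R) := h^-1 * (phi (h *: e_ i + x) - phi x).
have qd : q h @[h --> 0^'] --> partial i phi x by exact: d.
move/cvgr_dnbhsP : qd => qd.
have {}qd : q (- k.+1%:R^-1) @[k --> \oo] --> partial i phi x.
  apply: (qd (fun k => - k.+1%:R^-1)); split; first by move=> k; rewrite oppr_eq0 invr_eq0 pnatr_eq0.
  by have := cvgN (@cvg_harmonic R); rewrite oppr0 => /(_ _); exact.
rewrite (_ : (fun k : nat => _) = (fun k => - q (- k.+1%:R^-1))); last first.
  by apply/funext => k; rewrite /q invrN invrK mulNr opprK scaleNr [_ + x]addrC.
by apply: cvgN; exact: qd.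
Qed.

Lemma Rint_diffquot_cvg F phi i : continuous F -> test_function phi ->
  (fun k : nat => I (fun x => F x * (k.+1%:R * (phi (x - k.+1%:R^-1 *: e_ i) - phi x)))) @ \oo -->
  - I (fun x => F x * partial i phi x).
Proof.
move=> cF tphi; have [r r0 phir] := test_function_csupp tphi.
have [sphi _] := tphi.
have [cphi dphi] := sphi [::]; have [cdphi _] := sphi [:: i].
have [B1 B10 B1P] := csupp_bounded cdphi (csupp_partial i phir).
(* The steps have length at most 1, so all quotients of [phi] are supported in the ball of radius
   [r + 1], which also supports the dominating function. *)
have [BF BF0 BFP] := continuous_bounded_cball 0 (r + 1) cF.
pose D k x := k.+1%:R * (phi (x - k.+1%:R^-1 *: e_ i) - phi x).
have DB k x : `|D k x| <= B1.
  rewrite normrM ger0_norm// -scaleNr.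
  have := diffquot_le (- k.+1%:R^-1) x (dphi i) B1P.
  move=> /(ler_wpM2l (ler0n R k.+1)) /le_trans; apply.
  by rewrite normrN ger0_norm ?invr_ge0// mulrCA divff ?mulr1// pnatr_eq0.
have Dsupp k : csupp (D k) 0 (r + 1).
  move=> x /negP; rewrite /cball/= subr0 -ltNge => xr.
  rewrite /D !phir ?subrr ?mulr0//.
    by apply/negP; rewrite /cball/= subr0 -ltNge (lt_le_trans _ (ltW xr))// ltrDl.
  apply/negP; rewrite /cball/= subr0 -ltNge -(ltrD2r 1) (lt_le_trans xr)//.
  rewrite -[X in `|X| <= _](subrK (k.+1%:R^-1 *: e_ i)) (le_trans (ler_normD _ _))// lerD2l.
  by rewrite normrZ norm_delta_mx mulr1 ger0_norm ?invr_ge0// invf_le1// ler1n.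
have cD k : continuous (D k) by exact: continuous_diffquot.
have iFD k : mu.-integrable setT (EFin \o (fun x => F x * D k x)).
  exact: integrable_continuous_csupp (continuousM_rV cF (cD k)) (csuppM _ (Dsupp k)).
have iFd : mu.-integrable setT (EFin \o (fun x => F x * - partial i phi x)).
  apply: integrable_continuous_csupp (csuppM _ (_ : csupp _ 0 r)).
    by apply: continuousM_rV => //; exact: continuousN_rV.
  by move=> x /(csupp_partial i phir) ->; rewrite oppr0.
have := @dominated_convergence _ _ _ mu setT measurableT
  (fun k x => (F x * D k x)%:E) (fun x => (F x * - partial i phi x)%:E)
  (fun x => (BF * B1 * \1_(cball 0 (r + 1)) x)%:E).
case.
- by move=> k; have /integrableP[] := iFD k.
- by have /integrableP[] := iFd.
- apply: aeW => x _; apply: cvg_EFin; first exact: nearW.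
  apply: cvgM; first exact: cvg_cst.
  exact: diffquot_cvg (dphi i x).
- exact: integrable_indic_cball.
- apply: aeW => x k _; rewrite /= lee_fin.
  have [xr|/Dsupp ->] := pselect (cball 0 (r + 1) x).
    by rewrite indicE mem_set// mulr1 normrM ler_pM// BFP.
  by rewrite mulr0 normr0 mulr_ge0// mulr_ge0// ltW.
move=> _ _; rewrite /= (integral_Rintegral iFd).
under eq_fun do rewrite (integral_Rintegral (iFD _)).
have -> : I (fun x => F x * - partial i phi x) = - I (fun x => F x * partial i phi x).
  rewrite -mulN1r -RintegralZl//; first by apply: eq_Rintegral => x _; ring.
  exact: integrable_continuous_csupp (continuousM_rV cF cdphi) (csuppM _ (csupp_partial i phir)).
by move/fine_cvg.
Qed.

(** Being within [eps / 3] of the weak-derivative identity for a fixed [phi] is a convex condition.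
    It therefore passes from the late difference quotients [V k] to their midpoint hull, and then by
    strong convergence to [G]. *)
Theorem weak_partial_exists (p M : R) F i : 1 < p -> continuous F ->
  (forall t, 0 < t -> (\int[mu]_x (`|F (x + t *: e_ i) - F x| `^ p)%:E <= (M * t `^ p)%:E)%E) ->
  exists g, [/\ measurable_fun setT g, (powint mu p g <= M%:E)%E & weak_partial i F g].
Proof.
move=> p1 cF FM.
pose V k x := k.+1%:R * (F (x + k.+1%:R^-1 *: e_ i) - F x).
have cV k : continuous (V k) by exact: continuous_diffquot.
have mV k : measurable_fun setT (V k) by exact: continuous_measurable_rV.
have VM k : (powint mu p (V k) <= M%:E)%E.
  have cS := continuousB_rV (continuous_comp_shift (v := k.+1%:R^-1 *: e_ i) cF) cF.
  have mS := measurable_norm_powR p (continuous_measurable_rV cS).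
  have k0 : 0 <= k.+1%:R `^ p :> R by exact: powR_ge0.
  have S0 x : 0 <= `|F (x + k.+1%:R^-1 *: e_ i) - F x| `^ p by exact: powR_ge0.
  rewrite /powint; under eq_integral do rewrite /V normrM powRM// ger0_norm//.
  rewrite (ge0_intZ _ mS S0 k0).
  have ki : 0 < k.+1%:R^-1 :> R by rewrite invr_gt0.
  apply: le_trans (lee_wpmul2l _ (FM _ ki)) _; first by rewrite lee_fin.
  by rewrite -EFinM mulrCA -powRM ?invr_ge0// divff ?pnatr_eq0// powR1 mulr1.
have [h [G [hh mG GM hG]]] := mazur p1 mV VM.
exists G; split => // phi tphi.
have [r r0 phir] := test_function_csupp tphi.
have [sphi _] := tphi.
have [cphi dphi] := sphi [::]; have [cdphi _] := sphi [:: i].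
have [B B0 BP] := csupp_bounded cphi phir.
have mphi := continuous_measurable_rV cphi.
have iFd : mu.-integrable setT (EFin \o (fun x => F x * partial i phi x)).
  exact: integrable_continuous_csupp (continuousM_rV cF cdphi) (csuppM _ (csupp_partial i phir)).
have iphi f M' : measurable_fun setT f -> (powint mu p f <= M'%:E)%E ->
    mu.-integrable setT (EFin \o (fun x => f x * phi x)).
  by move=> mf fM; exact: Lp_csupp_integrable p1 r0 mf mphi BP phir fM.
have iG := iphi G M mG GM.
rewrite (integral_Rintegral iFd) (integral_Rintegral iG) -EFinN; congr EFin.
apply/eqP; rewrite -subr_eq0 opprK -normr_le0; apply/ler_addgt0Pl => eps eps0; rewrite addr0.
set L := I (fun x => F x * partial i phi x).
have hull_close : exists N, forall k f, (N <= k)%N -> mid_hull V k f ->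
    `|L + I (fun x => f x * phi x)| <= eps / 3.
  have e3 : 0 < eps / 3 by rewrite divr_gt0.
  have /cvgrPdist_le/(_ _ e3)[N _ NP] := Rint_diffquot_cvg (i := i) cF tphi.
  exists N => k f Nk; elim=> [j kj|f1 f2 h1 IH1 h2 IH2].
    have := NP j (leq_trans Nk kj); rewrite /= -normrN opprB opprK addrC.
    by rewrite (Rint_diffquot _ _ cF cphi phir).
  have m1 := measurable_mid_hull mV h1; have m2 := measurable_mid_hull mV h2.
  have i1 := iphi _ _ m1 (powint_mid_hull p1 mV VM h1).
  have i2 := iphi _ _ m2 (powint_mid_hull p1 mV VM h2).
  have -> : I (fun x => (f1 x + f2 x) / 2 * phi x) =
      2^-1 * (I (fun x => f1 x * phi x) + I (fun x => f2 x * phi x)).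
    rewrite -RintegralD// -RintegralZl//; last first.
      rewrite (_ : _ \o _ = (fun x => (f1 x * phi x)%:E + (f2 x * phi x)%:E)%E)//.
      exact: integrableD.
    by apply: eq_Rintegral => x _; field.
  move: IH1 IH2; set a := I _; set b := I _ => IH1 IH2.
  rewrite (_ : L + _ = 2^-1 * (L + a) + 2^-1 * (L + b)); last by field.
  rewrite (le_trans (ler_normD _ _))// !normrM ger0_norm ?invr_ge0//; lra.
have [N NP] := hull_close.
pose W := (2 * r) ^+ n.
have W0 : 0 <= W by rewrite exprn_ge0// mulr_ge0.
(* In the bound of [Lp_csupp_integral_le], [a] is fixed first to make the volume term small; the
   closeness [eta] in L_p is then chosen against [a^(1 - p)]. *)
pose a := eps / (3 * (B * W + 1)).
have a0 : 0 < a.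
  by rewrite divr_gt0// mulr_gt0// ltr_wpDl// mulr_ge0// ltW.
pose A := a `^ (1 - p).
have A0 : 0 < A by rewrite powR_gt0.
pose eta := eps / (3 * (B * A)).
have eta0 : 0 < eta by rewrite divr_gt0// !mulr_gt0.
have [N2 N2P] := hG _ eta0.
pose k := maxn N N2.
have mh := measurable_mid_hull mV (hh k).
have mhG : measurable_fun setT (fun x => h k x - G x) by exact: measurable_funB.
have hGk := N2P k (leq_maxr _ _).
have ih := iphi _ _ mh (powint_mid_hull p1 mV VM (hh k)).
have ihG := iphi _ _ mhG hGk.
have close2 : `|I (fun x => (h k x - G x) * phi x)| <= B * (a * W + A * eta).
  apply: le_trans (le_normr_Rintegral measurableT ihG) _.
  rewrite -lee_fin /Rintegral fineK; last first.
    by apply: integrable_fin_num => //; exact: integrable_norm.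
  exact: Lp_csupp_integral_le p1 a0 r0 mhG mphi BP phir hGk.
have E2 : I (fun x => (h k x - G x) * phi x) =
    I (fun x => h k x * phi x) - I (fun x => G x * phi x).
  by rewrite -RintegralB//; apply: eq_Rintegral => x _; rewrite mulrBl.
have := NP k (h k) (leq_maxl _ _) (hh k).
move: close2; rewrite E2; set u := I _; set v := I _ => c2 c1.
have b1 : B * (a * W) <= eps / 3.
  have BW : 0 < B * W + 1 by rewrite ltr_wpDl// mulr_ge0// ltW.
  have e1 : a * (B * W + 1) = eps / 3 by rewrite /a; field; rewrite gt_eqF.
  by rewrite mulrCA -e1 ler_wpM2l ?(ltW a0)// lerDl.
have b2 : B * (A * eta) = eps / 3 by rewrite /eta; field; rewrite !gt_eqF.
rewrite (_ : L + v = (L + u) - (u - v)); last by ring.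
apply: le_trans (ler_normB _ _) _.
apply: le_trans (lerD c1 c2) _; rewrite mulrDr b2.
by apply: le_trans (lerD (lexx _) (lerD b1 (lexx _))) _; rewrite le_eqVlt; apply/orP; left; apply/eqP; field.
Qed.

End weak_derivative.

(** * The extension operator *)

Section averaging.
Context {R : realType}.
Local Notation mu := (@lebesgue_measure R).
Implicit Types (M : R -> R) (a b s lo hi W eta : R).

Definition avg M : R := Rintegral mu `[1, 2] M.

Lemma integrable_nonincreasing M a b : nonincreasing_fun M ->
  mu.-integrable `[a, b] (EFin \o M).
Proof.
move=> Mni; apply: measurable_bounded_integrable.
- exact: measurable_itv.
- by rewrite /= lebesgue_measure_itv/=; case: ifP => // _; rewrite -EFinB ltry.
- by apply: nonincreasing_measurable.
- exists (Num.max `|M a| `|M b|); split; first exact: num_real.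
  move=> C MC x /=; rewrite in_itv/= => /andP[ax xb].
  apply: le_trans (ltW MC); rewrite le_max.
  have h1 := Mni _ _ ax; have h2 := Mni _ _ xb.
  have [x0|x0] := leP 0 (M x).
    by rewrite ger0_norm// (le_trans h1)// ler_norm.
  by rewrite ltr0_norm// orbC -normrN (le_trans _ (ler_norm _))// lerN2.
Qed.

Lemma avg_le M M' : nonincreasing_fun M -> nonincreasing_fun M' ->
  (forall s, 1 <= s <= 2 -> M s <= M' s) -> avg M <= avg M'.
Proof.
move=> Mn Mn' MM'; apply: le_Rintegral => //; try exact: integrable_nonincreasing.
Qed.

Lemma Rintegral_itv_cst a b c : a <= b -> Rintegral mu `[a, b] (fun=> c) = c * (b - a).
Proof.
move=> ab; rewrite Rintegral_cst//= lebesgue_measure_itv/= lte_fin.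
by case: ltP => [//|ba]; rewrite (_ : b - a = 0)//; apply/eqP; rewrite subr_eq0 eq_le ab ba.
Qed.

Lemma avg_cst c : avg (fun=> c) = c.
Proof. by rewrite /avg Rintegral_itv_cst ?ler1n//; ring. Qed.

Lemma avg_ge M lo : nonincreasing_fun M -> (forall s, 1 <= s <= 2 -> lo <= M s) -> lo <= avg M.
Proof.
by move=> Mn h; rewrite -[leLHS](avg_cst lo); apply: avg_le.
Qed.

Lemma avg_le_cst M hi : nonincreasing_fun M -> (forall s, 1 <= s <= 2 -> M s <= hi) -> avg M <= hi.
Proof.
by move=> Mn h; rewrite -[leRHS](avg_cst hi); apply: avg_le.
Qed.

Lemma integral_R_shift (f : R -> \bar R) eta : measurable_fun setT f ->
  (\int[mu]_s f (s + eta)%R = \int[mu]_s f s)%E.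
Proof.
move=> mf.
have mc : measurable_fun setT (fun x : measurableTypeR R => x + eta : measurableTypeR R).
  exact: measurable_funD.
have H g : measurable_fun setT g -> (forall x, 0 <= g x)%E ->
    (\int[mu]_x g (x + eta)%R = \int[mu]_x g x)%E.
  move=> mg g0; have := @ge0_integral_pushforward _ _ _ _ _ _ mc mu setT g.
  rewrite preimage_setT => /(_ measurableT mg (fun x _ => g0 x)) => <-.
  by apply: eq_measure_integral => A mA _; exact: lebesgue_measure_shift.
rewrite [LHS]integralE [RHS]integralE; congr (_ - _)%E.
  rewrite -[in RHS]H//; first by rewrite -/(f \o (fun x => x + eta)) funepos_comp.
  exact: measurable_funepos.
rewrite -[in RHS]H//; first by rewrite -/(f \o (fun x => x + eta)) funeneg_comp.
exact: measurable_funeneg.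
Qed.

Lemma avg_comp_shift M eta : nonincreasing_fun M ->
  avg (fun s => M (s + eta)) = Rintegral mu `[1 + eta, 2 + eta] M.
Proof.
move=> Mn; rewrite /avg /Rintegral; congr fine.
rewrite integral_mkcond [RHS]integral_mkcond -[RHS](integral_R_shift eta).
  apply: eq_integral => s _; rewrite !patchE.
  congr (if _ then _ else _) => //.
  by apply/idP/idP; rewrite !inE/= !in_itv/= !lerD2r//.
apply/(measurable_restrictT _ _).1; first exact: measurable_itv.
apply/measurable_EFinP; exact: nonincreasing_measurable.
Qed.

(** The common part of the two intervals cancels. What remains is the integral over [[1, 1 + eta]]
    minus that over [[2, 2 + eta]], at most [eta * (M 1 - M 3)] by monotonicity: averaging makes the
    cost of a shift proportional to its length. *)
Lemma avg_shift M W eta : nonincreasing_fun M -> 0 <= eta <= 1 ->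
  (forall s s', 1 <= s <= 3 -> 1 <= s' <= 3 -> M s - M s' <= W) ->
  avg M - eta * W <= avg (fun s => M (s + eta)).
Proof.
move=> Mn /andP[e0 e1] MW; rewrite avg_comp_shift// lerBlDr -lerBlDl.
pose J a b := Rintegral mu `[a, b] M.
have iM a b := @integrable_nonincreasing M a b Mn.
have h1 : J 1 (2 + eta) - J 1 2 = Rintegral mu `]2, (2 + eta)] M.
  by apply: Rintegral_itvB => //; rewrite bnd_simp; lra.
have h2 : J 1 (2 + eta) - J 1 (1 + eta) = J (1 + eta) (2 + eta).
  rewrite /J Rintegral_itvB//; [|by rewrite bnd_simp; lra..].
  apply: Rintegral_itv_obnd_cbnd; apply: integrableS (iM (1 + eta) (2 + eta)) => //.
  exact: subset_itv_oc_cc.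
have h3 : Rintegral mu `]2, (2 + eta)] M = J 2 (2 + eta).
  apply: Rintegral_itv_obnd_cbnd; apply: integrableS (iM 2 (2 + eta)) => //.
  exact: subset_itv_oc_cc.
have -> : avg M - Rintegral mu `[1 + eta, 2 + eta] M = J 1 (1 + eta) - J 2 (2 + eta).
  by rewrite -h3 -h1 -/(J _ _) -h2 /avg -/(J 1 2); ring.
have u1 : J 1 (1 + eta) <= M 1 * eta.
  rewrite (_ : M 1 * eta = Rintegral mu `[1, 1 + eta] (fun=> M 1)); last first.
    by rewrite Rintegral_itv_cst; [congr (_ * _); ring|lra].
  apply: le_Rintegral => //; first exact: integrable_nonincreasing.
  by move=> x; rewrite /= in_itv/= => /andP[x1 _]; exact: Mn.
have u2 : M 3 * eta <= J 2 (2 + eta).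
  rewrite (_ : M 3 * eta = Rintegral mu `[2, 2 + eta] (fun=> M 3)); last first.
    by rewrite Rintegral_itv_cst; [congr (_ * _); ring|lra].
  apply: le_Rintegral => //; first exact: integrable_nonincreasing.
  move=> x; rewrite /= in_itv/= => /andP[x1 x2]; apply: Mn; lra.
have := MW 1 3; rewrite !lexx (_ : 1 <= 3 :> R) ?ler1n// => /(_ isT isT) M13.
apply: le_trans (lerB u1 u2) _; rewrite -mulrBl mulrC ler_wpM2l//.
Qed.

End averaging.

Lemma scaled_ratio_le (R : realFieldType) (h dx dy : R) : 0 <= h -> 0 < dx -> 0 < dy ->
  200 * h <= dx -> dx <= dy + h -> 150 * h / dy <= 160 * (h / dx).
Proof.
move=> h0 dx0 dy0 hd dl; rewrite mulrA ler_pdivrMr// mulrAC ler_pdivlMr//.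
rewrite [150 * h]mulrC [160 * h]mulrC -!mulrA ler_wpM2l//; lra.
Qed.

Lemma scaled_ratio_small (R : realFieldType) (h dx W e : R) : 0 <= W -> 0 < dx -> 0 <= h ->
  h < e * dx / (160 * (W + 1)) -> 160 * (h / dx) * W <= e.
Proof.
move=> W0 dx0 h0; have W1 : 0 < W + 1 by rewrite ltr_wpDl.
rewrite ltr_pdivlMr ?mulr_gt0// => /ltW H.
rewrite mulrA mulrAC ler_pdivrMr//; apply: le_trans H.
have : h * W <= h * (W + 1) by rewrite ler_wpM2l// lerDl.
lra.
Qed.

(** * The extension by averaged infima and its increments *)

Section extension.
Context {R : realType} {n : nat}.
Variables (S : set 'rV[R]_n) (f : 'rV[R]_n -> R).
Implicit Types (x y u v : 'rV[R]_n) (r s h W : R).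
Hypotheses (clS : closed S) (S0 : S !=set0).

Definition dist x : R := inf [set `|x - u| | u in S].

Let dist_has_inf x : has_inf [set `|x - u| | u in S].
Proof.
split; first by have [u Su] := S0; exists `|x - u|, u.
by exists 0 => _ [u _ <-].
Qed.

Lemma dist_ge0 x : 0 <= dist x.
Proof. by apply: lb_le_inf; [exact: (dist_has_inf x).1|move=> _ [u _ <-]]. Qed.

Lemma dist_le x u : S u -> dist x <= `|x - u|.
Proof. by move=> Su; apply: ge_inf; [exact: (dist_has_inf x).2|exists u]. Qed.

Lemma dist_lt x r : dist x < r -> exists2 u, S u & cball x r u.
Proof.
rewrite -subr_gt0 => /inf_adherent /(_ (dist_has_inf x))[_ [u Su <-]].
by rewrite subrKC => /ltW ur; exists u => //; rewrite /cball/= distrC.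
Qed.

Lemma dist_lip x y : dist y <= dist x + `|x - y|.
Proof.
rewrite -lerBlDr; apply: lb_le_inf; first exact: (dist_has_inf x).1.
move=> _ [u Su <-]; rewrite lerBlDr (le_trans (dist_le y Su))//.
apply: le_trans (ler_distD x y u) _.
by rewrite [leRHS]addrC lerD2r distrC.
Qed.

Lemma dist_eq0 x : S x -> dist x = 0.
Proof.
by move=> Sx; apply/eqP; rewrite eq_le dist_ge0 andbT (le_trans (dist_le x Sx))// subrr normr0.
Qed.

Lemma dist_gt0 x : ~ S x -> 0 < dist x.
Proof.
move=> nSx; rewrite lt_neqAle dist_ge0 andbT; apply/negP => /eqP d0; apply: nSx.
apply: clS => B /nbhs_ballP[e /= e0 eB].
have [|u Su ux] := @dist_lt x (e / 2); first by rewrite -d0 divr_gt0.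
exists u; split => //; apply: eB; rewrite -ball_normE/= distrC.
by rewrite (le_lt_trans ux)// ltr_pdivrMr// ltr_pMr// ltr1n.
Qed.

Definition osc x r W := forall u v, S u -> S v -> cball x r u -> cball x r v ->
  `|f u - f v| <= W.

Variable om : R -> R.
Hypothesis f_osc : forall x r, 0 < r -> osc x r (om r).

Definition minf x r : R := inf [set f u | u in S `&` cball x r].

Let minf_has_inf x r : dist x < r -> has_inf [set f u | u in S `&` cball x r].
Proof.
move=> dr; have [u Su ur] := dist_lt dr; split; first by exists (f u), u.
exists (f u - om r) => _ [v [Sv vr] <-]; rewrite lerBlDr -lerBlDl.
apply: le_trans (ler_norm _) _.
by apply: (f_osc (le_lt_trans (dist_ge0 x) dr) Su Sv ur vr).
Qed.

Lemma minf_le x r u : dist x < r -> S u -> cball x r u -> minf x r <= f u.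
Proof. by move=> dr Su ur; apply: ge_inf; [exact: (minf_has_inf dr).2|exists u]. Qed.

Lemma minf_ge x r lo : dist x < r -> (forall u, S u -> cball x r u -> lo <= f u) ->
  lo <= minf x r.
Proof.
move=> dr h; apply: lb_le_inf; first exact: (minf_has_inf dr).1.
by move=> _ [u [Su ur] <-]; exact: h.
Qed.

Lemma minf_sub x y r r' : dist x < r -> dist y < r' -> `|x - y| + r <= r' ->
  minf y r' <= minf x r.
Proof.
move=> dr dr' rr'; apply: minf_ge => // u Su ur; apply: minf_le => //.
rewrite /cball/=; apply: le_trans (ler_distD x u y) _; rewrite addrC.
by apply: le_trans rr'; rewrite lerD2l.
Qed.

(* The [max] only makes the profile monotone on the whole line: [s] ranges over [[1, 2]]. *)
Definition rad x s := dist x * (1 + Num.max s 1 / 50).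

Definition prof x s := minf x (rad x s).

Definition ext x := if `[< S x >] then f x else avg (prof x).

Lemma extS x : S x -> ext x = f x.
Proof. by move=> Sx; rewrite /ext asboolT. Qed.

Lemma extNS x : ~ S x -> ext x = avg (prof x).
Proof. by move=> Sx; rewrite /ext asboolF. Qed.

Lemma radE x s : 1 <= s -> rad x s = dist x * (1 + s / 50).
Proof. by move=> s1; rewrite /rad max_l. Qed.

Lemma dist_lt_rad x s : ~ S x -> dist x < rad x s.
Proof.
move=> /dist_gt0 d0; rewrite /rad ltr_pMr// ltrDl divr_gt0//.
by rewrite lt_max ltr01 orbT.
Qed.

Lemma prof_nonincreasing x : ~ S x -> nonincreasing_fun (prof x).
Proof.
move=> nSx s s' ss'; apply: minf_sub; try exact: dist_lt_rad.
rewrite subrr normr0 add0r /rad ler_wpM2l ?dist_ge0// lerD2l ler_wpM2r//.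
by rewrite ge_max !le_max ss' lexx orbT.
Qed.

Lemma prof_shift_nonincreasing x (eta : R) : ~ S x -> nonincreasing_fun (fun s => prof x (s + eta)).
Proof. by move=> nSx s s' ss'; apply: prof_nonincreasing => //; rewrite lerD2r. Qed.

Opaque dist ext.

Lemma ext_between x lo hi : (forall u, S u -> cball x (dist x * (1 + 2 / 50)) u -> lo <= f u <= hi) ->
  lo <= ext x <= hi.
Proof.
move=> H; have [Sx|nSx] := pselect (S x).
  rewrite extS//; apply: H => //.
  by rewrite /cball/= subrr normr0 mulr_ge0 ?dist_ge0// addr_ge0// divr_ge0.
have pn := prof_nonincreasing nSx.
have radle s : 1 <= s <= 2 -> rad x s <= dist x * (1 + 2 / 50).
  move=> /andP[s1 s2]; rewrite radE// ler_wpM2l ?dist_ge0// lerD2l ler_wpM2r//.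
rewrite extNS//; apply/andP; split.
  apply: avg_ge => // s /radle sr; apply: minf_ge; first exact: dist_lt_rad.
  by move=> u Su ur; have /andP[] := H u Su (le_trans ur sr).
apply: avg_le_cst => // s /radle sr.
have [u Su ur] := dist_lt (dist_lt_rad s nSx).
by apply: le_trans (minf_le (dist_lt_rad s nSx) Su ur) _; have /andP[] := H u Su (le_trans ur sr).
Qed.

(** Write [h = |x - y|]. Shifting [s] by [eta = 150 h / dist x] enlarges the radius at [x] by [3 h].
    The ball at [y] with parameter [s <= 2] is contained in the ball at [x] enlarged by only
    [(2 + 1/25) h], so the shifted profile at [x] lies below the profile at [y]. The shift costs
    [eta * W], and [eta <= 1] keeps the parameters in [[1, 3]]. *)
Lemma ext_lower x y W : ~ S x -> ~ S y -> 150 * `|x - y| <= dist x ->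
  osc x (dist x * (1 + 3 / 50)) W -> ext x - 150 * `|x - y| / dist x * W <= ext y.
Proof.
move=> nSx nSy; set h := `|x - y| => hd ow; have d0 := dist_gt0 nSx.
rewrite (extNS nSx) (extNS nSy); set eta := 150 * h / dist x.
have h0 : 0 <= h by exact: normr_ge0.
have eta01 : 0 <= eta <= 1.
  by rewrite /eta divr_ge0 ?mulr_ge0 ?(ltW d0)//= ler_pdivrMr// mul1r.
apply: (@le_trans _ _ (avg (fun s => prof x (s + eta)))).
  apply: avg_shift => //; first exact: prof_nonincreasing.
  move=> s s' /andP[s1 s3] /andP[s1' s3'].
  have [u Su ur] := dist_lt (dist_lt_rad s nSx).
  rewrite lerBlDr; apply: le_trans (minf_le (dist_lt_rad s nSx) Su ur) _.
  rewrite -lerBlDl; apply: minf_ge; first exact: dist_lt_rad.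
  have radle t : 1 <= t -> t <= 3 -> rad x t <= dist x * (1 + 3 / 50).
    by move=> t1 t3; rewrite radE// ler_wpM2l ?dist_ge0// lerD2l ler_wpM2r.
  move=> v Sv vr; rewrite lerBlDr -lerBlDl (le_trans (ler_norm _))//.
  by apply: ow => //; [exact: le_trans ur (radle _ s1 s3)|exact: le_trans vr (radle _ s1' s3')].
apply: avg_le; [exact: prof_shift_nonincreasing|exact: prof_nonincreasing|].
move=> s /andP[s1 s2]; apply: minf_sub; try exact: dist_lt_rad.
have es : dist x * eta = 150 * h by rewrite /eta mulrC divfK// gt_eqF.
have eta0 : 0 <= eta by case/andP: eta01.
have -> : rad x (s + eta) = dist x * (1 + (s + eta) / 50).
  by rewrite radE// (le_trans s1)// lerDl.
rewrite distrC -/h (radE _ s1).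
have dl := dist_lip x y; rewrite -/h in dl.
have s50 : 0 <= 1 + s / 50 by rewrite addr_ge0// divr_ge0// (le_trans _ s1).
apply: (@le_trans _ _ (h + (dist x + h) * (1 + s / 50))).
  by rewrite lerD2l ler_wpM2r.
rewrite (_ : dist x * (1 + (s + eta) / 50) = dist x * (1 + s / 50) + dist x * eta / 50); last by field.
rewrite es.
have hs : h * s <= h * 2 by rewrite ler_wpM2l.
lra.
Qed.

(** [ext_lower] in both directions. Since [dist y] is at least [(199/200) dist x], replacing
    [dist y] by [dist x] turns 150 into at most 160, and the radius 11/10 accommodates the
    oscillation ball at [y]. *)
Lemma ext_near x y W : ~ S x -> 200 * `|x - y| <= dist x -> osc x (11 / 10 * dist x) W ->
  `|ext y - ext x| <= 160 * (`|x - y| / dist x) * W.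
Proof.
move=> nSx; set h := `|x - y| => hd ow; have d0 := dist_gt0 nSx.
have h0 : 0 <= h by exact: normr_ge0.
have nSy : ~ S y.
  by move=> Sy; have := dist_le x Sy; rewrite -/h; lra.
have dl := dist_lip x y; rewrite -/h in dl.
have dl' := dist_lip y x; rewrite distrC -/h in dl'.
have dy0 := dist_gt0 nSy.
have W0 : 0 <= W.
  have [u Su ur] : exists2 u, S u & cball x (11 / 10 * dist x) u by apply: dist_lt; lra.
  by have := ow u u Su Su ur ur; exact: le_trans.
have ox : osc x (dist x * (1 + 3 / 50)) W.
  by move=> u v Su Sv ur vr; apply: ow => //; [apply: le_trans ur _|apply: le_trans vr _]; lra.
have oy : osc y (dist y * (1 + 3 / 50)) W.
  have sub u : cball y (dist y * (1 + 3 / 50)) u -> cball x (11 / 10 * dist x) u.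
    rewrite /cball/= => ur; apply: le_trans (ler_distD y u x) _.
    rewrite [`|y - x|]distrC -/h; lra.
  by move=> u v Su Sv /sub ur /sub vr; exact: ow.
have hx : 150 * `|x - y| <= dist x.
  by apply: le_trans hd; rewrite ler_wpM2r// ler_nat.
have hy : 150 * `|y - x| <= dist y by rewrite distrC -/h; clear -h0 hd dl'; lra.
have L1 := ext_lower nSx nSy hx ox.
have L2 := ext_lower nSy nSx hy oy.
rewrite -/h in L1; rewrite [`|y - x|]distrC -/h in L2.
have e1 : 150 * h / dist x * W <= 160 * (h / dist x) * W.
  by rewrite ler_wpM2r// -mulrA ler_wpM2r ?divr_ge0 ?(ltW d0)// ler_nat.
have e2 : 150 * h / dist y * W <= 160 * (h / dist x) * W.
  by rewrite ler_wpM2r//; exact: scaled_ratio_le.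
move: L1 L2 e1 e2; move: (ext x) (ext y) (150 * h / dist x * W) (150 * h / dist y * W) (160 * (h / dist x) * W).
move=> a b c1 c2 c3 L1 L2 e1 e2.
rewrite ler_distl; apply/andP; split; lra.
Qed.

(** Far from [S] this is [ext_near]. When [dist x < tau], the hypothesis [|x - y| = tau / 200] makes
    the factor in front of [W] equal to 1, and both values of [ext] lie between bounds for [f] on
    one ball of radius [11 / 10 * tau]. *)
Lemma ext_increment x y tau W : 0 < tau -> 200 * `|x - y| <= tau ->
  osc x (11 / 10 * Num.max tau (dist x)) W ->
  (`|x - y| = tau / 200) ->
  `|ext y - ext x| <= 200 * (`|x - y| / Num.max tau (dist x)) * W.
Proof.
move=> tau0 hle ow hE.
have W0 : 0 <= W.
  have [u Su ur] : exists2 u, S u & cball x (11 / 10 * Num.max tau (dist x)) u.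
    apply: dist_lt; have : dist x <= Num.max tau (dist x) by rewrite le_max lexx orbT.
    have : tau <= Num.max tau (dist x) by rewrite le_max lexx.
    lra.
  by have := ow u u Su Su ur ur; exact: le_trans.
have [dt|td] := ltP (dist x) tau.
  rewrite max_l ?(ltW dt)// in ow *.
  rewrite (_ : 200 * _ = 1); last by rewrite hE; field; rewrite gt_eqF.
  rewrite mul1r.
  have dx0 := dist_ge0 x.
  have dt' : dist x < 11 / 10 * tau by lra.
  have [lo loP] : exists lo, forall u, S u -> cball x (11 / 10 * tau) u -> lo <= f u <= lo + W.
    exists (minf x (11 / 10 * tau)) => u Su ur; rewrite minf_le//=.
    rewrite -lerBlDr; apply: minf_ge => // v Sv vr; rewrite lerBlDr -lerBlDl.
    by rewrite (le_trans (ler_norm _))// ow.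
  have /andP[x1 x2] : lo <= ext x <= lo + W.
    by apply: ext_between => u Su ur; apply: loP => //; apply: le_trans ur _; lra.
  have /andP[y1 y2] : lo <= ext y <= lo + W.
    apply: ext_between => u Su ur; apply: loP => //.
    have dl := dist_lip x y.
    move: ur; rewrite /cball/= => ur; apply: le_trans (ler_distD y u x) _.
    rewrite [`|y - x|]distrC; lra.
  move: (ext x) (ext y) x1 x2 y1 y2 => a b x1 x2 y1 y2; clear -x1 x2 y1 y2.
  rewrite ler_norml; apply/andP; split; lra.
rewrite max_r// in ow *.
have nSx : ~ S x by move=> /dist_eq0 d0; move: td; rewrite d0 leNgt tau0.
apply: (le_trans (ext_near nSx (le_trans hle td) ow)).
apply: (ler_wpM2r W0); apply: ler_wpM2r; last by rewrite ler_nat.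
by rewrite divr_ge0// dist_ge0.
Qed.

Hypothesis om0 : forall e, 0 < e -> exists2 dl : R, 0 < dl & forall r, 0 < r -> r < dl -> om r <= e.

Lemma continuous_ext : continuous ext.
Proof.
move=> x; apply/(@cvgrPdist_le _ _ _ (nbhs x)) => e e0; have [Sx|nSx] := pselect (S x).
  have [dl dl0 dlP] := om0 e0.
  apply/nbhs_ballP; exists (dl / 3) => /=; first by rewrite divr_gt0.
  move=> y; rewrite -ball_normE/= => xy.
  have [->|yx] := eqVneq y x; first by rewrite subrr normr0 ltW.
  have h0 : 0 < `|x - y| by rewrite normr_gt0 subr_eq0 eq_sym.
  rewrite (extS Sx).
  have r0 : 0 < 21 / 10 * `|x - y| by rewrite mulr_gt0// divr_gt0.
  have H : om (21 / 10 * `|x - y|) <= e by apply: dlP => //; lra.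
  have /andP[] : f x - e <= ext y <= f x + e.
    apply: ext_between => u Su ur.
    have dy : dist y <= `|x - y| by rewrite distrC dist_le.
    have ux : cball x (21 / 10 * `|x - y|) u.
      move: ur; rewrite /cball/= => ur; apply: le_trans (ler_distD y u x) _.
      rewrite [`|y - x|]distrC; lra.
    have xx : cball x (21 / 10 * `|x - y|) x by rewrite /cball/= subrr normr0 ltW.
    have := le_trans (f_osc r0 Su Sx ux xx) H.
    by rewrite ler_distl.
  by move=> h1 h2; rewrite distrC ler_distl h1 h2.
have d0 := dist_gt0 nSx.
have r0 : 0 < 11 / 10 * dist x by rewrite mulr_gt0// divr_gt0.
have o := f_osc (x := x) r0; set W := om _ in o.
have W0 : 0 <= W.
  have [u Su ur] : exists2 u, S u & cball x (11 / 10 * dist x) u by apply: dist_lt; lra.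
  by have := o u u Su Su ur ur; exact: le_trans.
apply/nbhs_ballP; exists (Num.min (dist x / 200) (e * dist x / (160 * (W + 1)))) => /=.
  by rewrite lt_min !divr_gt0// ?mulr_gt0// ltr_wpDl.
move=> y; rewrite -ball_normE/= lt_min => /andP[h1 h2].
rewrite distrC; apply: (le_trans (ext_near nSx _ o)); first by lra.
exact: scaled_ratio_small h2.
Qed.

End extension.

(** * The packing condition and the energy of the extension *)

Section packing.
Context {R : realType} {n : nat}.
Hypothesis n_gt0 : (0 < n)%N.
Local Notation mu := (@lebesgue_rV R n).

Lemma diam_cube (Q : cube R n) : diam (cube_set Q) = 2 * Defs.radius Q.
Proof.
have r0 : 0 <= Defs.radius Q by exact/ltW/Defs.radius_gt0.
have ub : ubound [set `|z.1 - z.2| | z in cube_set Q `*` cube_set Q] (2 * Defs.radius Q).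
  move=> _ [[x y] [/= xQ yQ] <-]; apply: le_trans (ler_distD (Defs.center Q) x y) _.
  by rewrite mulr_natl mulr2n lerD// distrC.
pose v : 'rV[R]_n := Defs.radius Q *: delta_mx ord0 (Ordinal n_gt0).
have nv : `|v| = Defs.radius Q by rewrite normrZ norm_delta_mx mulr1 ger0_norm.
have e : `|(Defs.center Q + v) - (Defs.center Q - v)| = 2 * Defs.radius Q.
  rewrite opprB [_ + v]addrC addrACA subrr addr0 -mulr2n -scaler_nat normrZ nv.
  by rewrite ger0_norm.
have mem : [set `|z.1 - z.2| | z in cube_set Q `*` cube_set Q] (2 * Defs.radius Q).
  exists (Defs.center Q + v, Defs.center Q - v) => //; split; rewrite /cube_set/= addrC addKr.
    by rewrite nv.
  by rewrite normrN nv.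
apply/eqP; rewrite eq_le; apply/andP; split.
  by apply: ge_sup => //; exists (2 * Defs.radius Q).
by apply: ub_le_sup => //; exists (2 * Defs.radius Q).
Qed.

Lemma packing_bound_finset (p lam : R) (S : set 'rV[R]_n) (f : 'rV[R]_n -> R)
    (I : finType) (J : {set I}) (c : I -> 'rV[R]_n) (r : I -> R) (u v : I -> 'rV[R]_n) :
  packing_bound p S f lam -> (forall i, 0 < r i) ->
  (forall i j, i \in J -> j \in J -> i != j -> cball (c i) (r i) `&` cball (c j) (r j) = set0) ->
  (forall i, i \in J -> S (u i) /\ cball (c i) (11 * r i) (u i)) ->
  (forall i, i \in J -> S (v i) /\ cball (c i) (11 * r i) (v i)) ->
  \sum_(i in J) (`|f (u i) - f (v i)| `^ p / (2 * r i) `^ (p - n%:R)) <= lam.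
Proof.
move=> pb r0 dJ uS vS.
pose Q (k : 'I_#|J|) := Cube (c (enum_val k)) (r0 (enum_val k)).
rewrite big_enum_val (eq_bigr (fun k => `|f (u (enum_val k)) - f (v (enum_val k))| `^ p /
    diam (cube_set (Q k)) `^ (p - n%:R))); last by move=> k _; rewrite diam_cube.
apply: (pb #|J| Q (u \o enum_val) (v \o enum_val)).
- apply/trivIsetP => k l _ _ kl; apply: dJ; [exact: enum_valP|exact: enum_valP|].
  by rewrite (inj_eq enum_val_inj).
- by move=> k; have [] := uS _ (enum_valP k).
- by move=> k; have [] := vS _ (enum_valP k).
Qed.

End packing.

Section energy.
Context {R : realType} {n : nat}.
Hypothesis n_gt0 : (0 < n)%N.
Local Notation mu := (@lebesgue_rV R n).
Variables (p lam : R) (S : set 'rV[R]_n) (f : 'rV[R]_n -> R).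
Hypotheses (n_lt_p : n%:R < p) (lam0 : 0 < lam).
Hypotheses (clS : closed S) (S0 : S !=set0) (pb : packing_bound p S f lam).

Let p1 : 1 < p.
Proof. by rewrite (le_lt_trans _ n_lt_p)// ler1n. Qed.

Let p0 : 0 < p. Proof. exact: lt_trans p1. Qed.

(** The Hölder modulus of exponent [1 - n / p], obtained from the packing condition for a single
    cube. *)
Definition modulus (r : R) := (lam * (2 * r) `^ (p - n%:R)) `^ p^-1.

Lemma packing_osc x r : 0 < r -> osc S f x r (modulus r).
Proof.
move=> r0 u v Su Sv ur vr.
have r11 : r <= 11 * r by rewrite ler_peMl ?(ltW r0)// ler1n.
have := @packing_bound_finset R n n_gt0 p lam S f 'I_1 [set: 'I_1]%SET (fun=> x) (fun=> r)
  (fun=> u) (fun=> v) pb (fun=> r0).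
move=> H; have {}H : `|f u - f v| `^ p / (2 * r) `^ (p - n%:R) <= lam.
  have := H _ _ _; rewrite big_const cardsT card_ord /= addr0; apply.
  - by move=> i j _ _; rewrite (ord1 i) (ord1 j) eqxx.
  - by move=> i _; split=> //; exact: le_trans ur r11.
  - by move=> i _; split=> //; exact: le_trans vr r11.
move: H; rewrite ler_pdivrMr ?powR_gt0 ?mulr_gt0// => H.
have -> : `|f u - f v| = (`|f u - f v| `^ p) `^ p^-1.
  by rewrite -powRrM mulfV ?(lt0r_neq0 p0)// powRr1.
apply: ge0_ler_powR => //; rewrite ?nnegrE ?invr_ge0 ?(ltW p0) ?powR_ge0//.
by apply: mulr_ge0; [exact: ltW|exact: powR_ge0].
Qed.

Lemma modulus_small e : 0 < e -> exists2 dl : R, 0 < dl &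
  forall r, 0 < r -> r < dl -> modulus r <= e.
Proof.
move=> e0; have pn0 : 0 < p - n%:R by rewrite subr_gt0.
exists ((e `^ p / lam) `^ (p - n%:R)^-1 / 2).
  by rewrite divr_gt0// powR_gt0// divr_gt0// powR_gt0.
move=> r r0; rewrite ltr_pdivlMr// mulrC => rd.
have -> : e = (e `^ p) `^ p^-1.
  by rewrite -powRrM mulfV ?(lt0r_neq0 p0)// powRr1// ltW.
have m0 : 0 <= lam * (2 * r) `^ (p - n%:R) by rewrite mulr_ge0 ?powR_ge0// ltW.
apply: ge0_ler_powR; rewrite ?nnegrE ?invr_ge0 ?(ltW p0) ?powR_ge0//.
rewrite mulrC -ler_pdivlMr//.
have -> : e `^ p / lam = ((e `^ p / lam) `^ (p - n%:R)^-1) `^ (p - n%:R).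
  rewrite -powRrM mulVf ?gt_eqF// powRr1//.
  by rewrite divr_ge0 ?powR_ge0// ltW.
apply: ge0_ler_powR; rewrite ?nnegrE ?(ltW pn0) ?powR_ge0 ?(ltW rd)//.
by rewrite mulr_ge0// ltW.
Qed.

(** The supremum of the differences need not be attained, so a pair reaching half of it is chosen;
    this is the factor 2. If the supremum is zero, any pair serves. *)
Lemma osc_witness x r : 0 < r -> dist S x < r -> exists u v,
  [/\ S u /\ cball x r u, S v /\ cball x r v & osc S f x r (2 * `|f u - f v|)].
Proof.
move=> r0 dr; have [u0 Su0 ur0] := dist_lt S0 dr.
pose A := [set `|f uv.1 - f uv.2| | uv in (S `&` cball x r) `*` (S `&` cball x r)].
have Asup : has_sup A.
  split; first by exists `|f u0 - f u0|, (u0, u0).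
  by exists (modulus r) => _ [[u v] [[/= Su ur] [Sv vr]] <-]; exact: (@packing_osc x r r0 u v Su Sv ur vr).
have sub u v : S u -> S v -> cball x r u -> cball x r v -> `|f u - f v| <= sup A.
  by move=> Su Sv ur vr; apply: ub_le_sup; [exact: Asup.2|exists (u, v)].
have [s0|s0] := ltP 0 (sup A).
  have s20 : 0 < sup A / 2 by rewrite divr_gt0.
  have [_ [[u v] [[/= Su ur] [Sv vr]] <-] h] := sup_adherent s20 Asup.
  exists u, v; split => // u' v' Su' Sv' ur' vr'; have := sub _ _ Su' Sv' ur' vr'; lra.
exists u0, u0; split => // u' v' Su' Sv' ur' vr'.
by rewrite subrr normr0 mulr0; exact: le_trans (sub _ _ Su' Sv' ur' vr') s0.
Qed.

(** [400] is the 200 of [ext_increment] times the 2 of [osc_witness]; [6 ^+ n] comes from the side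
    [2 * (3 * r)] of the covering balls, and the last power from writing [r] in terms of the
    diameter [2 * r]. *)
Definition energy_const : R := 400 `^ p * 6 ^+ n * 2 `^ (p - n%:R).

Local Notation e_ i := (delta_mx ord0 i : 'rV[R]_n).

Lemma continuous_extension : continuous (ext S f).
Proof. exact: (continuous_ext clS S0 packing_osc modulus_small). Qed.

Lemma measurable_increment i (t : R) :
  measurable_fun setT (fun x : 'rV[R]_n => ext S f (x + t *: e_ i) - ext S f x).
Proof.
apply: continuous_measurable_rV.
exact: continuousB_rV (continuous_comp_shift (v := t *: e_ i) continuous_extension) continuous_extension.
Qed.

Lemma energy_const_ge0 : 0 <= energy_const.
Proof. by rewrite !mulr_ge0 ?powR_ge0 ?exprn_ge0. Qed.

Lemma energy_termE t w r : 0 < t -> 0 <= w -> 0 < r ->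
  (400 * t * w / r) `^ p * (2 * (3 * r)) ^+ n =
  energy_const * t `^ p * (w `^ p / (2 * r) `^ (p - n%:R)).
Proof.
move=> t0 w0 r0; have tw : 0 <= 400 * t by apply: mulr_ge0; [exact: ler0n|exact: ltW].
have ri : 0 <= r^-1 by rewrite invr_ge0 ltW.
rewrite /energy_const (powRM _ (mulr_ge0 tw w0) ri) (powRM _ tw w0) (powRM _ (ler0n _ 400) (ltW t0)).
rewrite -(powR_inv1 (ltW r0)) -powRrM mulN1r powRN.
rewrite (powRM _ (ler0n _ 2) (ltW r0)) mulrA (_ : 2 * 3 = 6); last by rewrite -natrM.
rewrite exprMn -(powR_mulrn n (ltW r0)).
have rE : r `^ p = r `^ (p - n%:R) * r `^ n%:R.
  by rewrite -powRD ?subrK// (gt_eqF r0) implybT.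
rewrite rE; field.
by rewrite !gt_eqF ?powR_gt0.
Qed.

Lemma powint_cover_le (I : finType) (J : {set I}) (c : I -> 'rV[R]_n) (r B : I -> R)
    (K : set 'rV[R]_n) (g : 'rV[R]_n -> R) : measurable K -> measurable_fun setT g ->
  (forall j, 0 <= r j) -> (forall j, 0 <= B j) ->
  (forall x, K x -> exists2 j, j \in J & cball (c j) (r j) x) ->
  (forall x j, j \in J -> cball (c j) (r j) x -> `|g x| `^ p <= B j) ->
  (powint mu p (fun x => \1_K x * g x)%R <= (\sum_(j in J) B j * (2 * r j) ^+ n)%R%:E)%E.
Proof.
move=> mK mg r0 B0 cov gB.
have mI j : measurable_fun setT (\1_(cball (c j) (r j)) : 'rV[R]_n -> R).
  exact: measurable_indic_cball.
have BI0 j x : 0 <= B j * \1_(cball (c j) (r j)) x :> R by rewrite mulr_ge0.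
have mBI j : measurable_fun setT (fun x => B j * \1_(cball (c j) (r j)) x : R).
  exact: measurable_funM.
apply: (@le_trans _ _ (\int[mu]_x (\sum_(j in J) B j * \1_(cball (c j) (r j)) x)%:E)%E).
  apply: ge0_le_int.
  - by apply: measurable_norm_powR; apply: measurable_funM => //; exact: measurable_indic.
  - exact: measurable_sum_cond.
  - by move=> x; exact: powR_ge0.
  - move=> x; have [xK|xK] := pselect (K x); last first.
      by rewrite indicE memNset// mul0r normr0 powR0 ?gt_eqF// sumr_ge0.
    have [j jJ xj] := cov x xK; rewrite [\1_K _]indicE mem_set// mul1r.
    rewrite (bigD1 j)//= [\1_(cball (c j) (r j)) _]indicE (mem_set xj) mulr1 -[leLHS]addr0 lerD//.
      exact: gB.
    by rewrite sumr_ge0.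
rewrite ge0_int_sum// -sumEFin lee_sum// => j _.
by rewrite ge0_intZ// int_indic_cball.
Qed.

(** On a compact ball a finite covering exists, so [vitali_finite] and the packing condition apply.
    The bound is independent of [N], which lets [global_energy] pass to the whole space by Fatou. *)
Lemma local_energy i t N : 0 < t ->
  (powint mu p (fun x => \1_(cball 0 N) x * (ext S f (x + t *: e_ i) - ext S f x))%R <=
   (energy_const * lam * t `^ p)%:E)%E.
Proof.
move=> t0; pose tau := 200 * t; have tau0 : 0 < tau by rewrite mulr_gt0.
pose D x := Num.max tau (dist S x).
have D0 x : 0 < D x by rewrite lt_max tau0.
have Dlip x y : D y <= D x + `|x - y|.
  rewrite ge_max; apply/andP; split.
    by rewrite ler_wpDr// le_max lexx.
  by apply: le_trans (dist_lip S0 x y) _; rewrite lerD2r le_max lexx orbT.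
have : cover_compact (cball (0 : 'rV[R]_n) N) by rewrite -compact_cover; exact: compact_cball.
move=> /(_ _ setT (fun x => ball x (D x / 4))) [].
- by move=> x _; exact: ball_open.
- by move=> x _; exists x => //; apply: ballxx; rewrite divr_gt0.
move=> D' _ cov.
pose s : seq 'rV[R]_n := finmap.enum_fset D'.
pose I : finType := 'I_(size s); pose c (j : I) : 'rV[R]_n := nth 0 s j; pose r (j : I) := D (c j) / 4.
have r0 j : 0 < r j by rewrite divr_gt0.
have [J _ [dJ cJ]] := @vitali_finite R n I c r [set: I]%SET (fun j => ltW (r0 j)).
have covJ x : cball 0 N x -> exists2 j, j \in J & cball (c j) (3 * r j) x.
  move=> /cov[y /= yD xy]; have ys : (index y s < size s)%N by rewrite index_mem.
  have [|j jJ /(_ x) h] := cJ (Ordinal ys); first by rewrite finset.in_setT.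
  exists j => //; apply: h; move: xy; rewrite /r /c /= nth_index// -ball_normE/= distrC.
  exact: ltW.
have /choice[uv uvP] : forall j : I, exists uv : 'rV[R]_n * 'rV[R]_n,
    [/\ S uv.1 /\ cball (c j) (11 * r j) uv.1, S uv.2 /\ cball (c j) (11 * r j) uv.2 &
      osc S f (c j) (11 * r j) (2 * `|f uv.1 - f uv.2|)].
  move=> j; have [||u [v h]] := @osc_witness (c j) (11 * r j); [by rewrite mulr_gt0| |by exists (u, v)].
  have : dist S (c j) <= D (c j) by rewrite le_max lexx orbT.
  have := D0 (c j); rewrite /r; lra.
pose w j := `|f (uv j).1 - f (uv j).2|.
have inc x j : j \in J -> cball (c j) (3 * r j) x ->
    `|ext S f (x + t *: e_ i) - ext S f x| <= 400 * t * w j / r j.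
  move=> jJ xj.
  have xt : `|x - (x + t *: e_ i)| = t.
    by rewrite opprD addNKr normrN normrZ norm_delta_mx mulr1 gtr0_norm.
  have rj := r0 j.
  have Dj : D (c j) = 4 * r j by rewrite /r; field.
  have Dx1 : D x <= 7 * r j.
    have := Dlip (c j) x; rewrite distrC; move: xj; rewrite /cball/= Dj; lra.
  have Dx2 : r j <= D x.
    have := Dlip x (c j); move: xj; rewrite /cball/= Dj; lra.
  have ox : osc S f x (11 / 10 * Num.max tau (dist S x)) (2 * w j).
    have sub u : cball x (11 / 10 * D x) u -> cball (c j) (11 * r j) u.
      rewrite /cball/= => ur; apply: le_trans (ler_distD x u (c j)) _.
      move: xj; rewrite /cball/=; lra.
    have [_ _ o] := uvP j.
    by move=> u v Su Sv /sub ur /sub vr; exact: o.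
  have := @ext_increment R n S f clS S0 modulus packing_osc x (x + t *: e_ i) tau (2 * w j) tau0.
  rewrite xt => /(_ (lexx _) ox); rewrite -/(D x) => h.
  apply: le_trans (h _) _; first by rewrite /tau mulrC mulKf// pnatr_eq0.
  rewrite (_ : 200 * (t / D x) * (2 * w j) = 400 * t * w j / D x); last by field; rewrite gt_eqF.
  have tw0 : 0 <= 400 * t * w j.
    by apply: mulr_ge0; [apply: mulr_ge0; [exact: ler0n|exact: ltW]|exact: normr_ge0].
  (* The quotient by [D x] is replaced by one by [r j], which no longer depends on the point [x] of
     the ball. *)
  by apply: (ler_wpM2l tw0); rewrite lef_pV2 ?posrE ?(D0 x) ?(r0 j) ?Dx2.
pose B j := (400 * t * w j / r j) `^ p.
have w0 j : 0 <= w j by exact: normr_ge0.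
have BP x j : j \in J -> cball (c j) (3 * r j) x ->
    `|ext S f (x + t *: e_ i) - ext S f x| `^ p <= B j.
  move=> jJ xj; apply: (ge0_ler_powR (ltW p0)); rewrite ?nnegrE; [exact: normr_ge0| |exact: inc].
  by apply: divr_ge0; [apply: mulr_ge0; [apply: mulr_ge0; [exact: ler0n|exact: ltW]|exact: w0]|exact: ltW].
have mE := measurable_increment i t.
have r3 j : 0 <= 3 * r j by apply: mulr_ge0; [exact: ler0n|exact: ltW].
have B0 j : 0 <= B j by exact: powR_ge0.
apply: le_trans (powint_cover_le (measurable_cball 0 N) mE r3 B0 covJ BP) _.
rewrite lee_fin.
have := @packing_bound_finset R n n_gt0 p lam S f I J c r (fun j => (uv j).1) (fun j => (uv j).2) pb r0 dJ.
have m1 j : j \in J -> S (uv j).1 /\ cball (c j) (11 * r j) (uv j).1 by have [] := uvP j.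
have m2 j : j \in J -> S (uv j).2 /\ cball (c j) (11 * r j) (uv j).2 by have [] := uvP j.
move=> /(_ m1 m2) pk.
have K0 : 0 <= energy_const * t `^ p.
  by apply: mulr_ge0; [exact: energy_const_ge0|exact: powR_ge0].
rewrite mulrAC; apply: le_trans (ler_wpM2l K0 pk); rewrite mulr_sumr.
by apply: ler_sum => j _; rewrite /B (energy_termE t0 (w0 j) (r0 j)).
Qed.

Lemma global_energy i t : 0 < t ->
  (\int[mu]_x (`|ext S f (x + t *: e_ i) - ext S f x| `^ p)%:E <=
   (energy_const * lam * t `^ p)%:E)%E.
Proof.
move=> t0.
have mE := measurable_increment i t.
apply: (@fatou_powint _ _ _ mu p p1
  (fun N x => \1_(cball 0 N%:R) x * (ext S f (x + t *: e_ i) - ext S f x))) => //.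
- by move=> N; apply: measurable_funM => //; exact: measurable_indic_cball.
- apply: aeW => x; apply: cvg_near_cst; exists (Num.truncn `|x|).+1 => // N /= xN.
  rewrite indicE mem_set ?mul1r// /cball/= subr0.
  by apply: le_trans (ltW (truncnS_gt _)) _; rewrite ler_nat.
- by exists 0%N => N _; exact: local_energy.
Qed.

End energy.

(** * Morrey's inequality *)

Section smooth_functions.
Context {R : realType}.
Implicit Types (f g b : R -> R) (x y a c h : R).

(** The class C^k on the line, with each derivative supplied as a witness. *)
Fixpoint Dk (k : nat) f : Prop :=
  match k with
  | 0 => continuous f
  | k'.+1 => exists2 f', (forall x, is_derive x 1 f (f' x)) & Dk k' f'
  end.

Lemma is_derive_continuous f f' : (forall x, is_derive x 1 f (f' x)) -> continuous f.
Proof.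
by move=> d x; apply/differentiable_continuous/derivable1_diffP; have [] := d x.
Qed.

Lemma Dk_mono k f : Dk k.+1 f -> Dk k f.
Proof.
elim: k f => [|k IH] f; first by move=> [f' d _]; exact: is_derive_continuous d.
by move=> [f' d kf']; exists f' => //; exact: IH.
Qed.

Lemma DkD k f g : Dk k f -> Dk k g -> Dk k (fun x => f x + g x).
Proof.
elim: k f g => [|k IH] f g; first by move=> cf cg x; exact: (@cvgD _ _ _ (nbhs x) _ f g _ _ (cf x) (cg x)).
move=> [f' df kf'] [g' dg kg']; exists (fun x => f' x + g' x); last exact: IH.
by move=> x; exact: (is_deriveD (df x) (dg x)).
Qed.

Lemma DkM k f g : Dk k f -> Dk k g -> Dk k (fun x => f x * g x).
Proof.
elim: k f g => [|k IH] f g; first by move=> cf cg x; exact: (@cvgM _ _ (nbhs x) _ f g _ _ (cf x) (cg x)).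
move=> kf kg; have [f' df kf'] := kf; have [g' dg kg'] := kg.
exists (fun x => f x * g' x + g x * f' x).
  by move=> x; exact: (is_deriveM (df x) (dg x)).
by apply: DkD; apply: IH => //; exact: Dk_mono.
Qed.

Lemma Dk_cst k c : Dk k (fun=> c).
Proof.
elim: k c => [|k IH] c; first exact: cst_continuous.
by exists (fun=> 0) => // x; exact: is_derive_cst.
Qed.

Lemma is_derive_affine a c x : is_derive x 1 (fun t => a * t + c) a.
Proof.
have d := is_deriveD (is_deriveZ a (is_derive_id x 1)) (is_derive_cst c x 1).
by apply: (is_derive_eq d); rewrite /GRing.scale/= mulr1 addr0.
Qed.

Lemma is_derive_comp_affine f (df : R) a c x : is_derive (a * x + c) 1 f df ->
  is_derive x 1 (fun t => f (a * t + c)) (a * df).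
Proof.
move=> d; have := @is_derive1_comp R f (fun t => a * t + c) x _ _ d (is_derive_affine a c x).
by rewrite mulrC.
Qed.

Lemma Dk_comp_affine k f a c : Dk k f -> Dk k (fun t => f (a * t + c)).
Proof.
elim: k f => [|k IH] f.
  move=> cf x; apply: (@continuous_comp _ _ _ (fun t => a * t + c) f); last exact: cf.
  exact: (is_derive_continuous (fun x => is_derive_affine a c x)).
move=> [f' d kf']; exists (fun t => a * f' (a * t + c)).
  by move=> x; apply: is_derive_comp_affine; exact: d.
by apply: (DkM (Dk_cst k a)); exact: IH.
Qed.

(** The functions [P(1/x) exp(-1/x)], extended by 0, form a family closed under differentiation;
    carrying the polynomial [P] makes smoothness of [exp(-1/x)] a plain induction. *)
Definition flat (P : {poly R}) x : R := if 0 < x then P.[x^-1] * expR (- x^-1) else 0.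

Lemma horner_bound (P : {poly R}) : exists2 C : R, 0 <= C &
  forall y, 1 <= y -> `|P.[y]| <= C * y ^+ (size P).
Proof.
exists (\sum_(i < size P) `|P`_i|); first by rewrite sumr_ge0.
move=> y y1; rewrite horner_coef mulr_suml (le_trans (ler_norm_sum _ _ _))//.
apply: ler_sum => i _; rewrite normrM ler_wpM2l// normrX ger0_norm ?(le_trans ler01)//.
by rewrite ler_weXn2l// ltnW.
Qed.

(** With [y = 1 / h], the exponential beats [y^(m + 1) / (m + 1)!], one power more than the bound
    [y^m] on [P(y)]; the spare power is the factor [h]. *)
Lemma flat_bound (P : {poly R}) : exists2 C : R, 0 <= C &
  forall h, `|h| <= 1 -> `|flat P h| <= C * `|h|.
Proof.
have [C C0 CP] := horner_bound P.
exists (C * (size P).+1`!%:R); first by rewrite mulr_ge0.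
move=> h; rewrite /flat; have [h0|h0] := ltP 0 h; last by rewrite normr0 !mulr_ge0.
rewrite gtr0_norm// => h1; set m := size P; set y := h^-1.
have y1 : 1 <= y by rewrite invf_ge1.
have y0 : 0 < y by rewrite invr_gt0.
have E : y ^+ m.+1 / m.+1`!%:R <= expR y.
  by apply: le_trans (expR_ge1Dxn m (ltW y0)); rewrite lerDr.
rewrite normrM (ger0_norm (expR_ge0 _)) expRN ler_pdivrMr ?expR_gt0//.
apply: le_trans (CP _ y1) _; rewrite -!mulrA ler_wpM2l//.
rewrite -[h]invrK -/y mulrA -ler_pdivrMl ?mulr_gt0 ?invr_gt0 ?ltr0n ?fact_gt0//.
apply: le_trans E; rewrite exprS; move: (m.+1`!%:R : R) => F.
by rewrite invf_div mulrAC -/m.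
Qed.

Lemma is_derive_flat (P : {poly R}) x :
  is_derive x 1 (flat P) (flat (('X ^+ 2) * (P - P^`())) x).
Proof.
have [x0|x0|->] := ltgtP x 0.
- have -> : flat ('X ^+ 2 * (P - P^`())) x = 0 by rewrite /flat (lt_gtF x0).
  apply: (@near_eq_is_derive _ _ _ (cst 0) (flat P) x 1 0 _ (is_derive_cst _ _ _)).
  near=> t; have t0 : t < 0 by near: t; exact: lt_nbhsl.
  by rewrite /flat (lt_gtF t0).
- have -> : flat ('X ^+ 2 * (P - P^`())) x = ('X ^+ 2 * (P - P^`())).[x^-1] * expR (- x^-1).
    by rewrite /flat x0.
  apply: (@near_eq_is_derive _ _ _ (fun x => P.[x^-1] * expR (- x^-1))).
    near=> t; have t0 : 0 < t by near: t; exact: lt_nbhsr.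
    by rewrite /flat t0.
  have xn0 : x != 0 by rewrite gt_eqF.
  have d1 : is_derive x 1 (fun t : R => t^-1) (- x ^- 2).
    apply: (is_derive_eq (@is_deriveV R id x 1 1 xn0 (is_derive_id x 1))).
    by rewrite /GRing.scale/= mulr1.
  have d2 := @is_derive1_comp R (horner P) (fun t => t^-1) x _ _ (is_derive_poly P x^-1) d1.
  have d3 := @is_derive1_comp R expR (fun t => - t^-1) x _ _ (is_derive_expR (- x^-1)) (is_deriveN d1).
  apply: (is_derive_eq (is_deriveM d2 d3)); rewrite /GRing.scale/= hornerM hornerD hornerN hornerXn exprVn.
  ring.
- rewrite {2}/flat ltxx.
  have [C C0 CP] := flat_bound (P * 'X).
  (* At the origin the difference quotient of [flat P] is [flat (P * 'X)], which [flat_bound] sends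
     to 0. *)
  have lim : (fun h : R => h^-1 *: ((flat P \o shift 0) (h *: 1) - flat P 0)) @ 0^' --> (0 : R).
    apply/cvgrPdist_le => e e0; near=> h.
    have h0 : h != 0 by near: h; exact: nbhs_dnbhs_neq.
    have -> : h^-1 *: ((flat P \o shift 0) (h *: 1) - flat P 0) = flat (P * 'X) h.
      rewrite /= /GRing.scale/= mulr1 addr0 /flat ltxx subr0.
      by case: ifP => _; rewrite ?mulr0// hornerMX mulrAC mulrC.
    rewrite sub0r normrN (le_trans (CP _ _))//.
      by near: h; apply: dnbhs0_le.
    apply: (@le_trans _ _ (C * (e / (C + 1)))).
      by rewrite ler_wpM2l//; near: h; apply: dnbhs0_le; rewrite divr_gt0// ltr_wpDl.
    rewrite mulrCA ler_piMr ?(ltW e0)// ler_pdivrMr ?mul1r ?lerDl// ltr_wpDl//.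
  by apply: DeriveDef; [apply/cvg_ex; exists 0|apply/cvg_lim].
Unshelve. all: by end_near. Qed.

Lemma Dk_flat k (P : {poly R}) : Dk k (flat P).
Proof.
elim: k P => [|k IH] P; first exact: (is_derive_continuous (is_derive_flat P)).
by exists (flat (('X ^+ 2) * (P - P^`()))); [exact: is_derive_flat|exact: IH].
Qed.

(** The coefficients [1] and [-1] are written out to match the affine form in [Dk_comp_affine]. *)
Definition bump x : R := flat 1 (1 * x + 1) * flat 1 (-1 * x + 1).

Lemma Dk_bump k : Dk k bump.
Proof. by apply: DkM; apply: Dk_comp_affine; exact: Dk_flat. Qed.

Lemma flat1_ge0 x : 0 <= flat 1 x.
Proof. by rewrite /flat; case: ifP => // _; rewrite hornerE mul1r expR_ge0. Qed.

Lemma flat1_le1 x : flat 1 x <= 1.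
Proof.
rewrite /flat; case: ifP => // x0; rewrite hornerE mul1r -[leRHS]expR0 ler_expR.
by rewrite oppr_le0 invr_ge0 ltW.
Qed.

Lemma bump_ge0 x : 0 <= bump x. Proof. by rewrite mulr_ge0 ?flat1_ge0. Qed.

Lemma bump_le1 x : bump x <= 1.
Proof. by rewrite -[leRHS]mulr1 ler_pM ?flat1_ge0 ?flat1_le1. Qed.

Lemma bump_eq0 x : 1 <= `|x| -> bump x = 0.
Proof.
rewrite ler_normr => /orP[x1|x1]; rewrite /bump /flat.
  by rewrite [X in _ * (if X then _ else _)]ltNge (_ : -1 * x + 1 <= 0) ?mulr0//; lra.
by rewrite ltNge (_ : 1 * x + 1 <= 0) ?mul0r//; lra.
Qed.

Lemma bump_lb x : `|x| <= 2^-1 -> expR (- 4) <= bump x.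
Proof.
rewrite ler_norml => /andP[x1 x2].
have h (t : R) : 2^-1 <= t -> expR (- 2) <= flat 1 t.
  move=> t2; have t0 : 0 < t by rewrite (lt_le_trans _ t2)// invr_gt0.
  by rewrite /flat t0 hornerE mul1r ler_expR lerN2 -[leRHS]invrK lef_pV2 ?posrE ?invr_gt0.
rewrite (_ : - 4 = - 2 + - 2 :> R); last by ring.
by rewrite expRD ler_pM ?expR_ge0// h//; lra.
Qed.

End smooth_functions.

Section smooth_step.
Context {R : realType}.
Implicit Types (x y : R).

(** The lower limit [-2] is strictly to the left of the support [[-1, 1]], so every [x >= -1] is
    beyond it, as the fundamental theorem of calculus requires; further left the function is 0. *)
Definition step x : R := (\int[lebesgue_measure]_(t in `[(-2)%R, x]) bump t)%R.

Lemma step_eq0 x : x <= -1 -> step x = 0.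
Proof.
move=> x1; rewrite /step /Rintegral integral0_eq// => t; rewrite /= in_itv/= => /andP[_ tx].
by rewrite bump_eq0// ler_normr; apply/orP; right; lra.
Qed.

Lemma is_derive_step x : is_derive x 1 step (bump x).
Proof.
have [x2|x2] := ltP x (-1).
  rewrite bump_eq0 ?ler_normr; last by apply/orP; right; lra.
  apply: (@near_eq_is_derive _ _ _ (cst 0) step x 1 0 _ (is_derive_cst _ _ _)).
  near=> t; have t1 : t < -1 by near: t; exact: lt_nbhsl.
  by rewrite step_eq0// ltW.
have x2' : -2 < x by lra.
have xu : x < x + 1 by rewrite ltrDl.
have bi : lebesgue_measure.-integrable `[-2, x + 1] (EFin \o (@bump R)).
  apply: continuous_compact_integrable; first exact: segment_compact.
  by apply: continuous_subspaceT => z; exact: (Dk_bump 0).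
have [d <-] := continuous_FTC1_closed xu bi x2' (Dk_bump 0 x).
by rewrite derive1E; exact/derivableP.
Unshelve. all: by end_near. Qed.

Lemma Dk_step k : Dk k step.
Proof.
case: k => [|k]; first exact: (is_derive_continuous is_derive_step).
by exists bump; [exact: is_derive_step|exact: Dk_bump].
Qed.

Lemma step_cst x : 1 <= x -> step x = step 1.
Proof.
rewrite le_eqVlt => /predU1P[<-//|x1].
have [c] := @MVT R step bump 1 x x1 (fun s _ => is_derive_step s) (continuous_subspaceT (Dk_step 0)).
rewrite in_itv/= => /andP[c1 _]; rewrite bump_eq0 ?mul0r; first by move/eqP; rewrite subr_eq0 => /eqP.
by rewrite ler_normr ltW.
Qed.

Lemma step_bounded : exists2 C : R, 1 <= C & forall x, `|step x| <= C.
Proof.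
have cn : {within `[-1, 1], continuous (fun x => `|step x|)}.
  apply: continuous_subspaceT => x.
  apply: (@continuous_comp _ _ _ step (fun y => `|y|)); last exact: norm_continuous.
  exact: (Dk_step 0).
have m11 : -1 <= 1 :> R by rewrite (le_trans (lerN10 R))// ler01.
have [c _ cP] := EVT_max m11 cn.
exists (`|step c| + 1); first by rewrite lerDr.
move=> x; rewrite ler_wpDr//; have [x1|x1] := lerP x (-1).
  by rewrite step_eq0// normr0.
have [x2|x2] := lerP 1 x; first by rewrite step_cst//; apply: cP; rewrite in_itv/= lexx m11.
by apply: cP; rewrite in_itv/= !ltW.
Qed.

End smooth_step.

(** * Product kernels whose difference is a divergence *)

Section tensor.
Context {R : realType} {n : nat}.
Implicit Types (b : 'I_n -> R -> R) (c x : 'rV[R]_n).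
Local Notation e_ i := (delta_mx ord0 i : 'rV[R]_n).

Definition tensor b x : R := \prod_j b j (x ord0 j).

Definition set_factor b i (g : R -> R) j : R -> R := if j == i then g else b j.

Lemma is_derive_tensor b i x (db : R) : is_derive (x ord0 i) 1 (b i) db ->
  is_derive x (e_ i) (tensor b) (db * \prod_(j | j != i) b j (x ord0 j)).
Proof.
move=> d; set c := \prod_(j | _) _.
have {}d := is_deriveZ c d.
have E : (fun h : R => h^-1 *: ((tensor b \o shift x) (h *: e_ i) - tensor b x)) =
  (fun h : R => h^-1 *: (((c *: b i) \o shift (x ord0 i)) (h *: 1) - (c *: b i) (x ord0 i))).
  apply/funext => h; congr (_ *: (_ - _)); rewrite /= /tensor (bigD1 i)//= mulrC /c; congr (_ * _).
  - by apply: eq_bigr => j ji; rewrite !mxE eqxx/= (negPf ji) mulr0 add0r.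
  - by rewrite !mxE !eqxx.
apply: DeriveDef; first by rewrite /derivable E; have [] := d.
by rewrite /derive E -/(derive _ _ _); have [_ ->] := d; rewrite mulrC.
Qed.

Lemma is_derive_tensor_factor b i x (g : R -> R) : (forall t : R, is_derive t 1 (b i) (g t)) ->
  is_derive x (e_ i) (tensor b) (tensor (set_factor b i g) x).
Proof.
move=> d; apply: (is_derive_eq (is_derive_tensor (d (x ord0 i)))).
rewrite [RHS](bigD1 i)//= /set_factor eqxx; congr (_ * _).
by apply: eq_bigr => j /negPf ->.
Qed.

Lemma partial_tensor b i (g : R -> R) : (forall t : R, is_derive t 1 (b i) (g t)) ->
  partial i (tensor b) = tensor (set_factor b i g).
Proof.
by move=> d; apply/funext => x; rewrite /partial; have [_ ->] := is_derive_tensor_factor x d.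
Qed.

Lemma continuous_tensor b : (forall j, continuous (b j)) -> continuous (tensor b).
Proof.
move=> cb; have {}cb j : continuous (fun x : 'rV[R]_n => b j (x ord0 j)).
  move=> x; apply: (@continuous_comp _ _ _ (fun x : 'rV[R]_n => x ord0 j) (b j)); last exact: cb.
  exact: coord_continuous.
rewrite /tensor; elim: (index_enum _) => [|j s IH].
  by under eq_fun do rewrite big_nil; exact: cst_continuous.
by under eq_fun do rewrite big_cons; exact: continuousM_rV.
Qed.

(** A partial derivative replaces one smooth factor by another, so iterated partial derivatives
    remain tensor products of smooth factors. *)
Lemma smooth_tensor b : (forall j k, Dk k (b j)) -> smooth (tensor b).
Proof.
move=> Db s; suff [b' Db' ->] : exists2 b', (forall j k, Dk k (b' j)) & foldr partial (tensor b) s = tensor b'.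
  split; first by apply: continuous_tensor => j; exact: (Db' j 0).
  move=> i x; have [g d _] := Db' i 1.
  by have [] := is_derive_tensor_factor x d.
elim: s => [|i s [b' Db' /= ->]]; first by exists b.
exists (set_factor b' i (fun t => 'D_1 (b' i) t)); last first.
  by apply: partial_tensor => t; apply/derivableP; have [g d _] := Db' i 1; have [] := d t.
move=> j k; rewrite /set_factor; case: eqP => // _.
have [g d kg] := Db' i k.+1.
by rewrite (_ : (fun t => _) = g)//; apply/funext => t; have [_ ->] := d t.
Qed.

(* Telescoping, replacing the factors one at a time. *)
Lemma prod_sub_prod (u v : 'I_n -> R) :
  \prod_j u j - \prod_j v j =
  \sum_(i < n) \prod_(j < n) (if (j < i)%N then v j else if j == i then u j - v j else u j).
Proof.
pose T (m : nat) := \prod_(j < n) (if (j < m)%N then v j else u j).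
have -> : \prod_j u j = T 0 by [].
have -> : \prod_j v j = T n by apply: eq_bigr => j _; rewrite ltn_ord.
rewrite -opprB -(telescope_sumr T (leq0n n)) -sumrN big_mkord; apply: eq_bigr => i _.
pose Q := \prod_(j | j != i) (if (j < i)%N then v j else u j).
have -> : T i = u i * Q by rewrite /T (bigD1 i)//= ltnn.
have -> : T i.+1 = v i * Q.
  rewrite /T (bigD1 i)//= ltnSn; congr (_ * _); apply: eq_bigr => j ji.
  by rewrite ltnS leq_eqVlt (negPf (ji : val j != val i)).
rewrite opprB -mulrBl (bigD1 i)//= ltnn eqxx; congr (_ * _).
by apply: eq_bigr => j /negPf ->.
Qed.

End tensor.

Section kernel_factors.
Context {R : realType}.
Implicit Types (a r t : R).

Definition kfac a r t : R := r^-1 * bump (r^-1 * t + - (r^-1 * a)).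

(* A primitive of the difference of two factors; it has compact support because both
   steps rise from the same constant to the same constant. *)
Definition pfac a a' r t : R :=
  step (r^-1 * t + - (r^-1 * a)) - step ((r / 2)^-1 * t + - ((r / 2)^-1 * a')).

Lemma Dk_kfac a r k : Dk k (kfac a r).
Proof. by apply: (DkM (Dk_cst k r^-1)); apply: Dk_comp_affine; exact: Dk_bump. Qed.

Lemma is_derive_pfac a a' r t :
  is_derive t 1 (pfac a a' r) (kfac a r t - kfac a' (r / 2) t).
Proof.
have d1 := is_derive_comp_affine (is_derive_step (r^-1 * t + - (r^-1 * a))).
have d2 := is_derive_comp_affine (is_derive_step ((r / 2)^-1 * t + - ((r / 2)^-1 * a'))).
exact: (is_deriveB d1 d2).
Qed.

Lemma Dk_pfac a a' r k : Dk k (pfac a a' r).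
Proof.
case: k => [|k]; first exact: (is_derive_continuous (is_derive_pfac a a' r)).
exists (fun t => kfac a r t - kfac a' (r / 2) t); first exact: is_derive_pfac.
rewrite (_ : (fun t => _) = (fun t => kfac a r t + -1 * kfac a' (r / 2) t)); last first.
  by apply/funext => t; rewrite mulN1r.
by apply: DkD; [exact: Dk_kfac|apply: (DkM (Dk_cst k (-1))); exact: Dk_kfac].
Qed.

Lemma kfac_ge0 a r t : 0 < r -> 0 <= kfac a r t.
Proof. by move=> r0; rewrite mulr_ge0 ?bump_ge0 ?invr_ge0 ?(ltW r0). Qed.

Lemma kfac_le a r t : 0 < r -> kfac a r t <= r^-1.
Proof. by move=> r0; rewrite /kfac ler_piMr ?bump_le1 ?invr_ge0 ?(ltW r0). Qed.

Lemma kfac_eq0 a r t : 0 < r -> r <= `|t - a| -> kfac a r t = 0.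
Proof.
move=> r0 rt; rewrite /kfac bump_eq0 ?mulr0// -mulrBr normrM.
by rewrite gtr0_norm ?invr_gt0// ler_pdivlMl// mulr1.
Qed.

Lemma kfac_lb a r t : 0 < r -> `|t - a| <= r / 2 -> r^-1 * expR (- 4) <= kfac a r t.
Proof.
move=> r0 rt; rewrite ler_wpM2l ?invr_ge0 ?(ltW r0)// bump_lb// -mulrBr normrM.
by rewrite gtr0_norm ?invr_gt0// ler_pdivrMl.
Qed.

Lemma pfac_eq0 a a' r t : 0 < r -> `|a - a'| <= r / 2 -> r <= `|t - a| -> pfac a a' r t = 0.
Proof.
move=> r0; rewrite ler_norml => /andP[a1 a2]; rewrite ler_normr /pfac -!mulrBr => rt.
have r20 : 0 < r / 2 by rewrite divr_gt0.
case/orP: rt => rt.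
  rewrite !step_cst ?subrr// ler_pdivlMl// mulr1//; lra.
rewrite !step_eq0 ?subrr// ler_pdivrMl// mulrN1; lra.
Qed.

Lemma kfac_half_eq0 a a' r t : 0 < r -> `|a - a'| <= r / 2 -> r <= `|t - a| ->
  kfac a' (r / 2) t = 0.
Proof.
move=> r0 aa' rt; apply: kfac_eq0; first by rewrite divr_gt0.
have := ler_distD a' t a; rewrite (distrC a' a); move: `|t - a| `|t - a'| `|a - a'| rt aa' => x y z; lra.
Qed.

End kernel_factors.

Section kernel.
Context {R : realType} {n : nat}.
Local Notation mu := (@lebesgue_rV R n).
Implicit Types (c x z : 'rV[R]_n) (r : R) (F : 'rV[R]_n -> R).
Local Notation e_ i := (delta_mx ord0 i : 'rV[R]_n).
Local Notation I f := (Rintegral mu setT f).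

(** The mass is not normalized to 1: the argument uses that it stays constant along the dyadic chain
    ([kernel_mass]) and is bounded below in terms of [n] alone ([kernel_integral_ge]). *)
Definition kernel c r : 'rV[R]_n -> R := tensor (fun j => kfac (c ord0 j) r).

(** The i-th term of [prod_sub_prod] for the two kernels, with the difference in coordinate [i]
    replaced by its primitive. Differentiating in direction [i] restores that term. *)
Definition theta_factor c c' r (i j : 'I_n) : R -> R :=
  if (j < i)%N then kfac (c' ord0 j) (r / 2)
  else if j == i then pfac (c ord0 j) (c' ord0 j) r else kfac (c ord0 j) r.

Definition theta c c' r i : 'rV[R]_n -> R := tensor (theta_factor c c' r i).

Lemma Dk_theta_factor c c' r (i j : 'I_n) k : Dk k (theta_factor c c' r i j).
Proof.
by rewrite /theta_factor; case: ifP => _; [exact: Dk_kfac|case: ifP => _; [exact: Dk_pfac|exact: Dk_kfac]].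
Qed.

Lemma continuous_kernel c r : continuous (kernel c r).
Proof. by apply: continuous_tensor => j; exact: (Dk_kfac _ _ 0). Qed.

Lemma csupp_tensor (b : 'I_n -> R -> R) c r : 0 <= r ->
  (forall j t, r <= `|t - c ord0 j| -> b j t = 0) -> csupp (tensor b) c r.
Proof.
move=> r0 b0 z nz; have /existsP[j jP] : [exists j, r < `|z ord0 j - c ord0 j|].
  apply: contrapT => /negP; rewrite negb_exists => /forallP h; apply: nz.
  by apply/rV_norm_leP => // i; rewrite !mxE leNgt.
by rewrite /tensor (bigD1 j)//= b0 ?mul0r// ltW.
Qed.

Lemma csupp_kernel c r : 0 < r -> csupp (kernel c r) c r.
Proof. by move=> r0; apply: csupp_tensor => [|j t]; [exact: ltW|exact: kfac_eq0]. Qed.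

Lemma coord_dist_le c c' (s : R) j : `|c - c'| <= s -> `|c ord0 j - c' ord0 j| <= s.
Proof. by apply: le_trans; have := coord_le_norm (c - c') j; rewrite !mxE. Qed.

Lemma csupp_theta c c' r i : 0 < r -> `|c - c'| <= r / 2 -> csupp (theta c c' r i) c r.
Proof.
move=> r0 cc'; apply: csupp_tensor => [|j t rt]; first exact: ltW.
have cc'j := coord_dist_le j cc'.
rewrite /theta_factor; case: ifP => _; first exact: kfac_half_eq0 rt.
by case: ifP => _; [exact: pfac_eq0|exact: kfac_eq0].
Qed.

Lemma test_function_theta c c' r i : 0 < r -> `|c - c'| <= r / 2 ->
  test_function (theta c c' r i).
Proof.
move=> r0 cc'; split; first by apply: smooth_tensor => j k; exact: Dk_theta_factor.
by exists (cball c r); [exact: compact_cball|exact: csupp_theta].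
Qed.

Lemma partial_theta c c' r i z :
  partial i (theta c c' r i) z = \prod_(j < n)
    (if (j < i)%N then kfac (c' ord0 j) (r / 2) (z ord0 j) else if j == i then
     kfac (c ord0 j) r (z ord0 j) - kfac (c' ord0 j) (r / 2) (z ord0 j)
     else kfac (c ord0 j) r (z ord0 j)).
Proof.
have d (t : R) : is_derive t 1 (theta_factor c c' r i i)
    (kfac (c ord0 i) r t - kfac (c' ord0 i) (r / 2) t).
  by rewrite /theta_factor ltnn eqxx; exact: is_derive_pfac.
rewrite /theta (partial_tensor d); apply: eq_bigr => j _; rewrite /set_factor /theta_factor.
by have [->|ji] := eqVneq j i; [rewrite ltnn|case: ifP].
Qed.

Lemma kernel_sub_kernel c c' r z :
  kernel c r z - kernel c' (r / 2) z = \sum_i partial i (theta c c' r i) z.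
Proof. by rewrite prod_sub_prod; apply: eq_bigr => i _; rewrite partial_theta. Qed.

(** The factor in coordinate [i] is a difference of two steps, at most [2 * C] at every scale, while
    the others are of size [2 / r]. This saves one power of [1 / r], the gain that becomes the
    factor [r] in Morrey's inequality. *)
Lemma theta_le (C : R) c c' r i z : 0 < r -> 1 <= C -> (forall t : R, `|step t| <= C) ->
  `|theta c c' r i z| <= C * r * (2 / r) ^+ n.
Proof.
move=> r0 C1 stepC; have r20 : 0 < r / 2 by rewrite divr_gt0.
have kle (a t : R) : `|kfac a r t| <= 2 / r.
  rewrite ger0_norm ?kfac_ge0// (le_trans (kfac_le _ _ r0))// -[leLHS]mul1r ler_pM2r ?invr_gt0//.
  by rewrite ler1n.
have kle2 (a t : R) : `|kfac a (r / 2) t| <= 2 / r.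
  by rewrite ger0_norm ?kfac_ge0// (le_trans (kfac_le _ _ r20))// invf_div.
have -> : C * r * (2 / r) ^+ n = 2 * C * \prod_(j | j != i) (2 / r).
  rewrite -{1}(card_ord n) -prodr_const (bigD1 i)//= mulrA; congr (_ * _).
  by field; rewrite gt_eqF.
rewrite /theta /tensor normr_prod (bigD1 i)//= ler_pM//.
- by rewrite prodr_ge0.
- rewrite /theta_factor ltnn eqxx (le_trans (ler_normB _ _))// mulr_natl mulr2n lerD//.
apply: ler_prod => j ji; rewrite normr_ge0/= /theta_factor (negPf ji).
by case: ifP.
Qed.

Lemma kernel_integral_ge c r : 0 < r -> expR (- 4) ^+ n <= I (kernel c r).
Proof.
move=> r0; have ik : mu.-integrable setT (EFin \o kernel c r).
  exact: integrable_continuous_csupp (@continuous_kernel c r) (@csupp_kernel c r r0).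
have k0 z : 0 <= kernel c r z by apply: prodr_ge0 => j _; exact: kfac_ge0.
rewrite -lee_fin -(integral_Rintegral ik).
have -> : (expR (- 4) ^+ n)%:E = (\int[mu]_z ((r^-1 * expR (- 4)) ^+ n * \1_(cball c (r / 2)) z)%:E)%E.
  have mi : measurable_fun setT (\1_(cball c (r / 2)) : 'rV[R]_n -> R) by exact: measurable_indic_cball.
  have e0 : 0 <= (r^-1 * expR (- 4)) ^+ n by rewrite exprn_ge0// mulr_ge0 ?invr_ge0 ?expR_ge0// ltW.
  rewrite ge0_intZ// int_indic_cball; last by rewrite divr_ge0// ltW.
  by rewrite -EFinM -exprMn; congr ((_ ^+ _)%:E); field; rewrite gt_eqF.
apply: ge0_le_int.
- by apply: measurable_funM => //; exact: measurable_indic_cball.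
- exact: continuous_measurable_rV (@continuous_kernel c r).
- by move=> z; rewrite mulr_ge0// exprn_ge0// mulr_ge0 ?invr_ge0 ?expR_ge0// ltW.
move=> z; rewrite indicE; have [zr|zr] := pselect (cball c (r / 2) z); last first.
  by rewrite memNset// mulr0.
rewrite mem_set// mulr1 -{1}(card_ord n) -prodr_const; apply: ler_prod => j _.
rewrite mulr_ge0 ?invr_ge0 ?expR_ge0 ?(ltW r0)//=; apply: kfac_lb => //.
exact: coord_dist_le.
Qed.

End kernel.

(** * The dyadic chain of kernels *)

Section morrey.
Context {R : realType} {n : nat}.
Local Notation mu := (@lebesgue_rV R n).
Implicit Types (c x z : 'rV[R]_n) (r q E : R) (F : 'rV[R]_n -> R) (G : 'I_n -> 'rV[R]_n -> R).
Local Notation e_ i := (delta_mx ord0 i : 'rV[R]_n).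
Local Notation I f := (Rintegral mu setT f).

Lemma Rint_sum (f : 'I_n -> 'rV[R]_n -> R) : (forall i, mu.-integrable setT (EFin \o f i)) ->
  I (fun x => \sum_i f i x) = \sum_i I (f i).
Proof.
move=> fi; rewrite /Rintegral; under eq_integral do rewrite -sumEFin.
rewrite integral_sum//; under eq_bigr do rewrite integral_Rintegral//.
by rewrite sumEFin.
Qed.

(** The kernel difference is a divergence of test functions, so the weak derivatives turn the left
    side into integrals of [G i] against [theta], bounded by [Lp_csupp_integral_le]. *)
Lemma kernel_step (C q E r : R) c c' F G : 1 <= C -> (forall t : R, `|step t| <= C) ->
  1 < q -> 0 < r -> 0 < E -> `|c - c'| <= r / 2 ->
  continuous F -> (forall i, measurable_fun setT (G i)) -> (forall i, weak_partial i F (G i)) ->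
  (forall i, (powint mu q (fun x => (\1_(cball c r) x * G i x)%R) <= E%:E)%E) ->
  `|I (fun x => F x * kernel c r x) - I (fun x => F x * kernel c' (r / 2) x)| <=
  n%:R * (C * 2 ^+ n * (2 ^+ n + 1)) * (r * (E / r ^+ n) `^ q^-1).
Proof.
move=> C1 stepC q1 r0 E0 cc' cF mG wG GE.
have r20 : 0 < r / 2 by rewrite divr_gt0.
pose th i := theta c c' r i.
have tth i : test_function (th i) by exact: test_function_theta.
have cth i : continuous (th i) by have [/(_ [::])[]] := tth i.
have cpth i : continuous (partial i (th i)) by have [/(_ [:: i])[]] := tth i.
have sth i : csupp (th i) c r by exact: csupp_theta.
have iF i : mu.-integrable setT (EFin \o (fun x => F x * partial i (th i) x)).
  exact: integrable_continuous_csupp (continuousM_rV cF (cpth i)) (csuppM _ (csupp_partial i (sth i))).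
have iK c0 s : 0 < s -> mu.-integrable setT (EFin \o (fun x => F x * kernel c0 s x)).
  move=> s0; exact: integrable_continuous_csupp
    (continuousM_rV cF (@continuous_kernel _ _ c0 s)) (csuppM _ (@csupp_kernel _ _ c0 s s0)).
have mi : measurable_fun setT (\1_(cball c r) : 'rV[R]_n -> R) by exact: measurable_indic_cball.
have mG1 i : measurable_fun setT (fun x => \1_(cball c r) x * G i x) by exact: measurable_funM.
have thB i x : `|th i x| <= C * r * (2 / r) ^+ n by exact: theta_le.
have mth i := continuous_measurable_rV (cth i).
rewrite -RintegralB; [|exact: measurableT|exact: iK|exact: iK].
under eq_Rintegral do rewrite -mulrBr kernel_sub_kernel mulr_sumr.
rewrite Rint_sum// (le_trans (ler_norm_sum _ _ _))//.
(* This value of the free parameter balances the two terms of the bound: [a^(1 - q) E = a r^n]. *)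
set a := (E / r ^+ n) `^ q^-1.
have rn0 : 0 < r ^+ n by rewrite exprn_gt0.
have Er0 : 0 < E / r ^+ n by rewrite divr_gt0.
have a0 : 0 < a by rewrite powR_gt0.
have aq : a `^ (1 - q) * E = a * r ^+ n.
  have q0 : q != 0 by rewrite gt_eqF// (lt_trans ltr01).
  rewrite powRB ?(gt_eqF a0) ?implybT// powRr1 ?(ltW a0)// {2}/a -powRrM mulVf// powRr1 ?(ltW Er0)//.
  by rewrite invf_div -mulrA divfK// gt_eqF.
have -> : n%:R * (C * 2 ^+ n * (2 ^+ n + 1)) * (r * a) =
    \sum_(i < n) (C * r * (2 / r) ^+ n) * (a * (2 * r) ^+ n + a `^ (1 - q) * E).
  rewrite sumr_const card_ord -mulr_natl aq !exprMn exprVn; field; rewrite gt_eqF//.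
apply: ler_sum => i _.
have iG : mu.-integrable setT (EFin \o (fun x => (\1_(cball c r) x * G i x) * th i x)).
  exact: Lp_csupp_integrable q1 (ltW r0) (mG1 i) (mth i) (thB i) (sth i) (GE i).
have -> : I (fun x => F x * partial i (theta c c' r i) x) =
    - I (fun x => (\1_(cball c r) x * G i x) * th i x).
  apply: EFin_inj; rewrite EFinN -(integral_Rintegral (iF i)) -(integral_Rintegral iG).
  rewrite (wG i _ (tth i)); congr (- _)%E; apply: eq_integral => x _; congr (_%:E).
  rewrite indicE; have [xr|xr] := pselect (cball c r x); first by rewrite mem_set// mul1r.
  by rewrite (sth i x xr) !mulr0.
rewrite normrN (le_trans (le_normr_Rintegral measurableT iG))//.
rewrite -lee_fin /Rintegral fineK; last first.
  by apply: integrable_fin_num => //; exact: integrable_norm.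
exact: Lp_csupp_integral_le q1 a0 (ltW r0) (mG1 i) (mth i) (thB i) (sth i) (GE i).
Qed.

(* Comparison of kernels applied to the constant function [1], whose gradient vanishes. *)
Lemma kernel_mass c c' r : 0 < r -> `|c - c'| <= r / 2 ->
  I (kernel c r) = I (kernel c' (r / 2)).
Proof.
move=> r0 cc'; have [C C1 stepC] := @step_bounded R.
have one_lt2 : 1 < 2 :> R by rewrite ltr1n.
have c1 : continuous (cst 1 : 'rV[R]_n -> R) by exact: cst_continuous.
have /choice[g gP] : forall i, exists g, [/\ measurable_fun setT g, (powint mu 2 g <= 0%:E)%E &
    weak_partial i (cst 1 : 'rV[R]_n -> R) g].
  move=> i; apply: weak_partial_exists => // t t0.
  rewrite mul0r integral0_eq// => x _.
  by rewrite subrr normr0 powR0// pnatr_eq0.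
have e (f : 'rV[R]_n -> R) : (fun x => cst 1 x * f x) = f by apply/funext => x; exact: mul1r.
apply/eqP; rewrite -subr_eq0 -normr_le0; apply/ler_addgt0Pl => eps eps0; rewrite addr0.
set D := n%:R * (C * 2 ^+ n * (2 ^+ n + 1)).
have D0 : 0 <= D.
  by rewrite mulr_ge0// !mulr_ge0 ?addr_ge0 ?exprn_ge0// (le_trans ler01).
(* The weak gradient has zero energy, so any positive [E] is admissible in [kernel_step]; [u] is
   chosen to bring its bound [D * (r * u)] below [eps]. *)
pose u := eps / ((D + 1) * r).
have u0 : 0 < u by rewrite divr_gt0// mulr_gt0// ltr_wpDl.
have rn0 : 0 < r ^+ n by rewrite exprn_gt0.
pose E := r ^+ n * u `^ 2.
have E0 : 0 < E by rewrite mulr_gt0// powR_gt0.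
have := @kernel_step C 2 E r c c' (cst 1) g C1 stepC one_lt2 r0 E0 cc' c1.
move=> /(_ (fun i => let: And3 m _ _ := gP i in m) (fun i => let: And3 _ _ w := gP i in w)).
rewrite !e.
have -> : r * (E / r ^+ n) `^ 2^-1 = r * u.
  rewrite /E [X in X / _]mulrC mulfK ?gt_eqF// -powRrM divff ?pnatr_eq0// powRr1// ltW//.
move=> h; apply: le_trans (h _) _; last first.
  rewrite -/D (_ : eps = (D + 1) * (r * u)); last first.
    by rewrite /u; field; rewrite gt_eqF//= gt_eqF// ltr_wpDl.
  by rewrite ler_wpM2r ?lerDl// mulr_ge0 ?ltW.
move=> i; have [mg g0 _] := gP i.
have mi : measurable_fun setT (\1_(cball c r) : 'rV[R]_n -> R) by exact: measurable_indic_cball.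
apply: (@le_trans _ _ 0%E); last by rewrite lee_fin ltW.
apply: le_trans g0; apply: ge0_le_int => //.
- by apply: measurable_norm_powR; exact: measurable_funM.
- exact: measurable_norm_powR.
move=> x; rewrite normrM; apply: ge0_ler_powR; rewrite ?nnegrE ?mulr_ge0//.
by rewrite indicE; case: (x \in _); rewrite ?normr1 ?normr0 ?mul1r ?mul0r.
Qed.


Lemma powint_indicM_le (A B : set 'rV[R]_n) q (g : 'rV[R]_n -> R) : 0 <= q -> A `<=` B ->
  measurable A -> measurable B -> measurable_fun setT g ->
  (powint mu q (fun x => (\1_A x * g x)%R) <= powint mu q (fun x => (\1_B x * g x)%R))%E.
Proof.
move=> q0 AB mA mB mg.
have mi (X : set 'rV[R]_n) : measurable X -> measurable_fun setT (fun x => \1_X x * g x : R).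
  by move=> mX; apply: measurable_funM => //; exact: measurable_indic.
apply: ge0_le_int => [| |x|x].
- by apply: measurable_norm_powR; exact: mi.
- by apply: measurable_norm_powR; exact: mi.
- exact: powR_ge0.
apply: ge0_ler_powR; rewrite ?nnegrE// !normrM ler_wpM2r//.
rewrite !indicE; have [Ax|Ax] := pselect (A x); last by rewrite (memNset Ax) normr0.
by rewrite !mem_set//; exact: AB.
Qed.

(** The centre slides from [c] to [x] as the radius halves: every cube of the chain contains [x] and
    lies in the initial one, and consecutive centres are within half a radius, as [kernel_step]
    demands. *)
Definition dyadic_center c x k := x + 2^-1 ^+ k *: (c - x).

Lemma dyadic_center_step c x r k : `|x - c| <= r ->
  `|dyadic_center c x k - dyadic_center c x k.+1| <= r * 2^-1 ^+ k / 2.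
Proof.
move=> xc; rewrite /dyadic_center opprD addrACA subrr add0r -scalerBl normrZ distrC.
have -> : 2^-1 ^+ k.+1 - 2^-1 ^+ k = - (2^-1 ^+ k / 2) :> R by rewrite exprSr; field.
rewrite normrN ger0_norm ?divr_ge0 ?exprn_ge0 ?invr_ge0// distrC mulrC.
by rewrite -mulrA ler_wpM2r// divr_ge0 ?exprn_ge0 ?invr_ge0.
Qed.

Lemma dyadic_cball_sub c x r k : `|x - c| <= r ->
  cball (dyadic_center c x k) (r * 2^-1 ^+ k) `<=` cball c r.
Proof.
move=> xc z; rewrite /cball/= => zk.
have h1 : 2^-1 ^+ k <= 1 :> R by rewrite exprn_ile1 ?invr_ge0// invf_le1// ler1n.
rewrite (le_trans (ler_distD (dyadic_center c x k) _ _))//.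
have -> : dyadic_center c x k - c = (1 - 2^-1 ^+ k) *: (x - c).
  by rewrite scalerBl scale1r /dyadic_center -[c - x]opprB scalerN addrAC.
rewrite normrZ ger0_norm ?subr_ge0//.
have := ler_wpM2l (_ : 0 <= 1 - 2^-1 ^+ k) xc; rewrite subr_ge0 => /(_ h1).
by move: zk; move: (2^-1 ^+ k) `|z - _| `|x - c| => h u v; lra.
Qed.

Lemma dyadic_cball_near c x r k z : `|x - c| <= r ->
  cball (dyadic_center c x k) (r * 2^-1 ^+ k) z -> `|x - z| <= 2 * r * 2^-1 ^+ k.
Proof.
move=> xc zk; rewrite distrC (le_trans (ler_distD (dyadic_center c x k) _ _))//.
have -> : `|dyadic_center c x k - x| = 2^-1 ^+ k * `|x - c|.
  by rewrite /dyadic_center addrC addKr normrZ distrC ger0_norm// exprn_ge0 ?invr_ge0.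
have := ler_wpM2l (_ : 0 <= 2^-1 ^+ k) xc; rewrite exprn_ge0 ?invr_ge0// => /(_ isT).
by move: zk; rewrite /cball/=; move: (2^-1 ^+ k) `|z - _| `|x - c| => h u v; lra.
Qed.

Lemma dyadic_mass c x r k : 0 < r -> `|x - c| <= r ->
  I (kernel (dyadic_center c x k) (r * 2^-1 ^+ k)) = I (kernel c r).
Proof.
move=> r0 xc; elim: k => [|k <-].
  by rewrite /dyadic_center expr0 scale1r subrKC mulr1.
rewrite exprSr mulrA; apply/esym/kernel_mass; last exact: dyadic_center_step.
by rewrite mulr_gt0// exprn_gt0// invr_gt0.
Qed.

(** Equal to [2^(n / q - 1)], the ratio of successive bounds in the chain; it is below 1 because
    [q > n]. *)
Definition morrey_ratio q : R := 2^-1 * (2 ^+ n) `^ q^-1.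

Lemma morrey_ratio_gt0 q : 0 < morrey_ratio q.
Proof. by rewrite mulr_gt0 ?invr_gt0// powR_gt0// exprn_gt0. Qed.

Lemma morrey_ratio_lt1 q : n%:R < q -> morrey_ratio q < 1.
Proof.
move=> nq; have q0 : 0 < q by rewrite (le_lt_trans _ nq).
rewrite /morrey_ratio ltr_pdivrMl// mulr1.
rewrite [ltRHS](_ : 2 = (2 `^ q) `^ q^-1); last by rewrite -powRrM divff ?gt_eqF// powRr1.
apply: gt0_ltr_powR; rewrite ?invr_gt0 ?nnegrE ?powR_ge0 ?exprn_ge0//.
have := lt1_powR2 (_ : 0 < q - n%:R); rewrite subr_gt0 => /(_ nq).
by rewrite powRB ?pnatr_eq0 ?implybT// powR_mulrn// ltr_pdivlMr ?exprn_gt0// mul1r.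
Qed.


Lemma scaled_oscillation q E r k : 0 < r -> 0 < E ->
  r * 2^-1 ^+ k * (E / (r * 2^-1 ^+ k) ^+ n) `^ q^-1 =
  r * (E / r ^+ n) `^ q^-1 * morrey_ratio q ^+ k.
Proof.
move=> r0 E0; have rn0 : 0 < r ^+ n by rewrite exprn_gt0.
have -> : E / (r * 2^-1 ^+ k) ^+ n = E / r ^+ n * (2 ^+ n) ^+ k.
  rewrite exprMn invfM mulrA -exprM mulnC exprM !exprVn invrK //.
rewrite powRM ?exprn_ge0// ?divr_ge0 ?(ltW E0) ?(ltW rn0)//.
have -> : ((2 ^+ n) ^+ k) `^ q^-1 = ((2 ^+ n) `^ q^-1) ^+ k :> R.
  by rewrite -powR_mulrn ?exprn_ge0// powRAC powR_mulrn ?powR_ge0.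
by rewrite /morrey_ratio exprMn mulrACA.
Qed.

Lemma kernel_chain (C q E r : R) c x F G N : 1 <= C -> (forall t : R, `|step t| <= C) ->
  1 < q -> 0 < r -> 0 < E -> `|x - c| <= r ->
  continuous F -> (forall i, measurable_fun setT (G i)) -> (forall i, weak_partial i F (G i)) ->
  (forall i, (powint mu q (fun x => (\1_(cball c r) x * G i x)%R) <= E%:E)%E) ->
  `|I (fun z => F z * kernel c r z) -
    I (fun z => F z * kernel (dyadic_center c x N) (r * 2^-1 ^+ N) z)| <=
  n%:R * (C * 2 ^+ n * (2 ^+ n + 1)) * (r * (E / r ^+ n) `^ q^-1) *
  \sum_(k < N) morrey_ratio q ^+ k.
Proof.
move=> C1 stepC q1 r0 E0 xc cF mG wG GE; elim: N => [|N IH].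
  by rewrite /dyadic_center expr0 scale1r subrKC mulr1 big_ord0 mulr0 subrr normr0.
have h0 : 0 < r * 2^-1 ^+ N by rewrite mulr_gt0// exprn_gt0// invr_gt0.
rewrite big_ord_recr/= mulrDr.
rewrite (le_trans (ler_distD (I (fun z => F z * kernel (dyadic_center c x N) (r * 2^-1 ^+ N) z)) _ _))//.
apply: lerD => //; rewrite -[leRHS]mulrA -scaled_oscillation//.
rewrite (_ : r * 2^-1 ^+ N.+1 = r * 2^-1 ^+ N / 2); last by rewrite exprSr mulrA.
apply: (kernel_step C1 stepC q1 h0 E0 (dyadic_center_step N xc) cF mG wG).
move=> i; apply: le_trans (GE i); apply: powint_indicM_le => //.
- by rewrite (le_trans _ (ltW q1)).
- exact: dyadic_cball_sub.
- exact: measurable_cball.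
- exact: measurable_cball.
Qed.

Lemma kernel_approx c x r F (e : R) : 0 < r -> `|x - c| <= r -> continuous F -> 0 < e ->
  exists N, `|I (fun z => F z * kernel (dyadic_center c x N) (r * 2^-1 ^+ N) z) -
              I (kernel c r) * F x| <= e * I (kernel c r).
Proof.
move=> r0 xc cF e0; have := cF x; move=> /(@cvgrPdist_le _ _ _ (nbhs x))/(_ _ e0).
move=> /nbhs_ballP[d /= d0 dP].
have [N rN] : exists N, 2 * r * 2^-1 ^+ N < d.
  have h1 : `|2^-1 : R| < 1 by rewrite ger0_norm ?invr_ge0// invf_lt1// ltr1n.
  have /cvgr0Pnorm_lt/(_ _ d0)[N _ NP] := cvg_geometric (2 * r) h1.
  by exists N; have := NP N (leqnn N); apply: le_lt_trans; rewrite /= ler_norm.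
exists N; have rN0 : 0 < r * 2^-1 ^+ N by rewrite mulr_gt0// exprn_gt0// invr_gt0.
rewrite -(dyadic_mass N r0 xc); set cN := dyadic_center c x N; set s := r * _.
have ck : continuous (kernel cN s) by exact: continuous_kernel.
have sk : csupp (kernel cN s) cN s by exact: csupp_kernel.
have iK := integrable_continuous_csupp ck sk.
have iFK (f : 'rV[R]_n -> R) : continuous f -> mu.-integrable setT (EFin \o (fun z => f z * kernel cN s z)).
  by move=> cf; exact: integrable_continuous_csupp (continuousM_rV cf ck) (csuppM _ sk).
have ce (a : R) : continuous ((fun=> a) : 'rV[R]_n -> R) by exact: cst_continuous.
rewrite [X in _ - X]mulrC -(RintegralZl (F x) measurableT iK) -RintegralB//; [|exact: iFK|exact: (iFK (fun=> F x))].
under eq_Rintegral do rewrite -mulrBl.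
have iD : mu.-integrable setT (EFin \o (fun z => (F z - F x) * kernel cN s z)).
  by apply: (iFK (fun z => F z - F x)); exact: continuousB_rV.
rewrite (le_trans (le_normr_Rintegral measurableT iD))// -RintegralZl//.
apply: le_Rintegral => //.
- exact: (integrable_norm iD).
- exact: (iFK (fun=> e)).
move=> z _; rewrite -[leRHS]/(e * kernel cN s z).
have k0 : 0 <= kernel cN s z by apply: prodr_ge0 => j _; exact: kfac_ge0.
rewrite normrM (ger0_norm k0); have [zs|zs] := pselect (cball cN s z); last first.
  by rewrite (sk z zs) !mulr0 lexx.
rewrite ler_wpM2r// distrC; apply: dP; rewrite -ball_normE/=.
exact: le_lt_trans (dyadic_cball_near xc zs) rN.
Qed.

(** The values at [x] and [y], multiplied by the kernel mass, are both compared with the same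
    integral [A] of [F] against the initial kernel. Each comparison is a geometric series along the
    chain shrinking to that point. *)
Theorem morrey q : (0 < n)%N -> n%:R < q -> exists2 M : R, 0 < M &
  forall F G c r E x y, continuous F -> (forall i, measurable_fun setT (G i)) ->
  (forall i, weak_partial i F (G i)) -> 0 < r -> 0 < E ->
  (forall i, (powint mu q (fun x => (\1_(cball c r) x * G i x)%R) <= E%:E)%E) ->
  `|x - c| <= r -> `|y - c| <= r -> `|F x - F y| <= M * (r * (E / r ^+ n) `^ q^-1).
Proof.
move=> n_gt0 nq; have q1 : 1 < q by rewrite (le_lt_trans _ nq)// ler1n.
have [C C1 stepC] := @step_bounded R.
pose D := n%:R * (C * 2 ^+ n * (2 ^+ n + 1)).
have D0 : 0 < D.
  have C0 : 0 < C by exact: lt_le_trans C1.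
  by rewrite mulr_gt0 ?ltr0n// mulr_gt0// ?mulr_gt0// ?exprn_gt0// ltr_wpDl// exprn_ge0.
pose rho := morrey_ratio q.
have rho0 : 0 < rho by exact: morrey_ratio_gt0.
have rho1 : rho < 1 by exact: morrey_ratio_lt1.
have e4 : 0 < expR (- 4) ^+ n :> R by rewrite exprn_gt0// expR_gt0.
pose M := 2 * (D / (1 - rho)) / expR (- 4) ^+ n.
exists M; first by rewrite divr_gt0// mulr_gt0// divr_gt0// subr_gt0.
move=> F G c r E x y cF mG wG r0 E0 GE.
set a := r * _; have a0 : 0 < a by rewrite mulr_gt0// powR_gt0// divr_gt0// exprn_gt0.
set k := I (kernel c r); set A := I (fun z => F z * kernel c r z).
have ek : expR (- 4) ^+ n <= k by exact: kernel_integral_ge.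
have k0 : 0 < k by exact: lt_le_trans ek.
have close z : `|z - c| <= r -> `|A - k * F z| <= D / (1 - rho) * a.
  move=> zc; apply/ler_addgt0Pl => eps eps0.
  have [N NP] := kernel_approx r0 zc cF (divr_gt0 eps0 k0).
  rewrite divfK ?gt_eqF// in NP.
  have := kernel_chain N C1 stepC q1 r0 E0 zc cF mG wG GE; rewrite -/A -/D -/a -/rho => ch.
  apply: le_trans (le_trans (ler_distD _ _ _) (lerD ch NP)) _; rewrite [leRHS]addrC lerD2r.
  have Da : 0 < D * a by rewrite mulr_gt0.
  rewrite (mulrAC D _ a) (ler_pM2l Da) -[leRHS]mul1r ler_pdivlMr ?subr_gt0// mulrC.
  by rewrite -[1 - rho]opprB mulNr -subrX1 opprB gerBl exprn_ge0// ltW.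
move=> xc yc; have hx := close x xc; have hy := close y yc.
have h : k * `|F x - F y| <= 2 * (D / (1 - rho) * a).
  rewrite -[X in X * _](gtr0_norm k0) -normrM mulrBr (le_trans (ler_distD A _ _))//.
  by rewrite mulr_natl mulr2n lerD// distrC.
have : expR (- 4) ^+ n * `|F x - F y| <= 2 * (D / (1 - rho) * a).
  by apply: le_trans h; rewrite ler_wpM2r.
rewrite -ler_pdivlMl// => /le_trans; apply; rewrite /M le_eqVlt; apply/orP; left; apply/eqP.
by ring.
Qed.

End morrey.

(** * The trace theorem *)

Section Lp_norm.
Context {R : realType} {n : nat}.
Local Notation mu := (@lebesgue_rV R n).
Implicit Types (p : R) (f : 'rV[R]_n -> R) (G : 'rV[R]_n -> 'rV[R]_n).

Lemma Lnorm_powint p f : Lnorm mu p%:E (EFin \o f) = (powint mu p f `^ p^-1)%E.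
Proof. by rewrite unlock. Qed.

Lemma Lfun_powint p f : 0 < p ->
  (f \in Lfun mu p%:E) <-> measurable_fun setT f /\ (powint mu p f < +oo)%E.
Proof.
move=> p0; have E : (powint mu p f < +oo)%E <-> finite_norm mu p%:E f.
  rewrite /finite_norm Lnorm_powint; split=> h.
    by rewrite poweR_lty.
  rewrite -[X in (X < _)%E]poweRe1; last by apply: integral_ge0 => x _; rewrite lee_fin powR_ge0.
  by rewrite -(mulVf (lt0r_neq0 p0)) poweRrM poweR_lty.
split=> [/andP[/set_mem mf /set_mem /E h]|[mf /E h]]; first by split.
by apply/andP; split; apply/mem_set.
Qed.

Lemma measurable_norm_rV G : (forall i, measurable_fun setT (fun x => G x ord0 i)) ->
  measurable_fun setT (fun x => `|G x|).
Proof.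
move=> mG; apply: (@measurableT_comp _ _ _ _ _ _ (fun y : 'rV[R]_n => `|y|) _ G).
  by apply: continuous_measurable_rV => x; exact: norm_continuous.
exact/measurable_fun_rVP.
Qed.

Lemma norm_powR_le_sum p (v : 'rV[R]_n) : 0 < p -> `|v| `^ p <= \sum_i `|v ord0 i| `^ p.
Proof.
move=> p0; set m := \sum_i _; have m0 : 0 <= m by rewrite sumr_ge0// => i _; exact: powR_ge0.
have h : `|v| <= m `^ p^-1.
  apply/rV_norm_leP => [|i]; first exact: powR_ge0.
  rewrite -[leLHS]powRr1// -(divff (lt0r_neq0 p0)) powRrM.
  apply: ge0_ler_powR; rewrite ?nnegrE ?powR_ge0 ?invr_ge0 ?(ltW p0)//.
  by rewrite /m (bigD1 i)//= lerDl sumr_ge0// => j _; exact: powR_ge0.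
have := ge0_ler_powR (ltW p0) (normr_ge0 v) (powR_ge0 _ _) h.
by rewrite -powRrM mulVf ?gt_eqF// powRr1.
Qed.

Lemma powint_norm_le p G : 0 < p -> (forall i, measurable_fun setT (fun x => G x ord0 i)) ->
  (powint mu p (fun x => `|G x|%R) <= \sum_i powint mu p (fun x => G x ord0 i))%E.
Proof.
move=> p0 mG; have mp i := measurable_norm_powR p (mG i).
rewrite /powint -(ge0_int_sum mu _ _ mp (fun i x => powR_ge0 _ _)).
apply: ge0_le_int.
- by apply: measurable_norm_powR; exact: measurable_norm_rV.
- by apply: measurable_sum => i; exact: mp.
- by move=> x; exact: powR_ge0.
by move=> x; rewrite normr_id; exact: norm_powR_le_sum.
Qed.

End Lp_norm.

(** * From a Sobolev extension to the packing condition *)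

Section necessity.
Context {R : realType} {n : nat}.
Local Notation mu := (@lebesgue_rV R n).
Implicit Types (p : R) (f F : 'rV[R]_n -> R) (G : 'rV[R]_n -> 'rV[R]_n).

Lemma packing_term_le (M p q r a w : R) : 0 <= M -> 0 < q -> 0 < p -> 0 < r -> 0 <= a -> 0 <= w ->
  w <= M * (11 * r * (2 ^+ n * a) `^ q^-1) ->
  w `^ p / (2 * r) `^ (p - n%:R) <=
  (M `^ p * (11 / 2) `^ p * (2 ^+ n) `^ (p / q)) * ((2 * r) ^+ n * a `^ (p / q)).
Proof.
move=> M0 q0 p0 r0 a0 w0 wM.
have r20 : 0 < 2 * r by rewrite mulr_gt0.
have na0 : 0 <= 2 ^+ n * a by rewrite mulr_ge0 ?exprn_ge0.
have u0 : 0 <= 11 * r * (2 ^+ n * a) `^ q^-1 by rewrite !mulr_ge0 ?powR_ge0// ltW.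
have h11 : 0 <= 11 / 2 :> R by rewrite divr_ge0.
have wp := ge0_ler_powR (ltW p0) (w0 : w \is Num.nneg) (mulr_ge0 M0 u0 : _ \is Num.nneg) wM.
rewrite ler_pdivrMr ?powR_gt0//; apply: le_trans wp _.
have r11 : 0 <= 11 * r by rewrite mulr_ge0// ltW.
rewrite (powRM _ M0 u0) (powRM _ r11 (powR_ge0 _ _)).
rewrite -powRrM [q^-1 * p]mulrC [(2 ^+ n * a) `^ _]powRM ?exprn_ge0//.
have -> : 11 * r = 11 / 2 * (2 * r) :> R by field.
rewrite [(11 / 2 * _) `^ p]powRM ?(ltW r20)//.
have -> : (2 * r) `^ p = (2 * r) ^+ n * (2 * r) `^ (p - n%:R).
  by rewrite -powR_mulrn ?(ltW r20)// -powRD ?gt_eqF ?implybT// addrC subrK.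
by rewrite le_eqVlt; apply/orP; left; apply/eqP; ring.
Qed.

(* The exponent [q := (n + p) / 2] leaves room for both Morrey's inequality, [n < q],
   and the maximal inequality, [1 < p / q]. *)
Theorem sobolev_packing p : (0 < n)%N -> n%:R < p -> exists2 C : R, 0 < C &
  forall S f F G lam, continuous F -> Lp_gradient p F G -> extends S f F ->
  (powint mu p (fun x => `|G x|%R) <= lam%:E)%E -> packing_bound p S f (C * lam).
Proof.
move=> n_gt0 np; pose q : R := (n%:R + p) / 2.
have nq : n%:R < q by rewrite /q; lra.
have qp : q < p by rewrite /q; lra.
have q0 : 0 < q by exact: le_lt_trans nq.
have p0 : 0 < p by exact: lt_trans qp.
have s1 : 1 < p / q by rewrite ltr_pdivlMr// mul1r.
have [M M0 mor] := morrey n_gt0 nq.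
pose K : R := 3 ^+ n * 2 * 2 `^ (p / q) *
  (2 `^ (p / q - 1) * (2 `^ (p / q - 1) / (2 `^ (p / q - 1) - 1))).
have K0 : 0 < K.
  have h : 1 < 2 `^ (p / q - 1) :> R by apply: lt1_powR2; rewrite subr_gt0.
  by rewrite /K !mulr_gt0 ?exprn_gt0 ?powR_gt0 ?invr_gt0 ?subr_gt0.
pose C0 : R := M `^ p * (11 / 2) `^ p * (2 ^+ n) `^ (p / q).
have C00 : 0 < C0 by rewrite /C0 !mulr_gt0 ?powR_gt0 ?exprn_gt0 ?divr_gt0.
exists (C0 * K); first by rewrite mulr_gt0.
move=> S f F G lam cF [_ gF] fF Glam m Q x y dQ xQ yQ.
have mG i : measurable_fun setT (fun x => G x ord0 i).
  by have [/(Lfun_powint _ p0)[]] := gF i.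
have wG i : weak_partial i F (fun x => G x ord0 i) by have [] := gF i.
have mnG := measurable_norm_rV mG.
pose h z := `|G z| `^ q.
have mh : measurable_fun setT h.
  by have := measurable_norm_powR q mnG; under eq_fun do rewrite normr_id.
have h0 z : 0 <= h z by exact: powR_ge0.
pose c i := Defs.center (Q i); pose r i := Defs.radius (Q i).
have r0 i : 0 < r i by exact: Defs.radius_gt0.
have r11 i : 0 < 11 * r i by rewrite mulr_gt0.
pose Ei i := (\int[mu]_z (\1_(cball (c i) (11 * r i)) z * h z)%:E)%E.
have mi i : measurable_fun setT (\1_(cball (c i) (11 * r i)) : 'rV[R]_n -> R) by exact: measurable_indic_cball.
have mih i : measurable_fun setT (fun z => \1_(cball (c i) (11 * r i)) z * h z) by exact: measurable_funM.
have Ei0 i : (0 <= Ei i)%E.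
  by apply: integral_ge0 => z _; rewrite lee_fin mulr_ge0.
have mGp := measurable_norm_powR p mnG.
(* On a ball [|G|^q <= 1 + |G|^p] because [q < p], and both terms are integrable there. *)
have Eifin i : Ei i \is a fin_num.
  rewrite ge0_fin_numE//.
  apply: (@le_lt_trans _ _ (\int[mu]_z (\1_(cball (c i) (11 * r i)) z + `| `|G z| | `^ p)%:E)%E).
    apply: ge0_le_int => //; [exact: measurable_funD|by move=> z; rewrite mulr_ge0|].
    move=> z; have p00 : 0 <= `| `|G z| | `^ p by exact: powR_ge0.
    rewrite indicE; case: (z \in _); last by rewrite mul0r add0r.
    rewrite mul1r normr_id /h; have [G1|/ltW G1] := leP 1 `|G z|.
      by rewrite ler_wpDl// ler_powR// ltW.
    rewrite ler_wpDr ?powR_ge0//.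
    have := ge0_ler_powR (ltW q0) (normr_ge0 (G z)) (ler01 : (1 : R) \is Num.nneg) G1.
    by rewrite powR1.
  rewrite ge0_intD//.
  by rewrite int_indic_cball ?(ltW (r11 i))// lte_add_pinfty ?ltry// (le_lt_trans Glam)// ltry.
pose a i := fine (Ei i) / (2 * (11 * r i)) ^+ n.
have a0 i : 0 <= a i.
  by rewrite divr_ge0 ?fine_ge0// exprn_ge0// mulr_ge0// ltW.
have dis i j : i != j -> cball (c i) (r i) `&` cball (c j) (r j) = set0.
  by move=> ij; move/trivIsetP : dQ => /(_ i j I I ij).
have ha i : ((a i * (2 * (11 * r i)) ^+ n)%:E <= Ei i)%E.
  by rewrite /a divfK ?fineK// expf_neq0// mulf_neq0// gt_eqF.
have L1 : 1 <= 11 :> R by rewrite ler1n.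
have := maximal_strong r0 L1 s1 dis mh h0 a0 ha.
have -> : (\int[mu]_z (h z `^ (p / q))%:E = powint mu p (fun z => `|G z|%R))%E.
  apply: eq_integral => z _; congr (_%:E).
  by rewrite /h normr_id -powRrM mulrCA divff ?mulr1// gt_eqF.
rewrite -/K => max.
have {}max : \sum_i (2 * r i) ^+ n * a i `^ (p / q) <= K * lam.
  by rewrite -lee_fin (le_trans max)// (EFinM K lam) lee_wpmul2l// lee_fin ltW.
rewrite -mulrA; apply: le_trans (ler_wpM2l (ltW C00) max).
rewrite mulr_sumr; apply: ler_sum => i _; rewrite diam_cube//.
apply: packing_term_le => //; [exact: ltW|exact: r0|].
have [xc xS] := xQ i; have [yc yS] := yQ i.
rewrite -(fF _ xS) -(fF _ yS).
(* Morrey's bound divides by the n-th power of the radius, while [a i] is a mean over the cube of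
   twice that side; hence [2 ^+ n]. *)
have -> : 2 ^+ n * a i = fine (Ei i) / (11 * r i) ^+ n.
  by rewrite /a exprMn; field; rewrite ?expf_neq0// gt_eqF.
have bound (e : R) : 0 < e -> fine (Ei i) <= e ->
    `|F (x i) - F (y i)| <= M * (11 * r i * (e / (11 * r i) ^+ n) `^ q^-1).
  move=> e0 Ee; apply: (mor F (fun j z => G z ord0 j) (c i) (11 * r i)) => //.
  move=> j; apply: (@le_trans _ _ (Ei i)); last by rewrite -[X in (X <= _)%E]fineK// lee_fin.
  apply: ge0_le_int => //.
  - by apply: measurable_norm_powR; exact: measurable_funM.
  move=> z; rewrite normrM indicE; case: (z \in _).
    rewrite normr1 !mul1r /h; apply: ge0_ler_powR; rewrite ?nnegrE// ?(ltW q0)//.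
    exact: coord_le_norm.
  by rewrite normr0 !mul0r powR0// gt_eqF.
have : 0 <= fine (Ei i) by rewrite fine_ge0.
rewrite le_eqVlt => /predU1P[E0|E0]; last exact: bound.
rewrite -E0 mul0r powR0 ?invr_eq0 ?gt_eqF// !mulr0; apply/ler_addgt0Pl => t t0; rewrite addr0.
(* [morrey] asks for a positive energy bound, so a cube with zero energy is treated with arbitrarily
   small ones; this [b] makes the resulting estimate equal to [t]. *)
pose b := t / (M * (11 * r i)).
have Mr0 : 0 < M * (11 * r i) by exact: mulr_gt0.
have b0 : 0 < b by exact: divr_gt0.
have rn0 : 0 < (11 * r i) ^+ n by exact: exprn_gt0.
have e0 : 0 < b `^ q * (11 * r i) ^+ n by rewrite mulr_gt0// powR_gt0.
have := bound _ e0; rewrite -E0 mulfK ?gt_eqF// -powRrM divff ?gt_eqF// powRr1 ?(ltW b0)//.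
have -> : M * (11 * r i * b) = t by rewrite mulrA mulrC divfK ?gt_eqF.
by apply; exact: ltW.
Qed.

End necessity.

(** * From the packing condition to an extension, and comparison of norms *)

Section extension_operator.
Context {R : realType} {n : nat}.
Local Notation mu := (@lebesgue_rV R n).
Implicit Types (p lam M : R) (f F : 'rV[R]_n -> R) (G : 'rV[R]_n -> 'rV[R]_n) (S : set 'rV[R]_n).
Local Notation e_ i := (delta_mx ord0 i : 'rV[R]_n).

Lemma continuous_locally_integrable F : continuous F -> locally_integrable_rV F.
Proof.
move=> cF K cK; have [M [Mr MP]] := compact_bounded cK.
have Kc : K `<=` cball 0 (`|M| + 1).
  by move=> x Kx; rewrite /cball/= subr0; apply: (MP (`|M| + 1)) => //; rewrite (le_lt_trans (ler_norm M))// ltrDl.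
have mK : measurable K.
  rewrite -[K]setCK; apply: measurableC; apply: measurable_rV_open.
  by apply: closed_openC; apply: compact_closed => //; exact: norm_hausdorff.
have [B B0 BP] := continuous_bounded_cball 0 (`|M| + 1) cF.
apply: measurable_bounded_integrable => //.
- apply: (@le_lt_trans _ _ (mu (cball 0 (`|M| + 1)))).
    by apply: le_measure => //; rewrite inE//; exact: measurable_cball.
  have r0 : 0 <= `|M| + 1 by rewrite addr_ge0.
  by rewrite [X in (X < _)%E](lebesgue_rV_cball 0 r0) ltry.
- by apply: measurable_funTS; exact: continuous_measurable_rV.
- exists B; split; first exact: num_real.
  by move=> b /ltW Bb x Kx /=; rewrite (le_trans _ Bb)// BP//; exact: Kc.
Qed.

Lemma Lp_gradient_exists p M F : 1 < p -> continuous F ->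
  (forall i t, 0 < t ->
    (\int[mu]_x (`|F (x + t *: e_ i) - F x| `^ p)%:E <= (M * t `^ p)%:E)%E) ->
  exists2 G, Lp_gradient p F G & (powint mu p (fun x => `|G x|%R) <= (n%:R * M)%:E)%E.
Proof.
move=> p1 cF FM; have p0 : 0 < p by exact: lt_trans p1.
have /choice[g gP] : forall i, exists g, [/\ measurable_fun setT g, (powint mu p g <= M%:E)%E &
    weak_partial i F g] by move=> i; exact: weak_partial_exists p1 cF (FM i).
pose G x : 'rV[R]_n := \row_i g i x.
have GE i : (fun x => G x ord0 i) = g i by apply/funext => x; rewrite mxE.
exists G; first split=> [|i].
- exact: continuous_locally_integrable.
- have [mg gM wg] := gP i; rewrite GE; split => //.
  by apply/(Lfun_powint _ p0); split => //; exact: le_lt_trans gM (ltry _).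
apply: le_trans (powint_norm_le p0 _) _; first by move=> i; rewrite GE; have [] := gP i.
have -> : (n%:R * M)%:E = (\sum_(i < n) M%:E)%E.
  by rewrite sumEFin sumr_const card_ord mulr_natl.
by apply: lee_sum => i _; rewrite GE; have [] := gP i.
Qed.

Lemma sobolev_extension p lam S f : (0 < n)%N -> n%:R < p -> 0 < lam -> closed S ->
  packing_bound p S f lam ->
  exists F, exists G, [/\ continuous F, Lp_gradient p F G, extends S f F &
    (powint mu p (fun x => `|G x|%R) <= (n%:R * (@energy_const R n p * lam))%:E)%E].
Proof.
move=> n_gt0 np lam0 clS pb.
have p1 : 1 < p by rewrite (le_lt_trans _ np)// ler1n.
(* The construction by distances presupposes points of [S]; for the empty set the zero function is
   taken. *)
have [S0|/set0P S0] := eqVneq S set0.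
  have c0 : continuous (cst 0 : 'rV[R]_n -> R) by exact: cst_continuous.
  have [i t t0|G GF GE] := @Lp_gradient_exists p (@energy_const R n p * lam) _ p1 c0.
    rewrite integral0_eq ?lee_fin ?mulr_ge0 ?powR_ge0 ?energy_const_ge0 ?(ltW lam0)//.
    by move=> x _; rewrite subrr normr0 powR0// gt_eqF// (lt_trans ltr01).
  by exists (cst 0), G; split => // x; rewrite S0.
have cF : continuous (ext S f) by exact: (@continuous_extension R n n_gt0 p lam S f np lam0 clS S0 pb).
have [i t t0|G GF GE] := @Lp_gradient_exists p (@energy_const R n p * lam) _ p1 cF.
  exact: global_energy.
by exists (ext S f), G; split => // x Sx; rewrite extS.
Qed.

End extension_operator.

Section norms.
Context {R : realType} {n : nat}.
Local Notation mu := (@lebesgue_rV R n).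
Implicit Types (p lam M : R) (f F : 'rV[R]_n -> R) (G : 'rV[R]_n -> 'rV[R]_n) (S : set 'rV[R]_n).

Lemma powint_gradient_fin p F G : 0 < p -> Lp_gradient p F G ->
  exists2 A : R, 0 <= A & powint mu p (fun x => `|G x|) = A%:E.
Proof.
move=> p0 [_ gF].
have lt : (powint mu p (fun x => `|G x|%R) < +oo)%E.
  apply: le_lt_trans (powint_norm_le p0 _) _.
    by move=> i; have [/(Lfun_powint _ p0)[]] := gF i.
  by apply/lte_sum_pinfty => i _; have [/(Lfun_powint _ p0)[]] := gF i.
have ge : (0 <= powint mu p (fun x => `|G x|%R))%E.
  by apply: integral_ge0 => x _; rewrite lee_fin powR_ge0.
exists (fine (powint mu p (fun x => `|G x|))); first exact: fine_ge0.
by rewrite fineK// ge0_fin_numE.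
Qed.

Lemma trace_norm_le p S f lam C2 : (0 < n)%N -> n%:R < p -> 0 < lam -> closed S ->
  n%:R * @energy_const R n p <= C2 ->
  packing_bound p S f lam -> (trace_norm p S f <= (C2 `^ p^-1 * lam `^ p^-1)%:E)%E.
Proof.
move=> n_gt0 np lam0 clS C2P pb; have p0 : 0 < p by exact: le_lt_trans np.
have [F [G [cF GF fF GM]]] := sobolev_extension n_gt0 np lam0 clS pb.
have [A A0 AE] := powint_gradient_fin p0 GF.
have e0 : 0 <= n%:R * @energy_const R n p by rewrite mulr_ge0// energy_const_ge0.
apply: (@le_trans _ _ (Lnorm mu p%:E (fun x => `|G x|%:E))).
  by apply: ereal_inf_lbound; exists F; split => //; exists G.
rewrite (Lnorm_powint p (fun x => `|G x|)) AE poweR_EFin lee_fin -powRM ?(ltW lam0) ?(le_trans e0)//.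
rewrite AE lee_fin in GM.
apply: ge0_ler_powR; rewrite ?nnegrE ?invr_ge0 ?(ltW p0)//.
  by rewrite mulr_ge0 ?(ltW lam0) ?(le_trans e0).
by rewrite (le_trans GM)// mulrA ler_wpM2r// ltW.
Qed.

(** The packing norm ranges over positive constants, so the value [A = 0] is reached only as a
    limit: the condition holds with [C1 * lam] for every [lam > 0], and the infimum is then at most
    every [t > 0]. *)
Lemma packing_norm_le p S f (C1 A : R) : 0 < p -> 0 < C1 -> 0 <= A ->
  (forall lam, A <= lam -> packing_bound p S f (C1 * lam)) ->
  (packing_norm p S f <= (C1 `^ p^-1 * A `^ p^-1)%:E)%E.
Proof.
move=> p0 C10; have le lam : 0 < lam -> packing_bound p S f (C1 * lam) ->
    (packing_norm p S f <= ((C1 * lam) `^ p^-1)%:E)%E.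
  move=> l0 pb; apply: ereal_inf_lbound; exists (C1 * lam) => //.
  by split => //; exact: mulr_gt0.
rewrite le_eqVlt => /predU1P[<-|A0] pb; last first.
  by rewrite -powRM ?(ltW C10) ?(ltW A0)//; apply: le => //; exact: pb.
rewrite powR0 ?invr_eq0 ?gt_eqF// mulr0; apply/lee_addgt0Pr => t t0; rewrite add0e.
have tp : 0 < t `^ p by exact: powR_gt0.
have -> : t = (C1 * (t `^ p / C1)) `^ p^-1.
  by rewrite mulrC divfK ?gt_eqF// -powRrM divff ?gt_eqF// powRr1// ltW.
by apply: le; [exact: divr_gt0|apply: pb; rewrite ltW// divr_gt0].
Qed.

End norms.

Theorem theorem1p1 (R : realType) (n : nat) (n_gt0 : (0 < n)%N)
    (p : R) (n_lt_p : n%:R < p) :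
  (forall (S : set 'rV[R]_n) (f : 'rV[R]_n -> R), closed S ->
     in_trace p S f <-> exists2 lam : R, 0 < lam & packing_bound p S f lam) /\
  (exists2 C : R, 1 <= C &
     forall (S : set 'rV[R]_n) (f : 'rV[R]_n -> R), closed S ->
       in_trace p S f ->
       (C^-1%:E * trace_norm p S f <= packing_norm p S f)%E /\
       (packing_norm p S f <= C%:E * trace_norm p S f)%E).
Proof.
have p0 : 0 < p by exact: le_lt_trans n_lt_p.
have [C1 C10 nec] := sobolev_packing n_gt0 n_lt_p.
split=> [S f clS|].
  split=> [[F [cF [G GF] fF]]|[lam lam0 pb]]; last first.
    have [F [G [cF GF fF _]]] := sobolev_extension n_gt0 n_lt_p lam0 clS pb.
    by exists F; split => //; exists G.
  have [A A0 AE] := powint_gradient_fin p0 GF.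
  (* [A + 1] instead of [A], since the constant has to be positive even for a null gradient. *)
  exists (C1 * (A + 1)); first by rewrite mulr_gt0// ltr_wpDl.
  by apply: (nec S f F G) => //; rewrite AE lee_fin lerDl.
pose C2 : R := n%:R * @energy_const R n p.
have C20 : 0 <= C2 by rewrite mulr_ge0// energy_const_ge0.
pose C := 1 + C1 `^ p^-1 + C2 `^ p^-1.
have C1C : C1 `^ p^-1 <= C by rewrite /C addrAC lerDr addr_ge0// powR_ge0.
have C2C : C2 `^ p^-1 <= C by rewrite lerDr addr_ge0// powR_ge0.
have oneC : 1 <= C by rewrite /C -addrA lerDl addr_ge0// powR_ge0.
have C0 : 0 < C by exact: lt_le_trans oneC.
exists C => // S f clS _; split.
  apply: le_ereal_inf_tmp => _ [lam [lam0 pb] <-]; rewrite lee_pdivrMl//.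
  apply: le_trans (trace_norm_le n_gt0 n_lt_p lam0 clS (lexx C2) pb) _.
  by rewrite -EFinM lee_fin ler_wpM2r// powR_ge0.
rewrite -lee_pdivrMl//; apply: le_ereal_inf_tmp => _ [F [cF [G GF ->] fF]].
have [A A0 AE] := powint_gradient_fin p0 GF.
rewrite lee_pdivrMl// (Lnorm_powint p (fun x => `|G x|)) AE poweR_EFin -EFinM.
apply: (@le_trans _ _ (C1 `^ p^-1 * A `^ p^-1)%:E).
  apply: packing_norm_le => // lam Alam.
  by apply: (nec S f F G) => //; rewrite AE lee_fin.
by rewrite lee_fin ler_wpM2r// powR_ge0.
Qed.
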